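(* Consider the two-stage linear instrumental variables model described in the context, with $\ell$ instruments, $k$ controls, $n$ observations and $s=n-1-k-\ell\ge 1$. Assume that $\ell\ge 4$ and $p\in\left(0,\,2\frac{\ell-2}{s}\right)$. Let $\hat\beta$ be the control-function shrinkage estimator, i.e. the coefficient on $X^*$ in the linear regression (without intercept) of $Y^*$ on $X^*$ and the control function $X^*-(c(X^* )(X_z^* )',\mathbf 0_s')'$, where $$c(x^* )=\frac{\|x_z^*\|^2}{\|x_z^*\|^2+p\,\|x_r^*\|^2},$$ and let $\hat\beta^{\mathrm{2SLS}}=\frac{(Y_z^* )'X_z^*}{(X_z^* )'X_z^*}$. Then $$\bigl|\mathrm E[\hat\beta\mid Z=z,W=w]-\beta\bigr|<\bigl|\mathrm E[\hat\beta^{\mathrm{2SLS}}\mid Z=z,W=w]-\beta\bigr|$$ provided $\rho\neq 0$ and $\|\mu\|\neq 0$; otherwise (if $\rho=0$ or $\|\mu\|=0$) the two sides are equal.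
   Context: Model: $n$ i.i.d. observations $(Y_i,X_i,Z_i,W_i)$ satisfy $$Y_i=\alpha+X_i\beta+W_i'\gamma+U_i,\qquad X_i=\alpha_X+Z_i'\pi+W_i'\gamma_X+V_i,$$ with $Y_i,X_i\in\mathbb R$, controls $W_i\in\mathbb R^k$, instruments $Z_i\in\mathbb R^\ell$, fixed parameters $\alpha,\alpha_X,\beta\in\mathbb R$, $\gamma,\gamma_X\in\mathbb R^k$, $\pi\in\mathbb R^\ell$, and noise $$\begin{pmatrix}U_i \\ V_i\end{pmatrix}\Big|\,Z_i=z_i,W_i=w_i\ \sim\ \mathcal N\left(\mathbf 0_2,\begin{pmatrix}\sigma^2&\rho\sigma\tau\\ \rho\sigma\tau&\tau^2\end{pmatrix}\right),\qquad \rho\in(-1,1),\ \sigma,\tau>0.$$ Omitting indices denotes the stacked vector/matrix of observations: $Y,X\in\mathbb R^n$, $z\in\mathbb R^{n\times\ell}$, $w\in\mathbb R^{n\times k}$. The matrix $(\mathbf 1,w,z)$ is assumed to have full rank $1+k+\ell\le n-1$, where $\mathbf 1\in\mathbb R^n$ is the all-ones vector. Canonical form: let $q=(q_{\mathbf 1},q_w,q_z,q_r)\in\mathbb R^{n\times n}$ be orthonormal with $q_{\mathbf 1}\in\mathbb R^n$, $q_w\in\mathbb R^{n\times k}$, $q_z\in\mathbb R^{n\times\ell}$, $q_r\in\mathbb R^{n\times s}$, such that $\mathbf 1$ is in the span of $q_{\mathbf 1}$, the columns of $(\mathbf 1,w)$ are in the span of the columns of $(q_{\mathbf 1},q_w)$,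 and the columns of $(\mathbf 1,w,z)$ are in the span of the columns of $(q_{\mathbf 1},q_w,q_z)$. Put $X_z^*=q_z'X$, $X_r^*=q_r'X$, $Y_z^*=q_z'Y$, $Y_r^*=q_r'Y$, $X^*=((X_z^* )',(X_r^* )')'$, $Y^*=((Y_z^* )',(Y_r^* )')'$ and $\mu=q_z'z\pi\in\mathbb R^\ell$. Then, conditionally on $Z=z,W=w$, $$X^*\sim\mathcal N\left(\begin{pmatrix}\mu\\ \mathbf 0_s\end{pmatrix},\tau^2 I_{\ell+s}\right),\qquad Y^*\mid X^*=x^*\ \sim\ \mathcal N\left(x^*\beta+\left(x^*-\begin{pmatrix}\mu\\ \mathbf 0_s\end{pmatrix}\right)\frac{\rho\sigma}{\tau},\ (1-\rho^2)\sigma^2 I_{\ell+s}\right).$$ For $x^*\in\mathbb R^{\ell+s}$, $x_z^*\in\mathbb R^\ell$ denotes its first $\ell$ and $x_r^*\in\mathbb R^s$ its last $s$ coordinates; $\|\cdot\|$ is the Euclidean norm. The estimator $\hat\beta$ is well defined almost surely. *)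

(* Defs.v *)
From HB Require Import structures.
From mathcomp Require Import all_boot all_order all_algebra.
From mathcomp Require Import all_classical all_reals all_analysis.
(* Re-imported for the measurable structures on R and \bar R. *)
From mathcomp Require Import measurable_realfun lebesgue_measure.

Set Implicit Arguments.
Unset Strict Implicit.
Unset Printing Implicit Defensive.

Import Order.TTheory GRing.Theory Num.Theory.
Import numFieldNormedType.Exports.

Local Open Scope classical_set_scope.
Local Open Scope ring_scope.

(* Real matrices carry the product (= Borel) sigma-algebra of their entries. *)
Section matrix_measurable.
Context (R : realType) (m n : nat).

Definition mx_measurable : set (set 'M[R]_(m, n)) :=
  <<s \bigcup_(ij in [set: 'I_m * 'I_n])
        preimage_set_system setT (fun M : 'M[R]_(m, n) => M ij.1 ij.2)
          measurable >>.

Let mx_measurable0 : mx_measurable set0.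
Proof. exact: sigma_algebra0. Qed.

Let mx_measurableC A : mx_measurable A -> mx_measurable (~` A).
Proof. exact: sigma_algebraC. Qed.

Let mx_measurable_bigcup (F : (set 'M[R]_(m, n))^nat) :
  (forall i, mx_measurable (F i)) -> mx_measurable (\bigcup_i F i).
Proof. exact: sigma_algebra_bigcup. Qed.

HB.instance Definition _ := @isMeasurable.Build default_measure_display
  'M[R]_(m, n) mx_measurable mx_measurable0 mx_measurableC mx_measurable_bigcup.

End matrix_measurable.

Section probability_notions.
Context (R : realType) (d d' : measure_display).
Context (T : measurableType d) (E : measurableType d').

(* Taking [A i := setT] outside a subfamily gives the product rule for it. *)
Definition mutually_independent (P : probability T R) (n : nat)
    (O : 'I_n -> T -> E) : Prop :=
  forall A : 'I_n -> set E, (forall i, measurable (A i)) ->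
    fine (P (\bigcap_(i in [set: 'I_n]) (O i @^-1` A i))) =
    \prod_(i < n) fine (P (O i @^-1` A i)).

Definition identically_distributed (P : probability T R) (n : nat)
    (O : 'I_n -> T -> E) : Prop :=
  forall (i j : 'I_n) (A : set E), measurable A ->
    P (O i @^-1` A) = P (O j @^-1` A).

(* [K e] is the conditional probability [P(. | D = e)]: a measurable family
   that disintegrates [P] and, for every [e], is carried by the event
   [D = e]. *)
Definition regular_conditional_probability (P : probability T R)
    (D : T -> E) (K : E -> probability T R) : Prop :=
  [/\ forall A : set T, measurable A ->
        measurable_fun [set: E] (fun e => K e A),
      forall (A : set T) (B : set E), measurable A -> measurable B ->
        P (A `&` D @^-1` B) = (\int[P]_(t in D @^-1` B) K (D t) A)%E
    & forall e : E, K e (D @^-1` [set e]) = 1%E].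

End probability_notions.

Section gaussian.
Context (R : realType).

Definition noise_cov (sigma tau rho : R) : 'M[R]_2 :=
  \matrix_(i < 2, j < 2)
    (if i == j then (if i == 0 then sigma ^+ 2 else tau ^+ 2)
     else rho * sigma * tau).

(* Density of N(0, S) on R^2, for S symmetric positive definite. *)
Definition normal2_pdf (S : 'M[R]_2) (u : R * R) : R :=
  let x : 'cV[R]_2 := \col_(i < 2) (if i == 0 then u.1 else u.2) in
  expR (- (x^T *m invmx S *m x) 0 0 / 2) /
  Num.sqrt ((2 * pi) ^+ 2 * \det S).

Definition has_normal2_law d (T : measurableType d) (Q : probability T R)
    (f : T -> R * R) (S : 'M[R]_2) : Prop :=
  forall A : set (R * R), measurable A ->
    Q (f @^-1` A) =
    (\int[(@lebesgue_measure R \x @lebesgue_measure R)%E]_(u in A)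
        (normal2_pdf S u)%:E)%E.

End gaussian.

Section estimators.
Context (R : realType).

(* The norm [`|x|] on matrices in the library is the sup norm. *)
Definition l2norm (m : nat) (x : 'cV[R]_m) : R :=
  Num.sqrt (\sum_i x i 0 ^+ 2).

(* Coefficients of the regression of [y] on the columns of [D], without
   intercept; the value is irrelevant when [D^T *m D] is singular. *)
Definition ols (m r : nat) (D : 'M[R]_(m, r)) (y : 'cV[R]_m) : 'cV[R]_r :=
  invmx (D^T *m D) *m (D^T *m y).

Context (l s : nat).
Implicit Types x y : 'cV[R]_(l + s).

Definition shrinkage (p : R) x : R :=
  l2norm (usubmx x) ^+ 2 /
  (l2norm (usubmx x) ^+ 2 + p * l2norm (dsubmx x) ^+ 2).

Definition control_function (p : R) x : 'cV[R]_(l + s) :=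
  x - col_mx (shrinkage p x *: usubmx x) 0.

Definition beta_hat (p : R) y x : R :=
  ols (row_mx x (control_function p x)) y (lshift 1 0) 0.

Definition beta_2sls y x : R :=
  ((usubmx y)^T *m usubmx x) 0 0 / ((usubmx x)^T *m usubmx x) 0 0.

End estimators.

Section iv_model.
Context (R : realType) (n k l s : nat).

Definition design_mx (z : 'M[R]_(n, l)) (w : 'M[R]_(n, k)) :
    'M[R]_(n, 1 + k + l) :=
  row_mx (row_mx (const_mx 1) w) z.

Definition canonical_basis (z : 'M[R]_(n, l)) (w : 'M[R]_(n, k))
    (q1 : 'cV[R]_n) (qw : 'M[R]_(n, k)) (qz : 'M[R]_(n, l))
    (qr : 'M[R]_(n, s)) : Prop :=
  let q : 'M[R]_(n, 1 + k + l + s) :=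
    row_mx (row_mx (row_mx q1 qw) qz) qr in
  (* Column spans, as row spaces of transposes. *)
  [/\ q^T *m q = 1%:M,
      ((const_mx 1 : 'cV[R]_n)^T <= q1^T)%MS,
      ((row_mx (const_mx 1 : 'cV[R]_n) w)^T <= (row_mx q1 qw)^T)%MS
    & ((design_mx z w)^T <= (row_mx (row_mx q1 qw) qz)^T)%MS].

Definition canonical_form (qz : 'M[R]_(n, l)) (qr : 'M[R]_(n, s))
    (x : 'cV[R]_n) : 'cV[R]_(l + s) :=
  col_mx (qz^T *m x) (qr^T *m x).

Section model.
Context d (T : measurableType d) (P : probability T R).

(* [Y t], [X t], [Z t], [W t], [U t], [V t] are the stacked observations and
   noise, observation [i] being row [i].  [K (z, w)] is the conditional
   probability given [Z = z] and [W = w]. *)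
Definition iv_model (Y X : {RV P >-> 'cV[R]_n}) (Z : {RV P >-> 'M[R]_(n, l)})
    (W : {RV P >-> 'M[R]_(n, k)}) (U V : {RV P >-> 'cV[R]_n})
    (K : 'M[R]_(n, l) * 'M[R]_(n, k) -> probability T R)
    (alpha alphaX beta : R) (gamma gammaX : 'cV[R]_k) (ppi : 'cV[R]_l)
    (sigma tau rho : R) : Prop :=
  let obs (i : 'I_n) (t : T) : R * R * 'rV[R]_l * 'rV[R]_k :=
    (Y t i 0, X t i 0, row i (Z t), row i (W t)) in
  let noise (i : 'I_n) (t : T) : R * R := (U t i 0, V t i 0) in
  [/\ forall t i,
        Y t i 0 = alpha + X t i 0 * beta + (row i (W t) *m gamma) 0 0 + U t i 0,
      forall t i,
        X t i 0 = alphaX + (row i (Z t) *m ppi) 0 0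
                  + (row i (W t) *m gammaX) 0 0 + V t i 0,
      mutually_independent P obs /\ identically_distributed P obs,
      regular_conditional_probability P (fun t => (Z t, W t)) K
    & forall zw, mutually_independent (K zw) noise /\
        forall i, has_normal2_law (K zw) (noise i) (noise_cov sigma tau rho)].

End model.
End iv_model.

(* Main.v *)
Require Import Defs.
From HB Require Import structures.
From mathcomp Require Import all_boot all_order all_algebra.
From mathcomp Require Import all_classical all_reals all_analysis.
From mathcomp Require Import measurable_realfun lebesgue_measure.
From mathcomp Require Import ring lra.

Set Implicit Arguments.
Unset Strict Implicit.
Unset Printing Implicit Defensive.

Import Order.TTheory GRing.Theory Num.Theory.
Import numFieldNormedType.Exports.

Local Open Scope classical_set_scope.
Local Open Scope ring_scope.

(** Conditionally on the design, write x = mu + q_z^T V and r = q_r^T V for the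
    two blocks of X*, a = |x|^2, b = |r|^2, and split the structural noise as
    U = kappa V + e with kappa = rho sigma / tau, so that e has mean zero and is
    independent of V.  Solving the two-by-two normal equations
    ([beta_hatE], [beta_hat_momentsE]) gives, off a null set,

      beta_2sls - beta = x.u_z / a,
      beta_hat - beta  = x.u_z / a + p (b x.u_z - a r.u_r) / a^2

    with u_z = q_z^T U and u_r = q_r^T U.  Substitute U = kappa V + e: the terms
    in e are e_i times integrable functions of V and average out, and the terms
    in kappa V simplify because x.(q_z^T V) = a - x.mu.  With

      B2 = E[(a - x.mu) / a]   and   M = E[x.mu / a^2],

    the two biases are kappa B2 and kappa (B2 - p E[b x.mu / a^2])
    ([err_2sls_expectation], [err_hat_expectation]), and
    E[b x.mu / a^2] = s tau^2 M since r is centred, has s components of variance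
    tau^2 and is independent of x ([residual_moment]).  Everything then
    rests on two inequalities.

    - (l - 2) tau^2 M <= B2 ([inv4_radial_le]).  Stein's identity for the field
      x / (a + eps) bounds its radial moment below by (l - 2) tau^2 E[1/(a + eps)];
      for x / (a + eps)^2 the divergence is nonnegative because l >= 4, whence
      E[x.mu / (a + eps)^2] <= E[a / (a + eps)^2] <= E[1 / (a + eps)].  Let eps
      tend to 0.
    - 0 < M when mu is nonzero ([inv4_moment_gt0]).  Put
      F(eps) = E[x.mu / (a + eps)^2].  Stein's identity in the direction mu is
      the differential equation F = |mu|^2 E[(a + eps)^-2] + 2 tau^2 F', so
      exp(- eps / (2 tau^2)) F(eps) is strictly decreasing; as it vanishes at
      infinity it is positive, and F(eps) tends to M.

    Hence 0 < p s tau^2 M < 2 (l - 2) tau^2 M <= 2 B2, which is exactly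
    |B2 - p s tau^2 M| < B2.  If rho = 0 then kappa = 0, and if mu = 0 then
    M = 0; the biases agree in both cases.

    Stein's identity is applied to one coordinate V_i at a time
    ([stein_coordinate]), with the other coordinates frozen by Fubini
    ([expectation_coordinate_eq0]), and summed against columns of q_z and q_r
    ([stein_wprod]); orthonormality of these columns takes the place of the joint
    normal law of (q_z^T V, q_r^T V).  The shift eps > 0 keeps the fields
    smooth and bounded by affine functions.  The same identity, with the powers 2
    and 3 of 1/sqrt(a + eps), bounds E[(a + eps)^-1] and E[(a + eps)^(-3/2)]
    uniformly in eps ([wz2_le], [wz3_le]), which is what allows eps to tend
    to 0. *)

(** * Measurability of matrix-valued functions *)

Definition bundle_mfun (d d' : measure_display) (T : measurableType d)
    (E : measurableType d') (f : T -> E) (mf : measurable_fun setT f) :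
    {mfun T >-> E} :=
  HB.pack f (isMeasurableFun.Build _ _ _ _ f mf).

Section matrix_measurability.
Context (R : realType).

Lemma measurable_entry m n (i : 'I_m) (j : 'I_n) :
  measurable_fun [set: 'M[R]_(m, n)] (fun M => M i j).
Proof.
move=> _ A mA; rewrite setTI.
apply: sub_sigma_algebra; exists (i, j) => //=; exists A => //.
by rewrite setTI.
Qed.

Lemma measurable_fun_entry d (T : measurableType d) m n (f : T -> 'M[R]_(m, n))
    i j :
  measurable_fun setT f -> measurable_fun setT (fun t => f t i j).
Proof.
by move=> mf; apply: (measurableT_comp (f := fun M : 'M[R]_(m, n) => M i j));
  first exact: measurable_entry.
Qed.

Lemma measurable_fun_mx d (T : measurableType d) m n (f : T -> 'M[R]_(m, n)) :
  (forall i j, measurable_fun [set: T] (fun t => f t i j)) ->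
  measurable_fun [set: T] f.
Proof.
move=> mf; apply: (measurability
   (\bigcup_(ij in [set: 'I_m * 'I_n])
        preimage_set_system setT (fun M : 'M[R]_(m, n) => M ij.1 ij.2)
          measurable)) => //.
move=> _ [_ [[i j] _ [A mA <-]] <-].
by rewrite !setTI -[X in measurable X]setTI; exact: (mf i j).
Qed.

(** A generating family closed under intersection: independence need only be
    tested on it. *)
Definition boxes n : set (set 'cV[R]_n) :=
  [set [set y : 'cV[R]_n | forall j, A j (y j 0)] |
       A in [set A : 'I_n -> set R | forall j, measurable (A j)]].

Lemma boxes_setI n : setI_closed (@boxes n).
Proof.
move=> _ _ [A mA <-] [B mB <-]; exists (fun j => A j `&` B j).
  by move=> j; exact: measurableI.
apply/seteqP; split=> y /=; first by move=> AB; split=> j; have [] := AB j.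
by move=> [Ay By] j; split.
Qed.

Lemma boxes_setT n : @boxes n setT.
Proof. by exists (fun=> setT) => //=; apply/seteqP; split. Qed.

Lemma boxes_measurable n : @boxes n `<=` measurable.
Proof.
move=> _ [A mA <-].
rewrite (_ : mkset _ = \bigcap_(j in [set: 'I_n]) ((fun y : 'cV[R]_n => y j 0) @^-1` A j)).
  apply: fin_bigcap_measurable => // j _.
  by rewrite -[X in measurable X]setTI; exact: measurable_entry.
by apply/seteqP; split=> y /= h j *; apply: h.
Qed.

Lemma measurable_boxes n (S : set 'cV[R]_n) : measurable S -> <<s @boxes n >> S.
Proof.
apply: smallest_sub; first exact: smallest_sigma_algebra.
move=> _ [[i j] _ [A mA <-]]; apply: sub_sigma_algebra.
exists (fun k => if k == i then A else setT).
  by move=> k /=; case: ifP.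
rewrite setTI /= (ord1 j); apply/seteqP; split=> y /=.
  by move/(_ i); rewrite eqxx.
by move=> Ay k; case: eqP => // ->.
Qed.

End matrix_measurability.

(** * Independence and product laws *)

Section product_law.
Context (R : realType) (d d1 d2 : measure_display) (T : measurableType d).
Context (E1 : measurableType d1) (E2 : measurableType d2).
Context (Q : probability T R) (X : {RV Q >-> E1}) (Y : {RV Q >-> E2}).
Context (G : set (set E2)).
Hypotheses (Gm : G `<=` measurable) (mG : forall S, measurable S -> <<s G >> S).
Hypotheses (GI : setI_closed G) (GT : G setT).
Hypothesis indep : forall A S, measurable A -> G S ->
  Q (X @^-1` A `&` Y @^-1` S) = (Q (X @^-1` A) * Q (Y @^-1` S))%E.

(** For fixed [A] both sides are finite measures in [S] that agree on a
    pi-system generating the sigma-algebra. *)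
Lemma indep_from_pi_system A S : measurable A -> measurable S ->
  Q (X @^-1` A `&` Y @^-1` S) = (Q (X @^-1` A) * Q (Y @^-1` S))%E.
Proof.
move=> mA mS.
have mXA : measurable (X @^-1` A).
  by rewrite -[X in measurable X]setTI; exact: measurable_funP.
have mY : measurable_fun [set: T] Y by exact: measurable_funP.
pose m1' : {measure set E2 -> \bar R} := pushforward (mrestr Q mXA) Y.
pose m1 := m1' mY.
have c0 : 0 <= fine (Q (X @^-1` A)) by exact: fine_ge0.
pose m2 : {measure set E2 -> \bar R} := mscale (NngNum c0) (distribution Q Y).
have := @g_sigma_algebra_measure_unique _ R E2 G Gm (fun=> setT) _ _ m1 m2 GI.
have m1E B : m1 B = Q (X @^-1` A `&` Y @^-1` B).
  by rewrite /m1 /m1' /pushforward /mrestr/= setIC.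
have m2E B : m2 B = (Q (X @^-1` A) * Q (Y @^-1` B))%E.
  transitivity ((fine (Q (X @^-1` A)))%:E * Q (Y @^-1` B))%E; first by [].
  by rewrite fineK// fin_num_measure.
rewrite -m1E -m2E; apply => //; last exact: mG.
- by apply/seteqP; split=> // x _; exists 0%N.
- by move=> B GB; rewrite m1E m2E; exact: indep.
- by move=> _; rewrite m1E preimage_setT setIT ltey_eq fin_num_measure.
Qed.

Let measurable_pair_XY : measurable_fun [set: T] (fun t => (X t, Y t)).
Proof. by apply: measurable_fun_pair; exact: measurable_funP. Qed.

Let XY : {RV Q >-> (E1 * E2)%type} := bundle_mfun measurable_pair_XY.

Lemma law_pair_product C : measurable C ->
  (distribution Q X \x distribution Q Y)%E C = distribution Q XY C.
Proof.
by apply: product_measure_unique => A B mA mB; exact: indep_from_pi_system.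
Qed.

Lemma ge0_integral_indep_pair (F : E1 * E2 -> \bar R) :
  measurable_fun setT F -> (forall x, 0 <= F x)%E ->
  (\int[Q]_t F (X t, Y t) =
   \int[distribution Q Y]_y \int[distribution Q X]_x F (x, y))%E.
Proof.
move=> mF F0; rewrite -fubini_tonelli2//.
rewrite (eq_measure_integral (distribution Q XY))//; last first.
  by move=> A mA _; exact: law_pair_product.
by rewrite ge0_integral_distribution.
Qed.

Lemma integral_indep_pair (F : E1 * E2 -> \bar R) :
  measurable_fun setT F -> Q.-integrable setT (fun t => F (X t, Y t)) ->
  (distribution Q X \x distribution Q Y)%E.-integrable setT F /\
  (\int[Q]_t F (X t, Y t) =
   \int[distribution Q Y]_y \int[distribution Q X]_x F (x, y))%E.
Proof.
move=> mF iF.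
have iF' : (distribution Q X \x distribution Q Y)%E.-integrable setT F.
  apply/integrableP; split => //.
  rewrite fubini_tonelli2//; last exact: measurableT_comp.
  rewrite -(@ge0_integral_indep_pair (fun x => `|F x|%E))//.
    by case/integrableP : iF.
  exact: measurableT_comp.
split => //; rewrite (integral21_prod_meas1 iF').
rewrite (eq_measure_integral (distribution Q XY))//; last first.
  by move=> A mA _; exact: law_pair_product.
by rewrite integral_distribution.
Qed.

End product_law.

(** * Integrability of real-valued functions *)

Section real_integrable.
Context (R : realType) (d : measure_display) (T : measurableType d).
Context (mu : {measure set T -> \bar R}).
Implicit Types f g : T -> R.

Lemma rintegrableD f g : mu.-integrable setT (EFin \o f) ->
  mu.-integrable setT (EFin \o g) ->
  mu.-integrable setT (EFin \o (fun x => f x + g x)).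
Proof. by move=> fi gi; exact: (integrableD measurableT fi gi). Qed.

Lemma rintegrableB f g : mu.-integrable setT (EFin \o f) ->
  mu.-integrable setT (EFin \o g) ->
  mu.-integrable setT (EFin \o (fun x => f x - g x)).
Proof. by move=> fi gi; exact: (integrableB measurableT fi gi). Qed.

Lemma rintegrableZ c f : mu.-integrable setT (EFin \o f) ->
  mu.-integrable setT (EFin \o (fun x => c * f x)).
Proof. by move=> fi; exact: (integrableZl measurableT c fi). Qed.

Lemma rintegrable_sum (I : Type) (r : seq I) (F : I -> T -> R) :
  (forall i, mu.-integrable setT (EFin \o F i)) ->
  mu.-integrable setT (EFin \o (fun x => \sum_(i <- r) F i x)).
Proof.
move=> Fi; elim: r => [|i r IH].
  apply: eq_integrable (integrable0 mu setT) => //.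
  by move=> x _ /=; rewrite big_nil.
apply: eq_integrable (rintegrableD (Fi i) IH) => //.
by move=> x _ /=; rewrite big_cons.
Qed.

Lemma rintegrable_le f g : measurable_fun setT f ->
  mu.-integrable setT (EFin \o g) -> (forall x, `|f x| <= g x) ->
  mu.-integrable setT (EFin \o f).
Proof.
move=> mf gi fg; apply: le_integrable gi => //; first exact/measurable_EFinP.
by move=> x _; rewrite /= lee_fin (le_trans (fg x))// ler_norm.
Qed.

Lemma Rintegral_sum (I : Type) (r : seq I) (F : I -> T -> R) :
  (forall i, mu.-integrable setT (EFin \o F i)) ->
  \int[mu]_x (\sum_(i <- r) F i x) = \sum_(i <- r) \int[mu]_x F i x.
Proof.
move=> Fi; elim: r => [|i r IH].
  rewrite big_nil; under eq_Rintegral do rewrite big_nil.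
  by rewrite Rintegral_cst// mul0r.
rewrite big_cons; under eq_Rintegral do rewrite big_cons.
by rewrite RintegralD// ?IH//; exact: rintegrable_sum.
Qed.

End real_integrable.

(** * Integration against a measure given by a density *)

Section density.
Context (R : realType) (d : measure_display) (T : measurableType d).
Context (mu : {sigma_finite_measure set T -> \bar R}).
Context (nu : {finite_measure set T -> \bar R}) (g : T -> R).
Hypotheses (mg : measurable_fun setT g) (g0 : forall x, 0 <= g x).
Hypothesis nuE : forall A, measurable A ->
  nu A = (\int[mu]_(x in A) (g x)%:E)%E.

Let mgE : measurable_fun setT (EFin \o g). Proof. exact/measurable_EFinP. Qed.

Lemma density_dominates : nu `<< mu.
Proof.
apply/null_content_dominatesP => A mA A0; rewrite nuE//.
by apply: null_set_integral => //; exact: measurable_funTS.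
Qed.

Lemma density_integrable : mu.-integrable setT (EFin \o g).
Proof.
apply/integrableP; split => //.
under eq_integral do rewrite /= ger0_norm//.
by rewrite -nuE// ltey_eq fin_num_measure.
Qed.

(** A density is almost everywhere the Radon-Nikodym derivative, so the change
    of variables known for the latter transfers to any given density. *)
Let RNE : ae_eq mu setT (EFin \o g) (Radon_Nikodym_SigmaFinite.f nu mu).
Proof.
apply: integral_ae_eq => //.
- exact: density_integrable.
- by apply: (measurable_int mu); apply: Radon_Nikodym_SigmaFinite.f_integrable;
    exact: density_dominates.
- move=> A _ mA; rewrite -Radon_Nikodym_SigmaFinite.f_integral//.
    by rewrite nuE.
  exact: density_dominates.
Qed.

Lemma ge0_integral_density (F : T -> \bar R) : measurable_fun setT F ->
  (forall x, 0 <= F x)%E ->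
  (\int[nu]_x F x = \int[mu]_x (F x * (g x)%:E))%E.
Proof.
move=> mF F0.
rewrite -(Radon_Nikodym_SigmaFinite.change_of_variables density_dominates)//.
apply: ae_eq_integral => //.
- apply: emeasurable_funM => //; apply: (measurable_int mu).
  exact/Radon_Nikodym_SigmaFinite.f_integrable/density_dominates.
- exact: emeasurable_funM.
- by apply: ae_eqe_mul2l; apply: ae_eq_sym; exact: RNE.
Qed.

Lemma integral_density (F : T -> \bar R) : nu.-integrable setT F ->
  mu.-integrable setT (fun x => F x * (g x)%:E)%E /\
  (\int[nu]_x F x = \int[mu]_x (F x * (g x)%:E))%E.
Proof.
move=> iF; have mF := measurable_int _ iF.
have iFg : mu.-integrable setT (fun x => F x * (g x)%:E)%E.
  apply/integrableP; split; first exact: emeasurable_funM.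
  rewrite (eq_integral (fun x => `|F x| * (g x)%:E))%E; last first.
    by move=> x _; rewrite abseM /= ger0_norm.
  rewrite -ge0_integral_density//; first by case/integrableP : iF.
  exact: measurableT_comp.
split => //.
(* Multiplying by a nonnegative density commutes with positive and negative
   parts. *)
have maxM (a : \bar R) x : (maxe (a * (g x)%:E) 0 = maxe a 0 * (g x)%:E)%E.
  have gx0 : (0 <= (g x)%:E)%E by rewrite lee_fin.
  by rewrite (maxe_pMl a 0%E _ gx0)// mul0e.
rewrite integralE [RHS]integralE (ge0_integral_density (measurable_funepos mF))//.
rewrite (ge0_integral_density (measurable_funeneg mF))//.
congr (_ - _)%E; apply: eq_integral => x _.
- by rewrite !funeposE maxM.
- by rewrite !funenegE -mulNe maxM.
Qed.

End density.

(** * Stein's identity for a normal law on the line *)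

Section normal_stein.
Context (R : realType).
Notation lam := (@lebesgue_measure R).
Implicit Types m s : R.

Lemma is_derive_normal_pdf m s (v : R) : s != 0 ->
  is_derive v 1 (normal_pdf m s) (- ((v - m) / s ^+ 2) * normal_pdf m s v).
Proof.
move=> s0; rewrite normal_pdfE//.
rewrite /normal_peak; set k := (Num.sqrt _)^-1.
rewrite (_ : (fun x : R => _) = k *: (expR \o (fun x => - (x - m) ^+ 2 / (s ^+ 2 *+ 2)))); last first.
  by apply/funext => x.
apply: is_derive_eq.
rewrite /GRing.scale/= /normal_fun.
by field.
Qed.

(** With y = (v - m)^2 / (4 s^2) this is y e^(-2y) <= e^(-y): half of the
    exponent absorbs the square and leaves a normal density of twice the
    variance.  Second moments are thereby reduced to integrability of a
    density. *)
Lemma sqr_normal_pdf_le m s v : s != 0 ->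
  (v - m) ^+ 2 * normal_pdf m s v <=
  4 * s ^+ 2 * normal_peak s / normal_peak (Num.sqrt 2 * s) *
    normal_pdf m (Num.sqrt 2 * s) v.
Proof.
move=> s0.
have s20 : Num.sqrt 2 * s != 0 by rewrite mulf_neq0// sqrtr_eq0 -ltNge.
rewrite !normal_pdfE// mulrCA mulrA.
rewrite [leRHS](_ : _ = normal_peak s * (4 * s ^+ 2 * normal_fun m (Num.sqrt 2 * s) v)); last first.
  have := normal_peak_gt0 s20 => /lt0r_neq0 ?.
  by field.
rewrite -mulrA ler_pM2l ?normal_peak_gt0//.
rewrite /normal_fun exprMn sqr_sqrtr//.
set z := (v - m) ^+ 2 / (4 * s ^+ 2).
have s2 : 0 < s ^+ 2 by rewrite exprn_even_gt0.
rewrite (_ : - _ / (_ *+ 2) = - z - z); last first.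
  by rewrite /z -mulr_natr; field.
rewrite (_ : - _ / (2 * _ *+ 2) = - z); last by rewrite /z -mulr_natr; field.
rewrite expRD mulrA ler_pM2r ?expR_gt0//.
rewrite (_ : (v - m) ^+ 2 = 4 * s ^+ 2 * z); last by rewrite /z; field.
rewrite -[leLHS]mulrA -[leRHS]mulr1 ler_pM2l; last by rewrite mulr_gt0.
rewrite expRN -ler_pdivlMr ?invr_gt0 ?expR_gt0// invrK mul1r.
by apply: le_trans (expR_ge1Dx _); rewrite lerDr.
Qed.

Lemma integrable_normal_moment2 m s : s != 0 ->
  lam.-integrable setT (EFin \o (fun v => (1 + (v - m) ^+ 2) * normal_pdf m s v)).
Proof.
move=> s0; set K := 4 * s ^+ 2 * normal_peak s / normal_peak (Num.sqrt 2 * s).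
apply: (@rintegrable_le _ _ _ lam _
  (fun v => normal_pdf m s v + K * normal_pdf m (Num.sqrt 2 * s) v)).
- apply/measurable_funM; last exact: measurable_normal_pdf.
  by apply: measurable_funD => //; apply: measurable_funX; apply: measurable_funB.
- apply: rintegrableD; first exact: integrable_normal_pdf.
  by apply: rintegrableZ; exact: integrable_normal_pdf.
- move=> v; rewrite ger0_norm; last first.
    by rewrite mulr_ge0 ?normal_pdf_ge0// addr_ge0// sqr_ge0.
  by rewrite mulrDl mul1r lerD2l sqr_normal_pdf_le.
Qed.

(** The integrand is the derivative of - s^2 f times the density.  On
    [m - n, m + n] the integral is a difference of two boundary terms of order
    1/n, while dominated convergence sends it to the integral over the line. *)
Lemma normal_stein m s (f df : R -> R) (C : R) : s != 0 ->
  (forall v : R, is_derive v 1 f (df v)) -> continuous df ->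
  (forall v, `|f v| <= C * (1 + `|v - m|)) ->
  (forall v, `|df v| <= C * (1 + `|v - m|)) ->
  let g v := ((v - m) * f v - s ^+ 2 * df v) * normal_pdf m s v in
  lam.-integrable setT (EFin \o g) /\ (\int[lam]_v (g v)%:E = 0)%E.
Proof.
move=> s0 fdf cdf fC dfC g.
have C0 : 0 <= C.
  by have := fC m; rewrite subrr normr0 addr0 mulr1; apply: le_trans.
pose G v := - s ^+ 2 * (f v * normal_pdf m s v).
have GG (v : R) : is_derive v 1 G (g v).
  have ? := is_derive_normal_pdf m v s0.
  apply: is_derive_eq; rewrite /GRing.scale/= /g; field.
  by [].
have cg : continuous g.
  have cf : continuous f.
    by move=> v; apply/differentiable_continuous/derivable1_diffP.
  move=> v; apply: cvgM; last exact: continuous_normal_pdf.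
  apply: cvgB; apply: cvgM; [|exact: cf|exact: cvg_cst|exact: cdf].
  by apply: cvgB; [exact: cvg_id|exact: cvg_cst].
have mg : measurable_fun setT g by exact: continuous_measurable_fun.
(* From (1 + t) <= 2 (1 + t^2) and t (1 + t) <= 2 (1 + t^2) for t >= 0. *)
pose K := C * (2 + 2 * s ^+ 2).
have gb v : `|g v| <= K * ((1 + (v - m) ^+ 2) * normal_pdf m s v).
  rewrite /g normrM (ger0_norm (normal_pdf_ge0 _ _ _)) mulrA.
  rewrite ler_wpM2r ?normal_pdf_ge0//.
  apply: le_trans (ler_normB _ _) _.
  rewrite [`|(v - m) * _|]normrM [`|s ^+ 2 * _|]normrM (ger0_norm (sqr_ge0 s)).
  set t := `|v - m|; have t0 : 0 <= t by exact: normr_ge0.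
  have -> : (v - m) ^+ 2 = t ^+ 2 by rewrite /t -normrX ger0_norm// sqr_ge0.
  have h : 1 + t <= 2 * (1 + t ^+ 2) by nra.
  have h1 : t * (1 + t) <= 2 * (1 + t ^+ 2) by nra.
  have h2 := fC v; have h3 := dfC v; rewrite -/t in h2 h3.
  have e1 : t * `|f v| <= C * (2 * (1 + t ^+ 2)).
    apply: le_trans (ler_wpM2l t0 h2) _.
    by rewrite mulrCA ler_wpM2l.
  have e2 : s ^+ 2 * `|df v| <= s ^+ 2 * (C * (2 * (1 + t ^+ 2))).
    rewrite ler_wpM2l ?sqr_ge0//; apply: le_trans h3 _.
    by rewrite ler_wpM2l.
  apply: le_trans (lerD e1 e2) _; rewrite /K le_eqVlt; apply/orP; left.
  by apply/eqP; ring.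
have iK : lam.-integrable setT
    (EFin \o (fun v => K * ((1 + (v - m) ^+ 2) * normal_pdf m s v))).
  by apply: rintegrableZ; exact: integrable_normal_moment2.
have ig : lam.-integrable setT (EFin \o g).
  exact: rintegrable_le iK _.
split => //.
pose I (n : nat) : set R := [set` `[m - n.+1%:R, m + n.+1%:R]].
have [] := @dominated_convergence _ _ _ lam _ measurableT
  (fun n => (EFin \o g) \_ (I n)) (EFin \o g)
  (EFin \o (fun v => K * ((1 + (v - m) ^+ 2) * normal_pdf m s v))).
- move=> n; apply/(measurable_restrictT _ _).1 => //.
    exact: measurable_itv.
  by apply/measurable_EFinP/measurable_funTS.
- exact/measurable_EFinP.
- apply: aeW => v _.
  apply: cvg_near_cst.
  have : `|v - m| < (Num.truncn `|v - m|).+1%:R by exact: truncnS_gt.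
  set N := Num.truncn _ => vN.
  exists N => // n /= Nn; rewrite patchE ifT// inE /I /= in_itv/=.
  have : N.+1%:R <= n.+1%:R :> R by rewrite ler_nat ltnS.
  move=> /(lt_le_trans vN); rewrite ltr_norml => /andP[h1 h2].
  by apply/andP; split; lra.
- exact: iK.
- apply: aeW => v n _; rewrite patchE; case: ifP => _ /=.
    by rewrite lee_fin gb.
  by rewrite normr0 lee_fin (le_trans _ (gb v)).
move=> _ _ cvgI.
have IE n : (\int[lam]_x ((EFin \o g) \_ (I n)) x)%E =
    (G (m + n.+1%:R) - G (m - n.+1%:R))%:E.
  rewrite -integral_mkcond /= /I.
  rewrite (@continuous_FTC2 _ g G)//.
  - by rewrite ltrD2l (@lt_trans _ _ 0)// ?oppr_lt0.
  - exact: continuous_subspaceT.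
  - split.
    + by move=> x _; exact: ex_derive.
    + apply: cvg_at_right_filter.
      by apply/differentiable_continuous/derivable1_diffP; exact: ex_derive.
    + apply: cvg_at_left_filter.
      by apply/differentiable_continuous/derivable1_diffP; exact: ex_derive.
  - by move=> x _; rewrite derive1E derive_val.
(* The boundary terms use e^(-y) <= 1/y at y = n^2 / (2 s^2), against the
   linear growth of [f]. *)
pose L := s ^+ 2 * (C * (2 * (normal_peak s * (2 * s ^+ 2)))).
have s2ge : 0 <= s ^+ 2 by exact: sqr_ge0.
have L0 : 0 <= L.
  rewrite /L; apply: mulr_ge0 => //; apply: mulr_ge0 => //.
  apply: mulr_ge0 => //; apply: mulr_ge0; first exact: normal_peak_ge0.
  exact: mulr_ge0.
have Gb v n : `|v - m| = n.+1%:R -> `|G v| <= L * (n.+1%:R)^-1.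
  move=> vn; rewrite /G mulNr normrN normrM (ger0_norm (sqr_ge0 s)).
  rewrite /L -[leRHS]mulrA ler_wpM2l//.
  rewrite normrM (ger0_norm (normal_pdf_ge0 _ _ _)).
  have n0 : 0 < n.+1%:R :> R by [].
  have n1 : 1 <= n.+1%:R :> R by rewrite ler1n.
  have h := fC v; rewrite vn in h.
  apply: le_trans (ler_wpM2r (normal_pdf_ge0 _ _ _) h) _.
  rewrite -[leLHS]mulrA -[leRHS]mulrA ler_wpM2l// normal_pdfE//.
  apply: (@le_trans _ _ (2 * n.+1%:R * (normal_peak s * normal_fun m s v))).
    by rewrite ler_wpM2r ?mulr_ge0 ?normal_peak_ge0 ?normal_fun_ge0//; lra.
  rewrite -[leLHS]mulrA -[leRHS]mulrA ler_pM2l// mulrCA -[leRHS]mulrA ler_wpM2l ?normal_peak_ge0//.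
  rewrite /normal_fun mulNr expRN.
  have -> : (v - m) ^+ 2 = n.+1%:R ^+ 2 by rewrite -vn -normrX ger0_norm// sqr_ge0.
  set y := n.+1%:R ^+ 2 / _.
  have s2 : 0 < s ^+ 2 by rewrite exprn_even_gt0.
  have y0 : 0 < y.
    by apply: divr_gt0; [exact: exprn_gt0|rewrite mulrn_wgt0].
  rewrite [leRHS](_ : _ = n.+1%:R * y^-1).
    rewrite ler_pM2l// lef_pV2 ?posrE ?expR_gt0//.
    by apply: le_trans (expR_ge1Dx _); rewrite lerDr.
  rewrite /y invf_div -mulr_natl expr2; field.
  by rewrite nat1r gt_eqF.
have c0 : (fun n => (G (m + n.+1%:R) - G (m - n.+1%:R))%:E) @ \oo --> 0%E.
  apply: cvg_EFin; first exact: nearW.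
  apply: (@squeeze_cvgr _ _ _ _ (fun n => - (2 * L * (n.+1%:R)^-1)) (fun n => 2 * L * (n.+1%:R)^-1)).
  - apply: nearW => n /=.
    have n0 : 0 < n.+1%:R :> R by [].
    have h1 : `|G (m + n.+1%:R)| <= L * n.+1%:R^-1.
      by apply: Gb; rewrite addrC addKr ger0_norm.
    have h2 : `|G (m - n.+1%:R)| <= L * n.+1%:R^-1.
      by apply: Gb; rewrite addrC addKr normrN ger0_norm.
    rewrite -ler_norml (le_trans (ler_normB _ _))// (le_trans (lerD h1 h2))//.
    by rewrite -[leRHS]mulrA mulr_natl mulr2n.
  - rewrite -oppr0; apply: cvgN; rewrite -[X in _ --> X](mulr0 (2 * L)).
    by apply: cvgMr; exact: cvg_harmonic.
  - rewrite -[X in _ --> X](mulr0 (2 * L)).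
    by apply: cvgMr; exact: cvg_harmonic.
move: cvgI; rewrite [X in X @ \oo --> _](_ : _ = (fun n => (G (m + n.+1%:R) - G (m - n.+1%:R))%:E)).
  by move=> cvgI; exact: (cvg_unique (@ereal_hausdorff R) cvgI c0).
by apply/funext => n; exact: IE.
Qed.

End normal_stein.

(** * First two moments of a normal law *)

Section normal_moments.
Context (R : realType).
Notation lam := (@lebesgue_measure R).
Implicit Types m s : R.

(** Stein's identity with a constant; the variance comes from the identity
    function in the same way. *)
Lemma normal_mean0 m s : s != 0 ->
  lam.-integrable setT (EFin \o (fun u => (u - m) * normal_pdf m s u)) /\
  (\int[lam]_u ((u - m) * normal_pdf m s u)%:E = 0)%E.
Proof.
move=> s0.
have [|||] := @normal_stein R m s (fun=> 1) (fun=> 0) 1 s0.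
- by move=> v; exact: cvg_cst.
- by move=> v; rewrite normr1 mul1r lerDl.
- by move=> v; rewrite normr0 mul1r addr_ge0.
move=> h1 h2.
have E u : ((u - m) * 1 - s ^+ 2 * 0) * normal_pdf m s u =
  (u - m) * normal_pdf m s u by rewrite mulr1 mulr0 subr0.
split; first by apply: eq_integrable h1 => // u _ /=; rewrite E.
by rewrite -[RHS]h2; apply: eq_integral => u _; rewrite E.
Qed.

Lemma normal_variance m s : s != 0 ->
  lam.-integrable setT (EFin \o (fun u => (u - m) ^+ 2 * normal_pdf m s u)) /\
  (\int[lam]_u ((u - m) ^+ 2 * normal_pdf m s u)%:E = (s ^+ 2)%:E)%E.
Proof.
move=> s0.
have [||||] := @normal_stein R m s (fun u => u - m) (fun=> 1) 1 s0.
- by move=> v; apply: is_derive_eq; rewrite subr0.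
- by move=> v; exact: cvg_cst.
- by move=> v; rewrite mul1r lerDr.
- by move=> v; rewrite normr1 mul1r lerDl.
move=> h1 h2.
have E u : (u - m) ^+ 2 * normal_pdf m s u =
  ((u - m) * (u - m) - s ^+ 2 * 1) * normal_pdf m s u + s ^+ 2 * normal_pdf m s u.
  by ring.
have h3 : lam.-integrable setT (EFin \o (fun u => s ^+ 2 * normal_pdf m s u)).
  by apply: rintegrableZ; exact: integrable_normal_pdf.
split.
  by apply: eq_integrable (rintegrableD h1 h3) => // u _ /=; rewrite E.
under eq_integral do rewrite E EFinD.
rewrite (integralD measurableT h1 h3)/= h2 add0e.
under eq_integral do rewrite EFinM.
rewrite integralZl//=; last exact: integrable_normal_pdf.
by rewrite integral_normal_pdf mule1.
Qed.

Lemma normal_total_scale m s c :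
  (\int[lam]_u (c * normal_pdf m s u)%:E = c%:E)%E.
Proof.
rewrite -[RHS]mule1 -(integral_normal_pdf m s).
exact: (integralZl measurableT (integrable_normal_pdf m s) c).
Qed.

Lemma normal_mean0_scale m s c : s != 0 ->
  (\int[lam]_u (c * ((u - m) * normal_pdf m s u))%:E = 0)%E.
Proof.
move=> s0; have [h h0] := normal_mean0 m s0.
by rewrite -[RHS](mule0 c%:E) -[in RHS]h0; exact: (integralZl measurableT h c).
Qed.

Lemma normal_variance_scale m s c : s != 0 ->
  (\int[lam]_u (c * ((u - m) ^+ 2 * normal_pdf m s u))%:E = (c * s ^+ 2)%:E)%E.
Proof.
move=> s0; have [h h0] := normal_variance m s0.
by rewrite EFinM -h0; exact: (integralZl measurableT h c).
Qed.

End normal_moments.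

(** * The bivariate normal density *)

Section noise_density.
Context (R : realType) (sigma tau rho : R).
Hypotheses (hsigma : 0 < sigma) (htau : 0 < tau) (hrho : -1 < rho < 1).

Definition slope : R := rho * sigma / tau.
Definition resid_sd : R := sigma * Num.sqrt (1 - rho ^+ 2).

Lemma rho_sqr_lt1 : 0 < 1 - rho ^+ 2.
Proof. by move/andP: hrho => [? ?]; nra. Qed.

Lemma resid_sd_sqr : resid_sd ^+ 2 = sigma ^+ 2 * (1 - rho ^+ 2).
Proof. by rewrite exprMn sqr_sqrtr// ltW// rho_sqr_lt1. Qed.

Lemma resid_sd_gt0 : 0 < resid_sd.
Proof. by rewrite mulr_gt0// sqrtr_gt0 rho_sqr_lt1. Qed.

Lemma det_noise_cov :
  \det (noise_cov sigma tau rho) = sigma ^+ 2 * tau ^+ 2 * (1 - rho ^+ 2).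
Proof.
rewrite (expand_det_row _ 0) !big_ord_recl big_ord0 /cofactor !det_mx11 !mxE.
by rewrite -!val_eqE/= expr0 expr1; ring.
Qed.

Lemma inv_noise_cov : invmx (noise_cov sigma tau rho) =
  (sigma ^+ 2 * tau ^+ 2 * (1 - rho ^+ 2))^-1 *:
  \matrix_(i < 2, j < 2) (if i == j then (if i == 0 then tau ^+ 2 else sigma ^+ 2)
     else - (rho * sigma * tau)).
Proof.
have s0 := lt0r_neq0 hsigma; have t0 := lt0r_neq0 htau.
have r0 := lt0r_neq0 rho_sqr_lt1.
set S := noise_cov _ _ _; set A := _ *: _.
have SA : S *m A = 1%:M.
  apply/matrixP => i j; rewrite !mxE !big_ord_recl big_ord0 !mxE/=.
  by case: i => [[|[|]]]//= ?; case: j => [[|[|]]]//= ?; rewrite -?val_eqE/=;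
    field; rewrite r0 t0 s0.
have Su : S \in unitmx by have [] := mulmx1_unit SA.
by rewrite -[LHS]mulmx1 -SA mulKmx.
Qed.

(** Completing the square in [u]: given the first-stage error [v], the
    structural error is normal with mean [slope * v], so that its residual
    u - slope v does not depend on [v]. *)
Lemma normal2_pdf_noise (u v : R) :
  normal2_pdf (noise_cov sigma tau rho) (u, v) =
  normal_pdf (slope * v) resid_sd u * normal_pdf 0 tau v.
Proof.
have s0 := lt0r_neq0 hsigma; have t0 := lt0r_neq0 htau.
have r0 := lt0r_neq0 rho_sqr_lt1; have d0 := lt0r_neq0 resid_sd_gt0.
rewrite !normal_pdfE// /normal_peak /normal_fun resid_sd_sqr.
rewrite mulrACA -expRD -invfM -sqrtrM; last first.
  by rewrite mulrn_wge0// mulr_ge0 ?pi_ge0// mulr_ge0 ?sqr_ge0// ltW// rho_sqr_lt1.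
rewrite /normal2_pdf det_noise_cov inv_noise_cov [LHS]mulrC.
congr (_^-1 * expR _); first by congr Num.sqrt; rewrite !mulr2n; ring.
rewrite !mxE !big_ord_recl big_ord0 !mxE !big_ord_recl !big_ord0 !mxE/=.
rewrite /= /slope !mulr2n.
field; rewrite r0 t0 s0 !gt_eqF ?addr_gt0 ?exprn_gt0//.
  by rewrite mulr_gt0 ?exprn_gt0// rho_sqr_lt1.
by rewrite mulr_gt0 ?exprn_gt0// rho_sqr_lt1.
Qed.

End noise_density.

(** * Splitting off one coordinate *)

Section drop_coordinate.
Context (R : realType) (n : nat).
Implicit Types (i : 'I_n) (y : 'cV[R]_n).

Definition axis i : 'cV[R]_n := delta_mx i 0.

(** The remaining coordinates of [y], kept in the same space so that [y] is
    recovered by moving along the axis. *)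
Definition zero_at i y : 'cV[R]_n := \col_j (if j == i then 0 else y j 0).

Lemma zero_atK i y : zero_at i y + y i 0 *: axis i = y.
Proof.
apply/colP => j; rewrite !mxE eqxx andbT.
by case: eqP => [->|_]; rewrite ?mulr1 ?mulr0 ?add0r ?addr0.
Qed.

Lemma measurable_zero_at i : measurable_fun setT (zero_at i).
Proof.
apply: measurable_fun_mx => j k.
rewrite (_ : (fun _ => _) = (fun y => if j == i then 0 else y j k)).
  by case: eqP => // _; exact: measurable_entry.
by apply/funext => y; rewrite mxE (ord1 k).
Qed.

Lemma measurable_move i :
  measurable_fun setT (fun vy : R * 'cV[R]_n => vy.2 + vy.1 *: axis i).
Proof.
apply: measurable_fun_mx => j k.
rewrite (_ : (fun _ => _) = (fun vy : R * 'cV[R]_n => vy.2 j k + vy.1 * axis i j k)).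
  apply: measurable_funD; last exact: measurable_funM.
  exact: measurable_fun_entry measurable_snd.
by apply/funext => y; rewrite !mxE.
Qed.

End drop_coordinate.

Arguments axis {R n} i.

(** * Lebesgue measure on the plane *)

Section lebesgue_plane. Context (R:realType).
Notation mR := (measurableTypeR R).
Notation lam := (@lebesgue_measure R).

Lemma sigma_finite_lebesgue2 :
  sigma_finite [set: mR * mR] (lam \x lam)%E.
Proof.
have /sigma_finiteP[F [TF ndF Foo]] := sigma_finiteT lam.
exists (fun n => F n `*` F n).
  rewrite -setXTT TF predeqE => -[x y]; split.
    move=> [/= [n _ Fnx] [k _ Fky]]; exists (maxn n k) => //; split.
    - by move: x Fnx; exact/subsetPset/ndF/leq_maxl.
    - by move: y Fky; exact/subsetPset/ndF/leq_maxr.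
  by move=> [n _ []/= ? ?]; split; exists n.
move=> k; have [? ?] := Foo k.
split; first exact: measurableX.
by rewrite product_measure1E// lte_mul_pinfty// ge0_fin_numE.
Qed.

(** The product measure packed as sigma-finite, the form in which
    Radon-Nikodym applies to a density on the plane. *)
Definition lebesgue2 : {sigma_finite_measure set (mR * mR)%type -> \bar R} :=
  HB.pack (lam \x lam)%E (Measure_isSigmaFinite.Build _ _ _ (lam \x lam)%E sigma_finite_lebesgue2).

Lemma integral_lebesgue2 (f : mR * mR -> \bar R) :
  (\int[lebesgue2]_x f x = \int[lam \x lam]_x f x)%E.
Proof. by []. Qed.

End lebesgue_plane.

(** * Smoothed inverse powers of the norm *)

Lemma is_derive_invsqrt_pow (R : realType) (g : R -> R) (dg v : R) (m : nat) :
  0 < g v -> is_derive v 1 g dg ->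
  is_derive v 1 (fun h : R => (Num.sqrt (g h))^-1 ^+ m)
    (- (m%:R / 2) * dg * (Num.sqrt (g v))^-1 ^+ m.+2).
Proof.
move=> gv hg.
have sg : Num.sqrt (g v) != 0 by rewrite sqrtr_eq0 -ltNge.
have h1 := is_derive1_sqrt gv.
have h2 : is_derive v 1 (fun h : R => Num.sqrt (g h)) (dg * (2 * Num.sqrt (g v))^-1).
  apply: (is_derive_eq (is_derive1_comp h1 hg)); rewrite mulrC.
  by [].
have h3 := @is_deriveV R (fun h : R => Num.sqrt (g h)) v _ 1 sg h2.
have h4 := is_deriveX m h3.
rewrite (_ : (fun h : R => _) = (fun h : R => (Num.sqrt (g h))^-1) ^+ m); last first.
  by apply/funext => h; rewrite fctE.
apply: is_derive_eq; rewrite /GRing.scale/=.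
case: m {h4} => [|m]; first by rewrite !mul0r oppr0 !mul0r.
rewrite /= !exprS; set k := _.+1%:R; by field.
Qed.

Section wprod_field.
Context (R : realType) (n l : nat) (qz : 'M[R]_(n, l)) (mu : 'cV[R]_l).
Implicit Types (y r : 'cV[R]_n).

Definition dotv k (x x' : 'cV[R]_k) : R := \sum_j x j 0 * x' j 0.

Definition xz y : 'cV[R]_l := mu + qz^T *m y.
Definition sqz y : R := dotv (xz y) (xz y).
(** The smoothed inverse norm (a + eps)^(-1/2).  At [eps = 0] it is the inverse
    norm of [xz y], with the value 0 where [xz y] vanishes. *)
Definition wz (eps : R) y : R := (Num.sqrt (sqz y + eps))^-1.
Definition aff (c : R) r y : R := c + dotv r y.

Lemma dotvDr k (x x1 x2 : 'cV[R]_k) : dotv x (x1 + x2) = dotv x x1 + dotv x x2.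
Proof. by rewrite -big_split; apply: eq_bigr => j _; rewrite mxE mulrDr. Qed.

Lemma dotvZr k (x x1 : 'cV[R]_k) c : dotv x (c *: x1) = c * dotv x x1.
Proof. by rewrite mulr_sumr; apply: eq_bigr => j _; rewrite mxE mulrCA. Qed.

Lemma dotvC k (x x' : 'cV[R]_k) : dotv x x' = dotv x' x.
Proof. by apply: eq_bigr => j _; rewrite mulrC. Qed.

Lemma dotvDl k (x x1 x2 : 'cV[R]_k) : dotv (x1 + x2) x = dotv x1 x + dotv x2 x.
Proof. by rewrite dotvC dotvDr !(dotvC x). Qed.

Lemma dotvZl k (x x1 : 'cV[R]_k) c : dotv (c *: x1) x = c * dotv x1 x.
Proof. by rewrite dotvC dotvZr dotvC. Qed.

Lemma dotv_axis r i : dotv r (axis i) = r i 0.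
Proof.
rewrite /dotv (bigD1 i)//= big1 ?addr0; first by rewrite mxE !eqxx mulr1.
by move=> j /negbTE ji; rewrite mxE ji mulr0.
Qed.

Lemma dotv_ge0 k (x : 'cV[R]_k) : 0 <= dotv x x.
Proof. by apply: sumr_ge0 => j _; rewrite -expr2 sqr_ge0. Qed.

Lemma sqz_ge0 y : 0 <= sqz y. Proof. exact: dotv_ge0. Qed.

Lemma wz_ge0 eps y : 0 <= wz eps y.
Proof. by rewrite invr_ge0 sqrtr_ge0. Qed.

Lemma wz_sqr eps y : 0 < sqz y + eps -> (sqz y + eps) * wz eps y ^+ 2 = 1.
Proof.
move=> h; rewrite /wz exprVn sqr_sqrtr ?(ltW h)// divff//.
exact: lt0r_neq0.
Qed.

Lemma sqz_wz_le eps y : 0 <= eps -> sqz y * wz eps y ^+ 2 <= 1.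
Proof.
move=> e0; rewrite /wz exprVn sqr_sqrtr ?addr_ge0 ?sqz_ge0//.
have [->|s0] := eqVneq (sqz y + eps) 0; first by rewrite invr0 mulr0.
rewrite ler_pdivrMr ?mul1r ?lerDl//.
by rewrite lt_neqAle eq_sym s0 addr_ge0 ?sqz_ge0.
Qed.

Lemma wz_le eps y : 0 < eps -> wz eps y <= (Num.sqrt eps)^-1.
Proof.
move=> e0; rewrite /wz lef_pV2 ?posrE ?sqrtr_gt0 ?ltr_wpDl ?sqz_ge0//.
by rewrite ler_sqrt ?lerDr ?sqz_ge0// addr_ge0 ?sqz_ge0 ?ltW.
Qed.

Lemma entry_le_norm k (x : 'cV[R]_k) j : `|x j 0| <= Num.sqrt (dotv x x).
Proof.
rewrite -sqrtr_sqr ler_sqrt ?dotv_ge0// /dotv (bigD1 j)//= -expr2 lerDl.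
by apply: sumr_ge0 => i _; rewrite -expr2 sqr_ge0.
Qed.

Lemma xz_wz_le eps y j : 0 <= eps -> `|xz y j 0| * wz eps y <= 1.
Proof.
move=> e0; rewrite /wz.
have [->|s0] := eqVneq (Num.sqrt (sqz y + eps)) 0; first by rewrite invr0 mulr0.
rewrite ler_pdivrMr ?lt_neqAle ?sqrtr_ge0 1?eq_sym ?s0// mul1r.
apply: le_trans (entry_le_norm _ _) _.
by rewrite ler_sqrt ?lerDl ?addr_ge0 ?sqz_ge0.
Qed.

Lemma xz_axis y v i : xz (y + v *: axis i) = xz y + v *: (qz^T *m axis i).
Proof. by rewrite /xz mulmxDr addrA -scalemxAr. Qed.

Lemma qz_axis i j : (qz^T *m axis i) j 0 = qz i j.
Proof.
rewrite mxE (bigD1 i)//= big1 ?addr0; first by rewrite !mxE !eqxx mulr1.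
by move=> k /negbTE ki; rewrite !mxE ki mulr0.
Qed.

(** Half the partial derivative of [sqz] along the [i]-th axis. *)
Definition xz_slope i y : R := \sum_j xz y j 0 * qz i j.

Lemma is_derive_sqz y i (v : R) :
  is_derive v 1 (fun h : R => sqz (y + h *: axis i)) (2 * xz_slope i (y + v *: axis i)).
Proof.
pose g := qz^T *m axis i.
have E h : sqz (y + h *: axis i) = sqz y + h * (2 * dotv (xz y) g) + h ^+ 2 * dotv g g.
  rewrite /sqz xz_axis -/g; move: (xz y) => X.
  rewrite !dotvDr !dotvDl !dotvZr !dotvZl (dotvC g X); ring.
have -> : (fun h : R => sqz (y + h *: axis i)) =
    (fun h : R => sqz y + h * (2 * dotv (xz y) g) + h ^+ 2 * dotv g g).
  by apply/funext => h; rewrite E.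
have -> : xz_slope i (y + v *: axis i) = dotv (xz y) g + v * dotv g g.
  rewrite -dotvZl -dotvDl -xz_axis; apply: eq_bigr => j _.
  by rewrite /g qz_axis.
apply: is_derive_eq; rewrite /GRing.scale/=; ring.
Qed.

Lemma is_derive_aff c r y i (v : R) :
  is_derive v 1 (fun h : R => aff c r (y + h *: axis i)) (r i 0).
Proof.
have -> : (fun h : R => aff c r (y + h *: axis i)) =
    (fun h : R => aff c r y + h * r i 0).
  by apply/funext => h; rewrite /aff dotvDr dotvZr dotv_axis addrA.
apply: is_derive_eq; rewrite /GRing.scale/=; ring.
Qed.

Section field.
Variables (c1 c2 : R) (r1 r2 : 'cV[R]_n) (m : nat) (eps : R).
Hypothesis eps0 : 0 < eps.

(** Two affine factors and a power of [wz]: a family that contains every field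
    to which Stein's identity is applied, so that one computation of the
    derivative and of the growth serves them all. *)
Definition wprod y := aff c1 r1 y * aff c2 r2 y * wz eps y ^+ m.

Definition dwprod i y :=
  (r1 i 0 * aff c2 r2 y + aff c1 r1 y * r2 i 0) * wz eps y ^+ m
  - m%:R * (aff c1 r1 y * aff c2 r2 y) * wz eps y ^+ m.+2 * xz_slope i y.

Lemma is_derive_wz y i (v : R) k :
  is_derive v 1 (fun h : R => wz eps (y + h *: axis i) ^+ k)
    (- k%:R * xz_slope i (y + v *: axis i) * wz eps (y + v *: axis i) ^+ k.+2).
Proof.
have h0 : 0 < sqz (y + v *: axis i) + eps by rewrite ltr_wpDl ?sqz_ge0.
have h1 := is_derive_sqz y i v.
have h2 : is_derive v 1 (fun h : R => sqz (y + h *: axis i) + eps)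
    (2 * xz_slope i (y + v *: axis i)).
  by apply: is_derive_eq; rewrite addr0.
have h3 := @is_derive_invsqrt_pow R (fun h => sqz (y + h *: axis i) + eps) _ v k h0 h2.
apply: (is_derive_eq h3); rewrite -/(wz _ _); set W := _ ^+ k.+2; by field.
Qed.

Lemma is_derive_wprod y i (v : R) :
  is_derive v 1 (fun h : R => wprod (y + h *: axis i)) (dwprod i (y + v *: axis i)).
Proof.
have h1 := is_derive_aff c1 r1 y i v.
have h2 := is_derive_aff c2 r2 y i v.
have h3 := is_derive_wz y i v m.
apply: is_derive_eq; rewrite /GRing.scale/= /dwprod; ring.
Qed.

Lemma continuous_wz y i k : continuous (fun v : R => wz eps (y + v *: axis i) ^+ k).
Proof.
by move=> v; have h := is_derive_wz y i v k;
  apply/differentiable_continuous/derivable1_diffP.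
Qed.

Lemma continuous_aff c r y i : continuous (fun v : R => aff c r (y + v *: axis i)).
Proof.
by move=> v; have h := is_derive_aff c r y i v;
  apply/differentiable_continuous/derivable1_diffP.
Qed.

(** [xz_slope] is itself affine, which gives its continuity along lines. *)
Lemma xz_slopeE i y : xz_slope i y = aff (dotv mu (qz^T *m axis i)) (qz *m (qz^T *m axis i)) y.
Proof.
rewrite /xz_slope /aff.
transitivity (dotv (xz y) (qz^T *m axis i)).
  by apply: eq_bigr => j _; rewrite qz_axis.
rewrite dotvDl; congr (_ + _).
set g := qz^T *m axis i.
transitivity (((qz^T *m y)^T *m g) 0 0); first by rewrite [RHS]mxE; apply: eq_bigr => j _; rewrite [in RHS]mxE.
transitivity ((y^T *m (qz *m g)) 0 0); first by rewrite trmx_mul trmxK mulmxA.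
by rewrite dotvC [LHS]mxE; apply: eq_bigr => j _; rewrite [in LHS]mxE.
Qed.

Lemma continuous_dwprod y i : continuous (fun v : R => dwprod i (y + v *: axis i)).
Proof.
have -> : (fun v : R => dwprod i (y + v *: axis i)) = (fun v : R =>
  (r1 i 0 * aff c2 r2 (y + v *: axis i) + aff c1 r1 (y + v *: axis i) * r2 i 0)
    * wz eps (y + v *: axis i) ^+ m
  - m%:R * (aff c1 r1 (y + v *: axis i) * aff c2 r2 (y + v *: axis i)) *
    wz eps (y + v *: axis i) ^+ m.+2 *
    aff (dotv mu (qz^T *m axis i)) (qz *m (qz^T *m axis i)) (y + v *: axis i)).
  by apply/funext => v; rewrite /dwprod xz_slopeE.
move=> v.
have ca c r := @continuous_aff c r y i v.
have cw k := @continuous_wz y i k v.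
apply: cvgB; first apply: cvgM; last apply: cvgM.
- by apply: cvgD; apply: cvgM; first [exact: cvg_cst|exact: ca].
- exact: cw.
- apply: cvgM; last exact: cw.
  by apply: cvgM; [exact: cvg_cst|apply: cvgM; exact: ca].
- exact: ca.
Qed.

End field.
End wprod_field.

(** * Linear growth of the fields *)

Section wprod_bounds.
Context (R : realType) (n l : nat) (qz : 'M[R]_(n, l)) (mu : 'cV[R]_l).
Implicit Types (y r : 'cV[R]_n).

Notation xz := (xz qz mu).
Notation sqz := (sqz qz mu).
Notation wz := (wz qz mu).

Lemma measurable_dotv k (x : 'cV[R]_k) : measurable_fun setT (dotv x).
Proof.
by apply: measurable_sum => j; apply: measurable_funM => //; exact: measurable_entry.
Qed.

Lemma measurable_aff k c (x : 'cV[R]_k) : measurable_fun setT (aff c x).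
Proof. by apply: measurable_funD => //; exact: measurable_dotv. Qed.

Lemma xz_entryE j y : xz y j 0 = aff (mu j 0) (col j qz) y.
Proof.
by rewrite /xz !mxE; congr (_ + _); apply: eq_bigr => i _; rewrite !mxE.
Qed.

Lemma measurable_xz_entry j : measurable_fun setT (fun y => xz y j 0).
Proof.
rewrite (_ : (fun y => _) = aff (mu j 0) (col j qz)); first exact: measurable_aff.
by apply/funext => y; rewrite xz_entryE.
Qed.

Lemma measurable_sqz : measurable_fun setT sqz.
Proof. by apply: measurable_sum => j; apply: measurable_funM; exact: measurable_xz_entry. Qed.

Lemma measurable_wz eps : 0 <= eps -> measurable_fun setT (wz eps).
Proof.
move=> e0.
rewrite (_ : wz eps = (fun x => x `^ (- 2^-1)) \o (fun y => sqz y + eps)).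
  apply: measurableT_comp; first exact: measurable_powR.
  by apply: measurable_funD => //; exact: measurable_sqz.
by apply/funext => y /=; rewrite powRN powR12_sqrt ?addr_ge0 ?sqz_ge0.
Qed.

Lemma aff_le c r y : `|aff c r y| <= (`|c| + \sum_j `|r j 0|) * (1 + \sum_j `|y j 0|).
Proof.
apply: le_trans (ler_normD _ _) _; rewrite mulrDl lerD//.
  by rewrite ler_peMr// lerDl; apply: sumr_ge0.
apply: le_trans (ler_norm_sum _ _ _) _.
rewrite mulr_suml; apply: ler_sum => j _; rewrite normrM ler_wpM2l//.
by rewrite (bigD1 j)//= addrCA lerDl addr_ge0//; apply: sumr_ge0.
Qed.

Section bounds.
Variables (c1 c2 : R) (r1 r2 : 'cV[R]_n) (m : nat) (eps K : R).
Hypothesis eps0 : 0 < eps.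
(* One affine factor is controlled by one power of [wz], so that only the other
   one can grow. *)
Hypothesis L2K : forall y, `|aff c2 r2 y| * wz eps y <= K.

Let f := wprod qz mu c1 c2 r1 r2 m.+1 eps.
Let df i := dwprod qz mu c1 c2 r1 r2 m.+1 eps i.

Lemma measurable_wprod : measurable_fun setT f.
Proof.
apply: measurable_funM; first by apply: measurable_funM; exact: measurable_aff.
by apply: measurable_funX; apply: measurable_wz; exact: ltW.
Qed.

Lemma measurable_dwprod i : measurable_fun setT (df i).
Proof.
have mw k : measurable_fun setT (fun y => wz eps y ^+ k).
  by apply: measurable_funX; apply: measurable_wz; exact: ltW.
apply: measurable_funB; apply: measurable_funM => //.
- apply: measurable_funD; apply: measurable_funM => //; exact: measurable_aff.
- apply: measurable_funM => //; apply: measurable_funM => //.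
  by apply: measurable_funM; exact: measurable_aff.
- by apply: measurable_sum => j; apply: measurable_funM => //;
    exact: measurable_xz_entry.
Qed.

Let W := (Num.sqrt eps)^-1.
Let W0 : 0 <= W. Proof. by rewrite invr_ge0 sqrtr_ge0. Qed.
Let wW y : wz eps y <= W. Proof. exact: wz_le. Qed.
Let w0 y : 0 <= wz eps y. Proof. exact: wz_ge0. Qed.
Let K0 : 0 <= K. Proof. by apply: le_trans (L2K 0); rewrite mulr_ge0. Qed.
Let wXW y k : wz eps y ^+ k <= W ^+ k. Proof. by rewrite lerXn2r ?nnegrE. Qed.
Let C1 := `|c1| + \sum_j `|r1 j 0|.
Let C10 : 0 <= C1. Proof. by rewrite addr_ge0// sumr_ge0. Qed.
Let S y := 1 + \sum_j `|y j 0|.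
Let S1 y : 1 <= S y. Proof. by rewrite lerDl sumr_ge0. Qed.

(** The first summand bounds [wprod], the others the three terms of its partial
    derivative, so that one constant serves both growth conditions of Stein's
    identity. *)
Definition wprod_bound i : R := C1 * K * W ^+ m + (`|r1 i 0| * K * W ^+ m +
  C1 * `|r2 i 0| * W ^+ m.+1 + m.+1%:R * C1 * K * W ^+ m * W * \sum_j `|qz i j|).

(** Two powers of [wz] tame the slope: one cancels [xz], the other is at most
    [W]. *)
Let slope_le y i : `|xz_slope qz mu i y| * wz eps y ^+ 2 <= W * \sum_j `|qz i j|.
Proof.
apply: (@le_trans _ _ ((\sum_j `|qz i j|) * wz eps y)); last first.
  by rewrite mulrC ler_wpM2r// sumr_ge0.
rewrite expr2 mulrA ler_wpM2r//.
apply: le_trans (ler_wpM2r _ (ler_norm_sum _ _ _)) _ => //.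
rewrite mulr_suml; apply: ler_sum => j _.
by rewrite normrM mulrAC ler_piMl// xz_wz_le// ltW.
Qed.

Let L2w y : `|aff c2 r2 y| * wz eps y ^+ m.+1 <= K * W ^+ m.
Proof. by rewrite exprS mulrA ler_pM ?mulr_ge0 ?exprn_ge0. Qed.

Lemma wprod_le i y : `|f y| <= wprod_bound i * (1 + \sum_j `|y j 0|).
Proof.
rewrite /f /wprod !normrM -mulrA (ger0_norm (exprn_ge0 _ (w0 y))).
apply: (@le_trans _ _ ((C1 * S y) * (K * W ^+ m))).
  by rewrite ler_pM ?mulr_ge0 ?exprn_ge0//; exact: aff_le.
rewrite mulrAC mulrA -/(S y) ler_wpM2r ?(le_trans _ (S1 y))// lerDl.
by rewrite !addr_ge0// ?mulr_ge0 ?exprn_ge0// ?sumr_ge0.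
Qed.

Lemma dwprod_le i y : `|df i y| <= wprod_bound i * (1 + \sum_j `|y j 0|).
Proof.
have S0 : 0 <= S y by exact: le_trans (S1 y).
have L1 := aff_le c1 r1 y; rewrite -/C1 -/(S y) in L1.
rewrite /df /dwprod -/(S y).
apply: le_trans (ler_normB _ _) _.
rewrite /wprod_bound [leRHS]mulrDl -[leLHS]add0r lerD//.
  by rewrite ?mulr_ge0 ?exprn_ge0.
rewrite [leRHS]mulrDl lerD//.
  rewrite normrM (ger0_norm (exprn_ge0 _ (w0 y))).
  apply: le_trans (ler_wpM2r (exprn_ge0 _ (w0 y)) (ler_normD _ _)) _.
  rewrite !normrM mulrDl [leRHS]mulrDl lerD//.
    rewrite -mulrA; apply: le_trans (ler_wpM2l (normr_ge0 _) (L2w y)) _.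
    by rewrite mulrA ler_peMr// ?mulr_ge0 ?exprn_ge0.
  rewrite [leRHS](_ : _ = C1 * S y * `|r2 i 0| * W ^+ m.+1); last by ring.
  by rewrite ler_pM ?mulr_ge0 ?exprn_ge0// ler_wpM2r.
rewrite normrM (normrM _ (wz eps y ^+ m.+3)) (ger0_norm (exprn_ge0 _ (w0 y))).
rewrite (normrM m.+1%:R) (ger0_norm (ler0n _ _)) (normrM (aff _ _ _)).
(* The power m + 3 of [wz] is shared between the second affine factor
   (m + 1 of them) and the slope (2 of them). *)
rewrite [leLHS](_ : _ = m.+1%:R * (`|aff c1 r1 y| *
   (`|aff c2 r2 y| * wz eps y ^+ m.+1) * (`|xz_slope qz mu i y| * wz eps y ^+ 2))); last first.
  by rewrite !exprS; ring.
rewrite [leRHS](_ : _ = m.+1%:R * ((C1 * S y) * (K * W ^+ m) * (W * \sum_j `|qz i j|))); last by ring.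
rewrite ler_wpM2l// ler_pM ?mulr_ge0 ?exprn_ge0// ler_pM ?mulr_ge0 ?exprn_ge0//.
Qed.

End bounds.
End wprod_bounds.

(** * Regression on two regressors *)

Section two_regressors.
Context (R : realType).

Lemma det_mx2 (A : 'M[R]_2) : \det A = A 0 0 * A 1 1 - A 0 1 * A 1 0.
Proof.
have l00 : lift 0 0 = 1 :> 'I_2 by exact: val_inj.
have l10 : lift 1 0 = 0 :> 'I_2 by exact: val_inj.
rewrite (expand_det_row _ 0) !big_ord_recl big_ord0 /cofactor !det_mx11 !mxE.
by rewrite /= !l00 !l10 expr0 expr1; ring.
Qed.

Definition gram2 (g11 g12 g22 : R) : 'M[R]_(1 + 1) :=
  block_mx g11%:M g12%:M g12%:M g22%:M.

Lemma det_gram2 (g11 g12 g22 : R) :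
  \det (gram2 g11 g12 g22) = g11 * g22 - g12 ^+ 2.
Proof.
have i0 : (0 : 'I_2) = lshift 1 (0 : 'I_1) by exact: val_inj.
have i1 : (1 : 'I_2) = rshift 1 (0 : 'I_1) by exact: val_inj.
have E (g : R) : (g%:M : 'M[R]_1) 0 0 = g by rewrite mxE eqxx.
rewrite det_mx2 i1 i0 expr2; congr (_ * _ - _ * _).
- exact: etrans (block_mxEul _ _ _ _ _ _) (E _).
- exact: etrans (block_mxEdr _ _ _ _ _ _) (E _).
- exact: etrans (block_mxEur _ _ _ _ _ _) (E _).
- exact: etrans (block_mxEdl _ _ _ _ _ _) (E _).
Qed.

(** The first coefficient of the solution of the normal equations.  [det / det]
    is the indicator of a nonsingular Gram matrix, so that the formula also
    covers the singular case, where [invmx] returns the matrix itself;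
    this makes the estimator a measurable function of its moments
    everywhere and not only almost everywhere. *)
Definition gram2_sol (g11 g12 g22 h1 h2 : R) : R :=
  let det := g11 * g22 - g12 ^+ 2 in
  let unit := det / det in
  unit * ((g22 * h1 - g12 * h2) / det) + (1 - unit) * (g11 * h1 + g12 * h2).

Lemma gram2_solve (g11 g12 g22 h1 h2 : R) :
  (invmx (gram2 g11 g12 g22) *m col_mx h1%:M h2%:M) (lshift 1 0) 0 =
  gram2_sol g11 g12 g22 h1 h2.
Proof.
rewrite /gram2_sol; set det := _ - _; set unit := det / det.
have [d0|d0] := eqVneq det 0.
  rewrite /unit d0 mul0r mul0r add0r subr0 mul1r.
  rewrite /invmx ifF; last by rewrite unitmxE det_gram2 -/det d0 unitr0.
  rewrite /gram2 mul_block_col col_mxEu -!scalar_mxM -raddfD /=.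
  by rewrite mxE eqxx.
rewrite /unit divff// mul1r subrr mul0r addr0.
have Gu : gram2 g11 g12 g22 \in unitmx by rewrite unitmxE det_gram2 unitfE.
pose sol : 'cV[R]_(1 + 1) := col_mx ((g22 * h1 - g12 * h2) / det)%:M
  ((g11 * h2 - g12 * h1) / det)%:M.
have -> : col_mx h1%:M h2%:M = gram2 g11 g12 g22 *m sol.
  rewrite /gram2 /sol mul_block_col -!scalar_mxM -!raddfD /=.
  by congr col_mx; congr _%:M; rewrite /det in d0 *; field.
by rewrite mulKmx// /sol col_mxEu mxE eqxx mulr1n.
Qed.

End two_regressors.

(** * The two estimators as functions of second moments *)

Section estimators.
Context (R : realType) (l s : nat).
Implicit Types (x y : 'cV[R]_(l + s)) (p : R).

Lemma l2norm_sqr k (x : 'cV[R]_k) : l2norm x ^+ 2 = dotv x x.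
Proof.
rewrite /l2norm sqr_sqrtr; last by apply: sumr_ge0 => i _; exact: sqr_ge0.
by apply: eq_bigr => i _; rewrite expr2.
Qed.

Lemma trmx_mul_dotv k (x y : 'cV[R]_k) : x^T *m y = (dotv x y)%:M.
Proof.
rewrite [LHS]mx11_scalar mxE; congr _%:M.
by apply: eq_bigr => i _; rewrite mxE.
Qed.

(** Here [c] is one minus the shrinkage factor, so the control function has
    blocks [c] times [xz] and [xr]. *)
Definition beta_hat_moments (p a b A B : R) : R :=
  let c := 1 - a / (a + p * b) in
  gram2_sol (a + b) (c * a + b) (c ^+ 2 * a + b) (A + B) (c * A + B).

Lemma dotv_col_mx (x1 y1 : 'cV[R]_l) (x2 y2 : 'cV[R]_s) :
  dotv (col_mx x1 x2) (col_mx y1 y2) = dotv x1 y1 + dotv x2 y2.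
Proof.
rewrite /dotv big_split_ord /=; congr (_ + _); apply: eq_bigr => i _.
  by rewrite !col_mxEu.
by rewrite !col_mxEd.
Qed.

Lemma beta_hatE p (xz yz : 'cV[R]_l) (xr yr : 'cV[R]_s) :
  beta_hat p (col_mx yz yr) (col_mx xz xr) =
  beta_hat_moments p (dotv xz xz) (dotv xr xr) (dotv xz yz) (dotv xr yr).
Proof.
rewrite /beta_hat /ols /control_function /shrinkage col_mxKu col_mxKd !l2norm_sqr.
set a := dotv xz xz; set b := dotv xr xr.
set c := a / _.
have -> : col_mx xz xr - col_mx (c *: xz) 0 = col_mx ((1 - c) *: xz) xr.
  by rewrite opp_col_mx add_col_mx oppr0 addr0 scalerBl scale1r.
rewrite tr_row_mx mul_col_row mul_col_mx !trmx_mul_dotv !dotv_col_mx.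
rewrite !(dotvZl, dotvZr) -/a -/b.
rewrite (mulrA (1 - c) (1 - c)) -expr2.
exact: gram2_solve.
Qed.

Lemma beta_2slsE (xz yz : 'cV[R]_l) (xr yr : 'cV[R]_s) :
  beta_2sls (col_mx yz yr) (col_mx xz xr) = dotv xz yz / dotv xz xz.
Proof.
rewrite /beta_2sls !col_mxKu !trmx_mul_dotv (dotvC yz).
by rewrite !mxE eqxx !mulr1n.
Qed.

(** The determinant of the Gram matrix is a^3 b / (a + p b)^2, and after
    division the shrinkage denominator cancels: the estimator is 2SLS plus a
    correction linear in [p]. *)
Lemma beta_hat_momentsE p a b A B : 0 < p -> 0 < a -> 0 < b ->
  beta_hat_moments p a b A B = A / a + p * (b * A - a * B) / a ^+ 2.
Proof.
move=> p0 a0 b0; rewrite /beta_hat_moments /gram2_sol.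
have d0 : a + p * b != 0 by rewrite gt_eqF// addr_gt0// mulr_gt0.
set c := 1 - _.
have det : (a + b) * (c ^+ 2 * a + b) - (c * a + b) ^+ 2 =
    a ^+ 3 * b / (a + p * b) ^+ 2 by rewrite /c; field.
have det0 : a ^+ 3 * b / (a + p * b) ^+ 2 != 0.
  by rewrite gt_eqF// divr_gt0 ?mulr_gt0 ?exprn_gt0// addr_gt0// mulr_gt0.
rewrite det divff// subrr mul0r addr0 mul1r /c.
have an0 := lt0r_neq0 a0; have bn0 := lt0r_neq0 b0.
by field; rewrite d0 an0 bn0.
Qed.

End estimators.

(** * Measurability of the estimators *)

Section measurable_estimators.
Context (R : realType) (d : measure_display) (T : measurableType d).

(** Inversion is the identity times the power -1 of the square, a real power of
    a nonnegative number; all three vanish at 0. *)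
Lemma measurable_fun_invr (f : T -> R) : measurable_fun setT f ->
  measurable_fun setT (fun t => (f t)^-1).
Proof.
move=> mf.
rewrite (_ : (fun t => _) = fun t => f t * (f t ^+ 2) `^ (-1)).
  apply: measurable_funM => //.
  apply: (measurableT_comp (f := fun x : R => x `^ (-1))); first exact: measurable_powR.
  exact: measurable_funX.
apply/funext => t; rewrite powRN powRr1 ?sqr_ge0//.
have [->|f0] := eqVneq (f t) 0; first by rewrite invr0 mul0r.
by rewrite expr2; field.
Qed.

Lemma measurable_gram2_sol (g11 g12 g22 h1 h2 : T -> R) :
  measurable_fun setT g11 -> measurable_fun setT g12 ->
  measurable_fun setT g22 -> measurable_fun setT h1 -> measurable_fun setT h2 ->
  measurable_fun setT
    (fun t => gram2_sol (g11 t) (g12 t) (g22 t) (h1 t) (h2 t)).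
Proof.
move=> m11 m12 m22 mh1 mh2; pose det t := g11 t * g22 t - g12 t ^+ 2.
have mdet : measurable_fun setT det.
  by apply: measurable_funB; [exact: measurable_funM|exact: measurable_funX].
have munit : measurable_fun setT (fun t => det t / det t).
  by apply: measurable_funM => //; exact: measurable_fun_invr.
apply: measurable_funD; apply: measurable_funM => //.
- apply: measurable_funM; last exact: measurable_fun_invr.
  by apply: measurable_funB; exact: measurable_funM.
- exact: measurable_funB.
- by apply: measurable_funD; exact: measurable_funM.
Qed.

Lemma measurable_beta_hat_moments (p : R) (a b A B : T -> R) :
  measurable_fun setT a -> measurable_fun setT b ->
  measurable_fun setT A -> measurable_fun setT B ->
  measurable_fun setT (fun t => beta_hat_moments p (a t) (b t) (A t) (B t)).
Proof.
move=> ma mb mA mB; pose c t := 1 - a t / (a t + p * b t).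
have mc : measurable_fun setT c.
  apply: measurable_funB => //; apply: measurable_funM => //.
  by apply: measurable_fun_invr; apply: measurable_funD => //; exact: measurable_funM.
apply: measurable_gram2_sol.
- exact: measurable_funD.
- by apply: measurable_funD => //; exact: measurable_funM.
- apply: measurable_funD => //; apply: measurable_funM => //.
  exact: measurable_funX.
- exact: measurable_funD.
- by apply: measurable_funD => //; exact: measurable_funM.
Qed.

Lemma measurable_dotv2 k (x y : T -> 'cV[R]_k) :
  measurable_fun setT x -> measurable_fun setT y ->
  measurable_fun setT (fun t => dotv (x t) (y t)).
Proof.
move=> mx my; apply: measurable_sum => j.
by apply: measurable_funM; exact: measurable_fun_entry.
Qed.

Lemma measurable_mulmx m n k (A : 'M[R]_(m, n)) (x : T -> 'M[R]_(n, k)) :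
  measurable_fun setT x -> measurable_fun setT (fun t => A *m x t).
Proof.
move=> mx; apply: measurable_fun_mx => i j.
rewrite (_ : (fun t => _) = fun t => \sum_h A i h * x t h j).
  by apply: measurable_sum => h; apply: measurable_funM => //; exact: measurable_fun_entry.
by apply/funext => t; rewrite mxE.
Qed.

Lemma rintegrable_ae_eq (Q : {measure set T -> \bar R}) (f g : T -> R) :
  measurable_fun setT f -> Q.-integrable setT (EFin \o g) ->
  (\forall t \ae Q, f t = g t) ->
  Q.-integrable setT (EFin \o f) /\ (\int[Q]_t (f t)%:E = \int[Q]_t (g t)%:E)%E.
Proof.
move=> mf ig fg.
have mfE : measurable_fun setT (EFin \o f) by exact/measurable_EFinP.
have mgE := measurable_int Q ig.
split; last first.
  by apply: ae_eq_integral => //; apply: filterS fg => t /= ->.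
apply/integrableP; split => //.
rewrite (ae_eq_integral (fun t => `|(EFin \o g) t|)%E) //.
- by case/integrableP : ig.
- exact: measurableT_comp.
- exact: measurableT_comp.
- by apply: filterS fg => t /= ->.
Qed.

Lemma integral_EFinE (Q : {measure set T -> \bar R}) (f : T -> R) :
  Q.-integrable setT (EFin \o f) ->
  (\int[Q]_t (f t)%:E = (\int[Q]_t f t)%R%:E)%E.
Proof. by move=> fi; rewrite -[LHS]fineK// (integrable_fin_num measurableT fi). Qed.

End measurable_estimators.

Lemma measurable_mx_set1 (R : realType) m n (A : 'M[R]_(m, n)) : measurable [set A].
Proof.
rewrite (_ : [set A] = \bigcap_(ij in [set: 'I_m * 'I_n])
    ((fun M : 'M[R]_(m, n) => M ij.1 ij.2) @^-1` [set A ij.1 ij.2])).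
  apply: fin_bigcap_measurable => // ij _.
  by rewrite -[X in measurable X]setTI; apply: measurable_entry.
apply/seteqP; split => [M -> //|M h]; apply/matrixP => i j.
exact: (h (i, j) I).
Qed.

(** * Orthogonality relations of the canonical basis *)

Section canonical_basis.
Context (R : realType) (n k l s : nat).
Context (z : 'M[R]_(n, l)) (w : 'M[R]_(n, k)) (q1 : 'cV[R]_n) (qw : 'M[R]_(n, k)).
Context (qz : 'M[R]_(n, l)) (qr : 'M[R]_(n, s)).
Hypothesis hq : canonical_basis z w q1 qw qz qr.

Let trmx_sub_ortho m m' m'' (A : 'M[R]_(n, m)) (B : 'M[R]_(n, m')) (C : 'M[R]_(n, m'')) :
  (A^T <= B^T)%MS -> C^T *m B = 0 -> C^T *m A = 0.
Proof.
move=> /submxP[D DE] CB.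
by rewrite -[A]trmxK DE trmx_mul trmxK mulmxA CB mul0mx.
Qed.

Lemma canonical_basisP :
  [/\ qz^T *m qz = 1%:M, qr^T *m qr = 1%:M & qz^T *m qr = 0] /\
  [/\ qz^T *m (const_mx 1 : 'cV[R]_n) = 0, qz^T *m w = 0,
      qr^T *m (const_mx 1 : 'cV[R]_n) = 0, qr^T *m w = 0 & qr^T *m z = 0].
Proof.
case: hq => qq _ s2 s3.
move: qq; rewrite tr_row_mx mul_col_row (scalar_mx_block _ _ (1 : R)).
move=> /eq_block_mx[E1 E2 E3 E4].
move: E1; rewrite tr_row_mx mul_col_row (scalar_mx_block _ _ (1 : R)).
move=> /eq_block_mx[F1 F2 F3 F4].
have zr : qz^T *m qr = 0.
  by move: E2; rewrite tr_row_mx mul_col_mx -[X in _ = X]col_mx0 => /eq_col_mx[].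
have z1w := trmx_sub_ortho s2 F3.
have rd := trmx_sub_ortho s3 E3.
move: z1w; rewrite mul_mx_row -[X in _ = X]row_mx0 => /eq_row_mx[z1 zw].
move: rd; rewrite /design_mx mul_mx_row -[X in _ = X]row_mx0 => /eq_row_mx[r1w rz].
move: r1w; rewrite mul_mx_row -[X in _ = X]row_mx0 => /eq_row_mx[r1 rw].
by [].
Qed.

End canonical_basis.

Lemma normrB_lt (R : realDomainType) (b x : R) :
  0 < x -> x < 2 * b -> `|b - x| < b.
Proof. by move=> x0 xb; rewrite ltr_norml; apply/andP; split; lra. Qed.

(** * Expectations under Gaussian noise *)

Section gaussian_noise.
Context (R : realType) (d : measure_display) (T : measurableType d).
Context (Q : probability T R) (n : nat) (U V : {mfun T >-> 'cV[R]_n}).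
Context (sigma tau rho : R).
Hypotheses (hsigma : 0 < sigma) (htau : 0 < tau) (hrho : -1 < rho < 1).
Hypothesis hind : mutually_independent Q (fun i t => (U t i 0, V t i 0)).
Hypothesis hlaw : forall i : 'I_n,
  has_normal2_law Q (fun t => (U t i 0, V t i 0)) (noise_cov sigma tau rho).

Notation lam := (@lebesgue_measure R).
Notation kap := (slope sigma tau rho).
Notation sd := (resid_sd sigma rho).
Notation mR := (measurableTypeR R).
Let pdf (w : R * R) := normal2_pdf (noise_cov sigma tau rho) w.

Let measurable_noise i :
  measurable_fun setT ((fun t => (U t i 0, V t i 0)) : T -> (mR * mR)%type).
Proof.
suff : measurable_fun setT (fun t => (U t i 0, V t i 0)) by exact.
by apply: measurable_fun_pair; apply: measurable_fun_entry;
  exact: measurable_funP.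
Qed.

Let measurable_rest i : measurable_fun setT (fun t => zero_at i (V t)).
Proof.
apply: (measurableT_comp (f := @zero_at R n i)); last exact: measurable_funP.
exact: measurable_zero_at.
Qed.

Let noise_rv i : {RV Q >-> (mR * mR)%type} := bundle_mfun (measurable_noise i).
Let rest_rv i : {RV Q >-> 'cV[R]_n} := bundle_mfun (measurable_rest i).

(** A box in the coordinates of [V] other than [i] is a product event in the
    noise pairs, hence independent of the [i]-th pair; the [i]-th side of the box
    only sees the constant 0. *)
Let indep_boxes i A S : measurable A -> @boxes R n S ->
  Q (noise_rv i @^-1` A `&` rest_rv i @^-1` S) = (Q (noise_rv i @^-1` A) * Q (rest_rv i @^-1` S))%E.
Proof.
move=> mA [D mD <-].
(* If the [i]-th side of the box misses 0, the event is empty. *)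
have [Di0|Di0] := pselect (D i 0); last first.
  have -> : rest_rv i @^-1` [set y | forall j, D j (y j 0)] = set0.
    by apply/seteqP; split=> t //= /(_ i); rewrite mxE eqxx.
  by rewrite setI0 measure0 mule0.
pose D' j : set (R * R) := if j == i then setT else [set w | D j w.2].
have mD' j : measurable (D' j).
  rewrite /D'; case: ifP => // _.
  by rewrite -[X in measurable X]setTI; exact: measurable_snd.
pose D'' j := if j == i then A else D' j.
have mD'' j : measurable (D'' j) by rewrite /D''; case: ifP => _; [exact: mA|exact: mD'].
have -> : rest_rv i @^-1` [set y | forall j, D j (y j 0)] =
    \bigcap_(j in [set: 'I_n]) ((fun t => (U t j 0, V t j 0)) @^-1` D' j).
  apply/seteqP; split=> t /=.
    move=> h j _; have := h j; rewrite mxE /D'.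
    by case: eqP.
  by move=> h j; have := h j I; rewrite mxE /D'; case: eqP => [->|].
have noise_rvE : noise_rv i @^-1` A = (fun t => (U t i 0, V t i 0)) @^-1` A by [].
have -> : noise_rv i @^-1` A `&`
    \bigcap_(j in [set: 'I_n]) ((fun t => (U t j 0, V t j 0)) @^-1` D' j) =
    \bigcap_(j in [set: 'I_n]) ((fun t => (U t j 0, V t j 0)) @^-1` D'' j).
  apply/seteqP; split=> t /=.
    by move=> [At h] j _; rewrite /D''; case: eqP => [->//|_]; exact: h.
  move=> h; split; first by have := h i I; rewrite /D'' eqxx.
  move=> j _; have := h j I; rewrite /D''; case: eqP => // -> _.
  by rewrite /D' eqxx.
have mN j (E : set (R * R)) : measurable E ->
    measurable ((fun t => (U t j 0, V t j 0)) @^-1` E).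
  by move=> mE; rewrite -[X in measurable X]setTI; exact: measurable_noise.
have mI (E : 'I_n -> set (R * R)) : (forall j, measurable (E j)) ->
    measurable (\bigcap_(j in [set: 'I_n]) ((fun t => (U t j 0, V t j 0)) @^-1` E j)).
  by move=> mE; apply: fin_bigcap_measurable => // j _; exact: mN.
rewrite -[LHS]fineK ?fin_num_measure//; last exact: mI.
rewrite noise_rvE -[X in _ = (X * _)%E]fineK ?fin_num_measure//; last exact: mN.
rewrite -[X in _ = (_ * X)%E]fineK ?fin_num_measure//; last exact: mI.
rewrite !hind// -EFinM; congr EFin.
rewrite (bigD1 i)//= [in RHS](bigD1 i)//= {1}/D'' eqxx.
congr (_ * _); rewrite {1}/D' eqxx preimage_setT probability_setT/= mul1r.
by apply: eq_bigr => j /negbTE ji; rewrite /D'' ji.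
Qed.

(** Read off from the factored form of the density. *)
Let measurable_pdf : measurable_fun setT (pdf : mR * mR -> R).
Proof.
suff : measurable_fun setT pdf by exact.
rewrite (_ : pdf = fun w => normal_pdf 0 sd (w.1 - kap * w.2) * normal_pdf 0 tau w.2).
  apply: measurable_funM; apply: measurableT_comp => //; try exact: measurable_normal_pdf.
  by apply: measurable_funB => //; exact: measurable_funM.
apply/funext => -[u v]; rewrite /pdf normal2_pdf_noise//=; congr (_ * _).
have sd0 := lt0r_neq0 (resid_sd_gt0 hsigma hrho).
by rewrite !normal_pdfE// [in LHS]normal_fun_center.
Qed.

Let pdf_ge0 w : 0 <= pdf w.
Proof. by case: w => u v; rewrite /pdf normal2_pdf_noise// mulr_ge0 ?normal_pdf_ge0. Qed.

Let pdfE i A : measurable A -> distribution Q (noise_rv i) A =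
  (\int[lebesgue2 R]_(w in A) (pdf w)%:E)%E.
Proof. by move=> mA; rewrite -(hlaw i). Qed.

(** Expectation by conditioning on all of [V] but its [i]-th coordinate: first
    over U_i given V_i, then over V_i, then over the rest. *)
Lemma ge0_expectation_coordinate i (F : (R * R) * 'cV[R]_n -> \bar R) :
  measurable_fun setT F -> (forall x, 0 <= F x)%E ->
  (\int[Q]_t F ((U t i 0%R, V t i 0%R), zero_at i (V t)) =
   \int[distribution Q (rest_rv i)]_y \int[lam]_v \int[lam]_u
     (F ((u, v), y) * (normal_pdf (kap * v) sd u * normal_pdf 0 tau v)%:E))%E.
Proof.
move=> mF F0.
rewrite (@ge0_integral_indep_pair _ _ _ _ _ _ _ Q (noise_rv i) (rest_rv i) (@boxes R n))//; last first.
- exact: indep_boxes.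
- exact: boxes_setT.
- exact: boxes_setI.
- exact: measurable_boxes.
- exact: boxes_measurable.
apply: eq_integral => y _.
have mFy : measurable_fun setT (fun x => F (x, y)).
  by apply: measurableT_comp => //; exact: measurable_pair2.
rewrite (@ge0_integral_density _ _ _ (lebesgue2 R) (distribution Q (noise_rv i)) pdf
  measurable_pdf pdf_ge0 (@pdfE i) _ mFy); last by move=> w; exact: F0.
have mG : measurable_fun setT (fun w : mR * mR => F (w, y) * (pdf w)%:E)%E.
  by apply: emeasurable_funM => //; exact/measurable_EFinP.
have G0 (w : mR * mR) : (0 <= F (w, y) * (pdf w)%:E)%E.
  by rewrite mule_ge0// lee_fin.
rewrite (integral_lebesgue2 (fun w => F (w, y) * (pdf w)%:E)%E).
have E := fubini_tonelli2 (m1 := lam) (m2 := lam) _ mG G0.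
rewrite E.
apply: eq_integral => v _; apply: eq_integral => u _.
by rewrite /pdf normal2_pdf_noise.
Qed.

(** The signed counterpart: an expectation vanishes as soon as its inner double
    integral vanishes for each value of the other coordinates. *)
Lemma expectation_coordinate_eq0 i (F : (R * R) * 'cV[R]_n -> R) :
  measurable_fun setT F ->
  Q.-integrable setT (EFin \o (fun t => F ((U t i 0, V t i 0), zero_at i (V t)))) ->
  (forall y, \int[lam]_v \int[lam]_u
     (F ((u, v), y) * (normal_pdf (kap * v) sd u * normal_pdf 0 tau v))%:E = 0)%E ->
  \int[Q]_t F ((U t i 0, V t i 0), zero_at i (V t)) = 0.
Proof.
move=> mF iF F0; rewrite /Rintegral.
have mFE : measurable_fun setT (EFin \o F) by exact/measurable_EFinP.
have [iF' ->] := @integral_indep_pair _ _ _ _ _ _ _ Q (noise_rv i) (rest_rv i) (@boxes R n)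
  (@boxes_measurable R n) (@measurable_boxes R n) (@boxes_setI R n)
  (@boxes_setT R n) (@indep_boxes i) (EFin \o F) mFE iF.
have iFy := ae_integrable2 iF'.
rewrite -[RHS]/(fine 0%E) -(integral0 (distribution Q (rest_rv i)) setT).
congr fine; apply: ae_eq_integral => //.
- exact: measurable_fubini_G iF'.
- apply: filterS iFy => y iy _ /=.
  have [iy' ->] := @integral_density _ _ _ (lebesgue2 R) (distribution Q (noise_rv i)) pdf
    measurable_pdf pdf_ge0 (@pdfE i) _ iy.
  rewrite (integral_lebesgue2 (fun w => (F (w, y))%:E * (pdf w)%:E)%E).
  have E := integral21_prod_meas1 (m1 := lam) (m2 := lam) iy'.
  rewrite -E.
  rewrite -[RHS](F0 y).
  apply: eq_integral => v _; apply: eq_integral => u _.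
  by rewrite /pdf normal2_pdf_noise.
Qed.

Definition resid i t : R := U t i 0 - kap * V t i 0.

Let sd0 : sd != 0. Proof. exact/lt0r_neq0/resid_sd_gt0. Qed.
Let tau0 : tau != 0. Proof. exact: lt0r_neq0. Qed.

Let VE i t : zero_at i (V t) + V t i 0 *: axis i = V t.
Proof. exact: zero_atK. Qed.

Let measurable_line i :
  measurable_fun setT (fun wy : (R * R) * 'cV[R]_n => wy.2 + wy.1.2 *: axis i).
Proof.
apply: (measurableT_comp (f := fun vy : R * 'cV[R]_n => vy.2 + vy.1 *: axis i)
  (g := fun wy : (R * R) * 'cV[R]_n => (wy.1.2, wy.2))).
  exact: measurable_move.
apply: measurable_fun_pair => //.
exact: (measurableT_comp measurable_snd measurable_fst).
Qed.

Let measurable_noise_resid :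
  measurable_fun setT (fun wy : (R * R) * 'cV[R]_n => wy.1.1 - kap * wy.1.2).
Proof.
apply: measurable_funB; first exact: (measurableT_comp measurable_fst measurable_fst).
apply: measurable_funM => //.
exact: (measurableT_comp measurable_snd measurable_fst).
Qed.

Lemma measurable_resid i : measurable_fun setT (resid i).
Proof.
apply: measurable_funB; last apply: measurable_funM => //;
  by apply: measurable_fun_entry; exact: measurable_funP.
Qed.

(** The residual of U_i on V_i is independent of [V], with variance [sd ^+ 2].
    Stated for nonnegative [g], without integrability, so that it can be used to
    prove integrability of products with the residual. *)
Lemma resid_sqr_expectation i (g : 'cV[R]_n -> R) : measurable_fun setT g ->
  (forall y, 0 <= g y) ->
  (\int[Q]_t (resid i t ^+ 2 * g (V t))%:E = (sd ^+ 2)%:E * \int[Q]_t (g (V t))%:E)%E.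
Proof.
move=> mg g0.
have mgl : measurable_fun setT
    (fun wy : (R * R) * 'cV[R]_n => g (wy.2 + wy.1.2 *: axis i)).
  exact: (measurableT_comp mg (measurable_line i)).
rewrite -ge0_integralZl//; last 2 first.
- by move=> t _; rewrite lee_fin.
- by rewrite lee_fin sqr_ge0.
under [RHS]eq_integral do rewrite -EFinM.
pose F c (wy : (R * R) * 'cV[R]_n) := (c wy * g (wy.2 + wy.1.2 *: axis i))%:E.
transitivity (\int[Q]_t F (fun wy => (wy.1.1 - kap * wy.1.2) ^+ 2)%R
  ((U t i 0%R, V t i 0%R), zero_at i (V t)))%E.
  by apply: eq_integral => t _; rewrite /F/= VE.
transitivity (\int[Q]_t F (fun wy => sd ^+ 2)%R
  ((U t i 0%R, V t i 0%R), zero_at i (V t)))%E; last first.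
  by apply: eq_integral => t _; rewrite /F/= VE.
rewrite !ge0_expectation_coordinate; first last.
- by move=> x; rewrite lee_fin mulr_ge0// sqr_ge0.
- by apply/measurable_EFinP/measurable_funM => //; exact: measurable_funX.
- by move=> x; rewrite lee_fin mulr_ge0// sqr_ge0.
- by apply/measurable_EFinP/measurable_funM.
apply: eq_integral => y _; apply: eq_integral => v _; rewrite /F/=.
pose c := g (y + v *: axis i) * normal_pdf 0 tau v.
transitivity (c * sd ^+ 2)%:E.
  rewrite -(normal_variance_scale (kap * v) c sd0).
  by apply: eq_integral => u _; rewrite -EFinM /c; congr EFin; ring.
rewrite -(normal_total_scale (kap * v) sd).
by apply: eq_integral => u _; rewrite -EFinM /c; congr EFin; ring.
apply/measurable_EFinP; apply: (measurableT_comp mg).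
exact: measurable_funP.
Qed.

(** Integrability of r g comes from |r g| <= |g| + r^2 |g| and the previous
    identity. *)
Lemma resid_expectation0 i (g : 'cV[R]_n -> R) : measurable_fun setT g ->
  Q.-integrable setT (EFin \o (fun t => g (V t))) ->
  Q.-integrable setT (EFin \o (fun t => resid i t * g (V t))) /\
  \int[Q]_t (resid i t * g (V t)) = 0.
Proof.
move=> mg ig.
have mgV : measurable_fun setT (fun t => g (V t)).
  by apply: (measurableT_comp mg); exact: measurable_funP.
have i2 : Q.-integrable setT (EFin \o (fun t => resid i t ^+ 2 * `|g (V t)|)).
  apply/integrableP; split.
    apply/measurable_EFinP/measurable_funM.
      by apply: measurable_funX; exact: measurable_resid.
    exact: measurableT_comp.
  rewrite (eq_integral (fun t => (resid i t ^+ 2 * `|g (V t)|)%:E)); last first.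
    by move=> t _ /=; rewrite ger0_norm// mulr_ge0// sqr_ge0.
  rewrite (resid_sqr_expectation _ (g := fun y => `|g y|))//; last exact: measurableT_comp.
  rewrite lte_mul_pinfty ?lee_fin ?sqr_ge0//.
  by case/integrableP : ig.
have ieg : Q.-integrable setT (EFin \o (fun t => resid i t * g (V t))).
  apply: (rintegrable_le _ (rintegrableD (integrable_norm ig) i2)).
    by apply: measurable_funM => //; exact: measurable_resid.
  move=> t; rewrite normrM -[X in _ <= X + _]mul1r -mulrDl ler_wpM2r//.
  have -> : resid i t ^+ 2 = `|resid i t| ^+ 2 by rewrite -normrX ger0_norm// sqr_ge0.
  by set r := `|_|; nra.
split => //.
pose F (wy : (R * R) * 'cV[R]_n) := (wy.1.1 - kap * wy.1.2) * g (wy.2 + wy.1.2 *: axis i).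
have FE t : F ((U t i 0, V t i 0), zero_at i (V t)) = resid i t * g (V t).
  by rewrite /F/= VE.
under eq_Rintegral do rewrite -FE.
apply: expectation_coordinate_eq0.
- apply: measurable_funM => //.
  exact: (measurableT_comp mg (measurable_line i)).
- by apply: eq_integrable ieg => // t _ /=; rewrite FE.
- move=> y; apply: integral0_eq => v _; rewrite /F/=.
  rewrite -(normal_mean0_scale (kap * v) (g (y + v *: axis i) * normal_pdf 0 tau v) sd0).
  by apply: eq_integral => u _; congr EFin; ring.
Qed.

Lemma V_sqr_integrable i :
  Q.-integrable setT (EFin \o (fun t => V t i 0 ^+ 2)).
Proof.
apply/integrableP; split.
  apply/measurable_EFinP/measurable_funX/measurable_fun_entry.
  exact: measurable_funP.
rewrite (_ : integral _ _ _ = (tau ^+ 2)%:E) ?ltry//.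
pose F (wy : (R * R) * 'cV[R]_n) := (wy.1.2 ^+ 2)%:E.
transitivity (\int[Q]_t F ((U t i 0%R, V t i 0%R), zero_at i (V t)))%E.
  by apply: eq_integral => t _; rewrite /F/= ger0_norm// sqr_ge0.
rewrite ge0_expectation_coordinate; first last.
- by move=> x; rewrite lee_fin sqr_ge0.
- apply/measurable_EFinP/measurable_funX.
  exact: (measurableT_comp measurable_snd measurable_fst).
rewrite (eq_integral (fun=> (tau ^+ 2)%:E)).
  by rewrite integral_cst// [X in (_ * X)%E]probability_setT mule1.
move=> y _; rewrite -[RHS]/((tau ^+ 2)%:E) -[tau ^+ 2]mul1r.
rewrite -(normal_variance_scale 0 1 tau0); apply: eq_integral => v _.
rewrite -(normal_total_scale (kap * v) sd); apply: eq_integral => u _.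
by rewrite -EFinM/= subr0; congr EFin; rewrite /F/=; ring.
Qed.

(** Stein's identity on the line for V_i, the other coordinates being frozen at
    [y]: moving V_i moves [V] along the [i]-th axis.  Linear growth of [f] and
    [df] makes both sides integrable, since the coordinates are square
    integrable. *)
Lemma stein_coordinate i (f df : 'cV[R]_n -> R) C :
  measurable_fun setT f -> measurable_fun setT df ->
  (forall y (v : R), is_derive v 1 (fun h : R => f (y + h *: axis i)) (df (y + v *: axis i))) ->
  (forall y, continuous (fun v : R => df (y + v *: axis i))) ->
  (forall y, `|f y| <= C * (1 + \sum_j `|y j 0|)) ->
  (forall y, `|df y| <= C * (1 + \sum_j `|y j 0|)) ->
  [/\ Q.-integrable setT (EFin \o (fun t => V t i 0 * f (V t))),
      Q.-integrable setT (EFin \o (fun t => df (V t))) &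
      \int[Q]_t (V t i 0 * f (V t)) = tau ^+ 2 * \int[Q]_t df (V t)].
Proof.
move=> mf mdf fdf cdf fC dfC.
have C0 : 0 <= C.
  have := fC 0; rewrite big1 ?addr0 ?mulr1; first exact: le_trans.
  by move=> j _; rewrite mxE normr0.
have mV j : measurable_fun setT (fun t => V t j 0).
  by apply: measurable_fun_entry; exact: measurable_funP.
have mfV : measurable_fun setT (fun t => f (V t)).
  by apply: (measurableT_comp mf); exact: measurable_funP.
have mdfV : measurable_fun setT (fun t => df (V t)).
  by apply: (measurableT_comp mdf); exact: measurable_funP.
have i1 : Q.-integrable setT (EFin \o (fun=> 1 : R)).
  exact: finite_measure_integrable_cst.
have iS : Q.-integrable setT (EFin \o (fun t =>
    C * (1 + V t i 0 ^+ 2 + \sum_j (1 + V t j 0 ^+ 2 + V t i 0 ^+ 2)))).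
  apply: rintegrableZ; apply: rintegrableD.
    by apply: rintegrableD => //; exact: V_sqr_integrable.
  apply: rintegrable_sum => j.
  apply: rintegrableD; last exact: V_sqr_integrable.
  by apply: rintegrableD => //; exact: V_sqr_integrable.
have sq (x : R) : x ^+ 2 = `|x| ^+ 2 by rewrite -normrX ger0_norm// sqr_ge0.
have iVf : Q.-integrable setT (EFin \o (fun t => V t i 0 * f (V t))).
  apply: rintegrable_le iS _; first exact: measurable_funM.
  move=> t; rewrite normrM.
  apply: le_trans (ler_wpM2l (normr_ge0 _) (fC _)) _.
  rewrite mulrCA ler_wpM2l// mulrDr mulr1 mulr_sumr lerD//.
    by rewrite sq; set r := `|_|; nra.
  apply: ler_sum => j _.
  by rewrite [X in 1 + X]sq [X in _ + X]sq; set r := `|_|; set r' := `|_|; nra.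
have idf : Q.-integrable setT (EFin \o (fun t => df (V t))).
  apply: rintegrable_le iS _ => //.
  move=> t; apply: le_trans (dfC _) _; rewrite ler_wpM2l// lerD//.
    by rewrite lerDl sqr_ge0.
  apply: ler_sum => j _; rewrite -[leLHS]addr0 lerD ?sqr_ge0//.
  by rewrite sq; set r := `|_|; nra.
split => //.
apply/eqP; rewrite -subr_eq0 -RintegralZl// -RintegralB//; last exact: rintegrableZ.
apply/eqP.
pose F (wy : (R * R) * 'cV[R]_n) := wy.1.2 * f (wy.2 + wy.1.2 *: axis i) -
  tau ^+ 2 * df (wy.2 + wy.1.2 *: axis i).
have FE t : F ((U t i 0, V t i 0), zero_at i (V t)) =
    V t i 0 * f (V t) - tau ^+ 2 * df (V t).
  by rewrite /F/= VE.
under eq_Rintegral do rewrite -FE.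
apply: expectation_coordinate_eq0.
- apply: measurable_funB; apply: measurable_funM => //.
  + exact: (measurableT_comp measurable_snd measurable_fst).
  + exact: (measurableT_comp mf (measurable_line i)).
  + exact: (measurableT_comp mdf (measurable_line i)).
- have := rintegrableB iVf (rintegrableZ (tau ^+ 2) idf).
  by apply: eq_integrable => // t _ /=; rewrite FE.
- move=> y; rewrite /F/=.
  pose L := C * (1 + \sum_j (`|y j 0| + 1)).
  have SL (v : R) : C * (1 + \sum_j `|(y + v *: axis i) j 0|) <= L * (1 + `|v - 0|).
    rewrite /L -mulrA ler_wpM2l// subr0 mulrDl mul1r -addrA lerD2l.
    rewrite -[leLHS]add0r lerD// mulr_suml; apply: ler_sum => j _.
    rewrite !mxE eqxx andbT.
    apply: le_trans (ler_normD _ _) _; rewrite normrM.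
    have : `|(j == i)%:R : R| <= 1 by case: (j == i); rewrite ?normr1 ?normr0.
    set a := `|y j 0|; set b := `|v|; set c := `|_|.
    have : 0 <= a by exact: normr_ge0.
    have : 0 <= b by exact: normr_ge0.
    have : 0 <= c by exact: normr_ge0.
    by nra.
  have [|||_] := @normal_stein R 0 tau (fun v => f (y + v *: axis i))
      (fun v => df (y + v *: axis i)) L tau0.
  - exact: cdf.
  - by move=> v; exact: le_trans (fC _) (SL v).
  - by move=> v; exact: le_trans (dfC _) (SL v).
  move=> h0; rewrite -[RHS]h0; apply: eq_integral => v _.
  rewrite -(normal_total_scale (kap * v) sd); apply: eq_integral => u _.
  by rewrite subr0; congr EFin; ring.
Qed.

(** Along an axis on which [c] does not vanish, the hyperplane is met in one
    point, a null set for the conditional density.  Applied to columns of q_z and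
    q_r, it makes a and b positive almost surely. *)
Lemma hyperplane_null (c : 'cV[R]_n) (b : R) : c != 0 ->
  Q [set t | \sum_j c j 0 * V t j 0 = b] = 0%E.
Proof.
move=> /matrix0Pn[i [k]]; rewrite (ord1 k) => ci0.
pose L (y : 'cV[R]_n) := \sum_j c j 0 * y j 0.
have mL : measurable_fun setT L.
  by apply: measurable_sum => j; apply: measurable_funM => //; exact: measurable_entry.
have mS : measurable [set y | L y = b].
  rewrite -[X in measurable X]setTI.
  exact: (mL measurableT [set b]).
have mSV : measurable [set t | \sum_j c j 0 * V t j 0 = b].
  rewrite -[X in measurable X]setTI.
  exact: (@measurable_funP _ _ _ _ _ V measurableT _ mS).
have {1}-> : [set t | \sum_j c j 0 * V t j 0 = b] =
    [set t | \sum_j c j 0 * V t j 0 = b] `&` setT by rewrite setIT.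
rewrite -integral_indic//.
pose S := [set y | L y = b].
pose F (wy : (R * R) * 'cV[R]_n) := (\1_S (wy.2 + wy.1.2 *: axis i) : R)%:E.
transitivity (\int[Q]_t F ((U t i 0%R, V t i 0%R), zero_at i (V t)))%E.
  by apply: eq_integral => t _; rewrite /F/= VE.
rewrite ge0_expectation_coordinate; first last.
- by move=> x; rewrite lee_fin.
- by apply/measurable_EFinP; apply: (measurableT_comp (f := \1_S : 'cV[R]_n -> R)).
apply: integral0_eq => y _.
pose v0 := (b - L y) / c i 0.
rewrite -[RHS](integral_set1 (EFin \o normal_pdf 0 tau) v0).
rewrite [RHS]integral_mkcond; apply: eq_integral => v _.
rewrite patchE.
transitivity ((\1_S (y + v *: axis i) * normal_pdf 0 tau v)%:E).
  rewrite -[RHS](normal_total_scale (kap * v) sd); apply: eq_integral => u _.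
  by rewrite -EFinM/=; congr EFin; ring.
have LE : L (y + v *: axis i) = L y + c i 0 * v.
  rewrite /L (eq_bigr (fun j => c j 0 * y j 0 + c j 0 * (v * axis i j 0))).
    rewrite big_split/=; congr (_ + _).
    rewrite (bigD1 i)//= big1 ?addr0; first by rewrite mxE !eqxx mulr1.
    by move=> j /negbTE ji; rewrite mxE ji !mulr0.
  by move=> j _; rewrite !mxE mulrDr.
rewrite indicE; case: ifPn => [|vv0].
  rewrite inE => /= vE; rewrite (_ : _ \in S) ?mul1r//.
  by rewrite inE /S/= LE vE /v0 mulrC divfK// subrKC.
rewrite (_ : _ \in S = false) ?mul0r//.
apply/negbTE; apply: contra vv0; rewrite !inE /S/= LE /v0 => <-.
by rewrite addrAC subrr add0r mulrAC divff// mul1r.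
Qed.

(** * Stein's identity along the columns of the basis *)

Context (l s : nat) (qz : 'M[R]_(n, l)) (qr : 'M[R]_(n, s)) (mu : 'cV[R]_l).
Hypotheses (qzz : qz^T *m qz = 1%:M) (qrr : qr^T *m qr = 1%:M).
Hypothesis (qzr : qz^T *m qr = 0).

Notation xz := (xz qz mu).
Notation sqz := (sqz qz mu).
Notation wz := (wz qz mu).

(** Linear combination of the coordinatewise identities with weights [q]: [D] is
    the directional derivative of [f] along [q]. *)
Lemma stein_wprod (q : 'cV[R]_n) c1 c2 (r1 r2 : 'cV[R]_n) m eps K : 0 < eps ->
  (forall y, `|aff c2 r2 y| * wz eps y <= K) ->
  let f y := aff c1 r1 y * aff c2 r2 y * wz eps y ^+ m.+1 in
  let D y := (dotv q r1 * aff c2 r2 y + aff c1 r1 y * dotv q r2) * wz eps y ^+ m.+1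
    - m.+1%:R * (aff c1 r1 y * aff c2 r2 y) * wz eps y ^+ m.+3 *
      dotv (xz y) (qz^T *m q) in
  [/\ Q.-integrable setT (EFin \o (fun t => dotv q (V t) * f (V t))),
      Q.-integrable setT (EFin \o (fun t => D (V t))) &
      \int[Q]_t (dotv q (V t) * f (V t)) = tau ^+ 2 * \int[Q]_t D (V t)].
Proof.
move=> eps0 L2K f D.
pose df i := dwprod qz mu c1 c2 r1 r2 m.+1 eps i.
have st i : [/\ Q.-integrable setT (EFin \o (fun t => V t i 0 * f (V t))),
    Q.-integrable setT (EFin \o (fun t => df i (V t))) &
    \int[Q]_t (V t i 0 * f (V t)) = tau ^+ 2 * \int[Q]_t df i (V t)].
  apply: (stein_coordinate (C := wprod_bound qz c1 r1 r2 m eps K i)).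
  - exact: measurable_wprod.
  - exact: measurable_dwprod.
  - by move=> y v; exact: is_derive_wprod.
  - by move=> y; exact: continuous_dwprod.
  - exact: wprod_le.
  - exact: dwprod_le.
have fE t : dotv q (V t) * f (V t) = \sum_i q i 0 * (V t i 0 * f (V t)).
  by rewrite mulr_suml; apply: eq_bigr => i _; rewrite mulrA.
have DE t : D (V t) = \sum_i q i 0 * df i (V t).
  set y := V t.
  transitivity (\sum_i (q i 0 * r1 i 0 * (aff c2 r2 y * wz eps y ^+ m.+1) +
     q i 0 * r2 i 0 * (aff c1 r1 y * wz eps y ^+ m.+1) -
     (m.+1%:R * (aff c1 r1 y * aff c2 r2 y) * wz eps y ^+ m.+3) *
     (q i 0 * xz_slope qz mu i y))); last first.
    by apply: eq_bigr => i _; rewrite /df /dwprod; ring.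
  rewrite big_split big_split/= -!mulr_suml sumrN -mulr_sumr.
  have -> : \sum_i q i 0 * xz_slope qz mu i y = dotv (xz y) (qz^T *m q).
    rewrite (eq_bigr (fun i => \sum_j xz y j 0 * (qz i j * q i 0))); last first.
      by move=> i _; rewrite mulr_sumr; apply: eq_bigr => j _; ring.
    rewrite exchange_big; apply: eq_bigr => j _ /=.
    by rewrite -mulr_sumr; congr (_ * _); rewrite mxE; apply: eq_bigr => i _;
      rewrite mxE.
  by rewrite /D/dotv; ring.
split.
- have h : Q.-integrable setT
      (EFin \o (fun t => \sum_i q i 0 * (V t i 0 * f (V t)))).
    by apply: rintegrable_sum => i; apply: rintegrableZ; case: (st i).
  by apply: eq_integrable h => // t _ /=; rewrite fE.
- have h : Q.-integrable setT (EFin \o (fun t => \sum_i q i 0 * df i (V t))).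
    by apply: rintegrable_sum => i; apply: rintegrableZ; case: (st i).
  by apply: eq_integrable h => // t _ /=; rewrite DE.
- under eq_Rintegral do rewrite fE.
  under [in RHS]eq_Rintegral do rewrite DE.
  rewrite !Rintegral_sum; last 2 first.
  + by move=> i; apply: rintegrableZ; case: (st i).
  + by move=> i; apply: rintegrableZ; case: (st i).
  rewrite mulr_sumr; apply: eq_bigr => i _.
  have [h1 h2 h3] := st i.
  by rewrite !RintegralZl// h3 mulrCA.
Qed.

Definition xmu (y : 'cV[R]_n) : R := dotv (xz y) mu.
Definition sqr_r (y : 'cV[R]_n) : R := dotv (qr^T *m y) (qr^T *m y).
Definition mu_size : R := \sum_j `|mu j 0|.

Lemma mu_size_ge0 : 0 <= mu_size. Proof. exact: sumr_ge0. Qed.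

Lemma xmu_wz_le eps y : 0 <= eps -> `|xmu y| * wz eps y <= mu_size.
Proof.
move=> e0; apply: le_trans (ler_wpM2r (wz_ge0 _ _ _ _) (ler_norm_sum _ _ _)) _.
rewrite mulr_suml; apply: ler_sum => j _; rewrite normrM mulrAC ler_piMl//.
exact: xz_wz_le.
Qed.

Lemma dotv_trmx k (A : 'M[R]_(n, k)) (x : 'cV[R]_k) y :
  dotv (A *m x) y = dotv x (A^T *m y).
Proof.
rewrite /dotv (eq_bigr (fun i => \sum_j x j 0 * (A i j * y i 0))).
  rewrite exchange_big; apply: eq_bigr => j _ /=; rewrite -mulr_sumr mxE.
  by congr (_ * _); apply: eq_bigr => i _; rewrite mxE.
by move=> i _; rewrite mxE mulr_suml; apply: eq_bigr => j _; ring.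
Qed.

Lemma dotv_col k (A : 'M[R]_(n, k)) j y : dotv (col j A) y = (A^T *m y) j 0.
Proof. by rewrite mxE; apply: eq_bigr => i _; rewrite !mxE. Qed.

Lemma dotv_delta k (x : 'cV[R]_k) j : dotv x (delta_mx j 0) = x j 0.
Proof. exact: dotv_axis. Qed.

Lemma dotv0 k (x : 'cV[R]_k) : dotv x 0 = 0.
Proof. by rewrite /dotv big1// => j _; rewrite mxE mulr0. Qed.

Lemma xmuE y : xmu y = aff (dotv mu mu) (qz *m mu) y.
Proof. by rewrite /xmu /aff dotvDl dotv_trmx (dotvC _ mu). Qed.

Lemma measurable_xmu : measurable_fun setT xmu.
Proof.
rewrite (_ : xmu = aff (dotv mu mu) (qz *m mu)); first exact: measurable_aff.
by apply/funext => y; rewrite xmuE.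
Qed.

Lemma measurable_sqr_r : measurable_fun setT sqr_r.
Proof.
rewrite (_ : sqr_r = fun y => \sum_j dotv (col j qr) y * dotv (col j qr) y).
  by apply: measurable_sum => j; apply: measurable_funM; exact: measurable_dotv.
by apply/funext => y; apply: eq_bigr => j _; rewrite dotv_col.
Qed.

Lemma sqr_r_ge0 y : 0 <= sqr_r y. Proof. exact: dotv_ge0. Qed.

Lemma measurable_along (f : 'cV[R]_n -> R) : measurable_fun setT f ->
  measurable_fun setT (fun t => f (V t)).
Proof. by move=> mf; apply: (measurableT_comp mf); exact: measurable_funP. Qed.

Lemma bounded_integrable (f : 'cV[R]_n -> R) C : measurable_fun setT f ->
  (forall y, `|f y| <= C) -> Q.-integrable setT (EFin \o (fun t => f (V t))).
Proof.
move=> mf fC.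
have iC : Q.-integrable setT (EFin \o (fun=> C)) by exact: finite_measure_integrable_cst.
apply: (rintegrable_le _ iC) => [|t]; first exact: measurable_along.
exact: fC.
Qed.

Lemma wz_pow_integrable eps k : 0 < eps ->
  Q.-integrable setT (EFin \o (fun t => wz eps (V t) ^+ k)).
Proof.
move=> e0; apply: (@bounded_integrable (fun y => wz eps y ^+ k) ((Num.sqrt eps)^-1 ^+ k)).
  by apply: measurable_funX; apply: measurable_wz; exact: ltW.
move=> y; rewrite ger0_norm ?exprn_ge0 ?wz_ge0// lerXn2r ?nnegrE ?wz_ge0 ?wz_le//.
Qed.

Lemma sqz_wz_pow_integrable eps k : 0 < eps ->
  Q.-integrable setT (EFin \o (fun t => sqz (V t) * wz eps (V t) ^+ k.+2)).
Proof.
move=> e0; apply: (rintegrable_le _ (wz_pow_integrable k e0)).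
  apply: (@measurable_along (fun y => sqz y * wz eps y ^+ k.+2)).
  apply: measurable_funM; first exact: measurable_sqz.
  by apply: measurable_funX; apply: measurable_wz; exact: ltW.
move=> t; have w0 j : 0 <= wz eps (V t) ^+ j by rewrite exprn_ge0// wz_ge0.
rewrite ger0_norm; last by apply: mulr_ge0 => //; exact: sqz_ge0.
rewrite -addn2 addnC exprD mulrA ler_piMl//.
by apply: sqz_wz_le; exact: ltW.
Qed.

Lemma xmu_wz_pow_integrable eps k : 0 < eps ->
  Q.-integrable setT (EFin \o (fun t => xmu (V t) * wz eps (V t) ^+ k.+1)).
Proof.
move=> e0; apply: (rintegrable_le _ (rintegrableZ mu_size (wz_pow_integrable k e0))).
  apply: (@measurable_along (fun y => xmu y * wz eps y ^+ k.+1)).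
  apply: measurable_funM; first exact: measurable_xmu.
  by apply: measurable_funX; apply: measurable_wz; exact: ltW.
move=> t; rewrite normrM (ger0_norm (exprn_ge0 _ (wz_ge0 _ _ _ _))).
rewrite exprS mulrA ler_wpM2r ?exprn_ge0 ?wz_ge0//.
by apply: xmu_wz_le; exact: ltW.
Qed.

Lemma xz_noise y : dotv (xz y) (qz^T *m y) = sqz y - xmu y.
Proof.
have E : qz^T *m y = xz y + (-1) *: mu by rewrite /xz scaleN1r addrAC subrr add0r.
by rewrite [X in dotv _ X]E dotvDr dotvZr mulN1r.
Qed.

(** Sum over [j] of the identities for the fields x_j wz^(m + 1) along the
    columns of q_z: by orthonormality the divergence is
    l wz^(m + 1) - (m + 1) a wz^(m + 3). *)
Lemma stein_radial eps m : 0 < eps ->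
  \int[Q]_t ((sqz (V t) - xmu (V t)) * wz eps (V t) ^+ m.+1) =
  tau ^+ 2 * (l%:R * \int[Q]_t (wz eps (V t) ^+ m.+1) -
    m.+1%:R * \int[Q]_t (sqz (V t) * wz eps (V t) ^+ m.+3)).
Proof.
move=> e0.
pose f j y := dotv (col j qz) y * (xz y j 0 * wz eps y ^+ m.+1).
pose D j y := wz eps y ^+ m.+1 - m.+1%:R * (xz y j 0 ^+ 2 * wz eps y ^+ m.+3).
have st j : [/\ Q.-integrable setT (EFin \o (fun t => f j (V t))),
    Q.-integrable setT (EFin \o (fun t => D j (V t))) &
    \int[Q]_t (f j (V t)) = tau ^+ 2 * \int[Q]_t D j (V t)].
  have [|h1 h2 h3] := @stein_wprod (col j qz) (mu j 0) 1 (col j qz) 0 m eps (Num.sqrt eps)^-1 e0.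
    move=> y; rewrite /aff dotvC dotv0 addr0 normr1 mul1r.
    exact: wz_le.
  have fE t : f j (V t) = dotv (col j qz) (V t) * (aff (mu j 0) (col j qz) (V t) *
     aff 1 0 (V t) * wz eps (V t) ^+ m.+1).
    by rewrite /f xz_entryE {3}/aff (dotvC 0) dotv0 addr0 mulr1.
  have DE t : D j (V t) =
     (dotv (col j qz) (col j qz) * aff 1 0 (V t) + aff (mu j 0) (col j qz) (V t) *
        dotv (col j qz) 0) * wz eps (V t) ^+ m.+1 -
      m.+1%:R * (aff (mu j 0) (col j qz) (V t) * aff 1 0 (V t)) *
      wz eps (V t) ^+ m.+3 * dotv (xz (V t)) (qz^T *m col j qz).
    rewrite -xz_entryE dotv0 mulr0 addr0 {1 2}/aff (dotvC 0) dotv0 addr0 !mulr1.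
    rewrite dotv_col colE mulmxA qzz mul1mx dotv_delta mxE !eqxx mul1r /D; ring.
  split.
  - by apply: eq_integrable h1 => // t _ /=; rewrite fE.
  - by apply: eq_integrable h2 => // t _ /=; rewrite DE.
  - by under eq_Rintegral do rewrite fE; rewrite h3; under eq_Rintegral do rewrite -DE.
transitivity (\int[Q]_t \sum_j f j (V t)).
  apply: eq_Rintegral => t _; rewrite -xz_noise dotvC mulr_suml.
  by apply: eq_bigr => j _; rewrite /f dotv_col mulrA.
rewrite Rintegral_sum; last by move=> j; case: (st j).
transitivity (tau ^+ 2 * \int[Q]_t \sum_j D j (V t)).
  rewrite Rintegral_sum ?mulr_sumr; last by move=> j; case: (st j).
  by apply: eq_bigr => j _; case: (st j).
congr (_ * _).
have h1 := wz_pow_integrable m.+1 e0.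
have h2 := sqz_wz_pow_integrable m.+1 e0.
rewrite -!RintegralZl// -RintegralB//; [|exact: rintegrableZ|exact: rintegrableZ].
apply: eq_Rintegral => t _.
rewrite /D sumrB sumr_const card_ord -mulr_sumr -mulr_suml.
by congr (_ - _ * (_ * _)); rewrite mulr_natl.
Qed.

(** The field wz^(m + 1) in the constant direction q_z mu; it relates the moments
    of x.mu against powers of [wz] that differ by two and becomes, for m = 3, a
    differential equation in [eps]. *)
Lemma stein_mu eps m : 0 < eps ->
  \int[Q]_t (xmu (V t) * wz eps (V t) ^+ m.+1) =
  dotv mu mu * \int[Q]_t (wz eps (V t) ^+ m.+1) -
  tau ^+ 2 * m.+1%:R * \int[Q]_t (xmu (V t) * wz eps (V t) ^+ m.+3).
Proof.
move=> e0.
have [|h1 h2 h3] := @stein_wprod (qz *m mu) 1 1 0 0 m eps (Num.sqrt eps)^-1 e0.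
  move=> y; rewrite /aff dotvC dotv0 addr0 normr1 mul1r.
  exact: wz_le.
have a1 y : aff 1 0 y = 1 :> R by rewrite /aff dotvC dotv0 addr0.
have i1 := wz_pow_integrable m.+1 e0.
have i2 := xmu_wz_pow_integrable m e0.
have i3 := xmu_wz_pow_integrable m.+2 e0.
have vE t : dotv (qz *m mu) (V t) = xmu (V t) - dotv mu mu.
  by rewrite xmuE /aff addrC addKr.
have L : \int[Q]_t (dotv (qz *m mu) (V t) * (aff 1 0 (V t) * aff 1 0 (V t) *
    wz eps (V t) ^+ m.+1)) =
    \int[Q]_t (xmu (V t) * wz eps (V t) ^+ m.+1) -
    dotv mu mu * \int[Q]_t (wz eps (V t) ^+ m.+1).
  rewrite -RintegralZl// -RintegralB//; last exact: rintegrableZ.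
  by apply: eq_Rintegral => t _; rewrite !a1 vE !mul1r mulrBl.
rewrite L in h3.
rewrite -[LHS](subrK (dotv mu mu * \int[Q]_t (wz eps (V t) ^+ m.+1))) h3.
rewrite addrC -mulrA -mulrN; congr (_ + _ * _).
rewrite -mulN1r -!RintegralZl//; last exact: rintegrableZ.
apply: eq_Rintegral => t _; rewrite !a1 !dotv0.
rewrite mulmxA qzz mul1mx /xmu; ring.
Qed.

(** The weight is a function of x only, and the columns of q_r are orthogonal to
    those of q_z: differentiating along them only hits the factor r_j, and each
    of the [s] components contributes its variance. *)
Lemma stein_residual eps m c nu K : 0 < eps ->
  (forall y, `|aff c (qz *m nu) y| * wz eps y <= K) ->
  Q.-integrable setT (EFin \o (fun t => aff c (qz *m nu) (V t) * wz eps (V t) ^+ m.+1)) ->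
  Q.-integrable setT (EFin \o (fun t =>
    sqr_r (V t) * (aff c (qz *m nu) (V t) * wz eps (V t) ^+ m.+1))) /\
  \int[Q]_t (sqr_r (V t) * (aff c (qz *m nu) (V t) * wz eps (V t) ^+ m.+1)) =
  s%:R * tau ^+ 2 * \int[Q]_t (aff c (qz *m nu) (V t) * wz eps (V t) ^+ m.+1).
Proof.
move=> e0 hK iH; pose H y := aff c (qz *m nu) y * wz eps y ^+ m.+1.
pose f j y := dotv (col j qr) y ^+ 2 * H y.
have st j : Q.-integrable setT (EFin \o (fun t => f j (V t))) /\
    \int[Q]_t (f j (V t)) = tau ^+ 2 * \int[Q]_t H (V t).
  have [h1 h2 h3] := @stein_wprod (col j qr) 0 c (col j qr) (qz *m nu) m eps K e0 hK.
  have fE t : f j (V t) = dotv (col j qr) (V t) * (aff 0 (col j qr) (V t) *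
     aff c (qz *m nu) (V t) * wz eps (V t) ^+ m.+1).
    by rewrite /f /H {2}/aff add0r expr2; ring.
  have zr : qz^T *m col j qr = 0 by rewrite colE mulmxA qzr mul0mx.
  have DE t : H (V t) =
     (dotv (col j qr) (col j qr) * aff c (qz *m nu) (V t) + aff 0 (col j qr) (V t) *
        dotv (col j qr) (qz *m nu)) * wz eps (V t) ^+ m.+1 -
      m.+1%:R * (aff 0 (col j qr) (V t) * aff c (qz *m nu) (V t)) *
      wz eps (V t) ^+ m.+3 * dotv (xz (V t)) (qz^T *m col j qr).
    rewrite zr dotv0 mulr0 subr0 (dotvC _ (qz *m nu)) dotv_trmx zr dotv0 mulr0 addr0.
    by rewrite dotv_col colE mulmxA qrr mul1mx mxE !eqxx mul1r.
  split; first by apply: eq_integrable h1 => // t _ /=; rewrite fE.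
  by under eq_Rintegral do rewrite fE; rewrite h3; under eq_Rintegral do rewrite -DE.
have E t : sqr_r (V t) * H (V t) = \sum_j f j (V t).
  rewrite mulr_suml; apply: eq_bigr => j _.
  by rewrite /f dotv_col expr2.
split.
  have h : Q.-integrable setT (EFin \o (fun t => \sum_j f j (V t))).
    by apply: rintegrable_sum => j; case: (st j).
  by apply: eq_integrable h => // t _ /=; rewrite -E.
under eq_Rintegral do rewrite E.
rewrite Rintegral_sum; last by move=> j; case: (st j).
rewrite (eq_bigr (fun=> tau ^+ 2 * \int[Q]_t H (V t))); last first.
  by move=> j _; case: (st j).
by rewrite sumr_const card_ord -[LHS]mulr_natl mulrA.
Qed.

(** * Removing the smoothing *)

Hypothesis hl : (4 <= l)%N.
Notation e k := (k.+1%:R^-1 : R).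
Let e_gt0 k : 0 < e k. Proof. by rewrite invr_gt0. Qed.

Lemma col_neq0 k (A : 'M[R]_(n, k)) j : A^T *m A = 1%:M -> col j A != 0.
Proof.
move=> AA; apply/eqP => A0.
have : dotv (col j A) (col j A) = 1.
  by rewrite dotv_col colE mulmxA AA mul1mx mxE !eqxx.
by rewrite A0 dotv0 => /esym/eqP; rewrite oner_eq0.
Qed.

Lemma sqz_gt0_ae : \forall t \ae Q, 0 < sqz (V t).
Proof.
have j : 'I_l by exact: Ordinal (leq_trans (isT : 0 < 4)%N hl).
have null := hyperplane_null (- mu j 0) (col_neq0 j qzz).
exists [set t | \sum_i (col j qz) i 0 * V t i 0 = - mu j 0]; split => //.
- rewrite -[X in measurable X]setTI.
  exact: (measurable_along (measurable_dotv (col j qz)) measurableT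
    (measurable_set1 (- mu j 0))).
- move=> t /= /negP; rewrite -leNgt => a0.
  have : xz (V t) j 0 == 0.
    rewrite -normr_le0; apply: le_trans (entry_le_norm _ _) _.
    by rewrite ler0_sqrtr.
  by rewrite xz_entryE /aff addrC addr_eq0 => /eqP.
Qed.

(** From [stein_radial], since a wz^2 <= 1. *)
Lemma radial_lower eps m : 0 < eps ->
  tau ^+ 2 * (l%:R - m.+1%:R) * \int[Q]_t (wz eps (V t) ^+ m.+1) <=
  \int[Q]_t ((sqz (V t) - xmu (V t)) * wz eps (V t) ^+ m.+1).
Proof.
move=> e0; rewrite stein_radial//.
rewrite -mulrA ler_wpM2l ?sqr_ge0// mulrBl lerD2l lerN2 ler_wpM2l//.
apply: le_Rintegral => //.
- exact: sqz_wz_pow_integrable.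
- exact: wz_pow_integrable.
- move=> t _; rewrite -addn2 addnC exprD mulrA ler_piMl ?exprn_ge0 ?wz_ge0//.
  by rewrite sqz_wz_le// ltW.
Qed.

Lemma radial_integrable eps m : 0 < eps -> Q.-integrable setT
  (EFin \o (fun t => (sqz (V t) - xmu (V t)) * wz eps (V t) ^+ m.+2)).
Proof.
move=> e0.
have h := rintegrableB (sqz_wz_pow_integrable m e0)
  (xmu_wz_pow_integrable m.+1 e0).
by apply: eq_integrable h => // t _ /=; rewrite mulrBl.
Qed.

Definition wz2_bound : R := (1 + mu_size ^+ 2 / (4 * tau ^+ 2)) / tau ^+ 2.
Definition wz3_bound : R := (1 + (1 + mu_size) * wz2_bound) / tau ^+ 2.

Let t2 : 0 < tau ^+ 2. Proof. exact: exprn_gt0. Qed.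
Let l3 : 1 <= l%:R - 3 :> R.
Proof. by rewrite lerBrDr -[1]/(1%:R) -natrD ler_nat. Qed.
Let i1 : Q.-integrable setT (EFin \o (fun=> 1 : R)).
Proof. exact: finite_measure_integrable_cst. Qed.
Let int1 : \int[Q]_t (1 : R) = 1.
Proof.
rewrite Rintegral_cst// mul1r; exact: (congr1 fine (probability_setT Q)).
Qed.

Let sqw eps y : 0 < eps -> sqz y * wz eps y ^+ 2 <= 1.
Proof. by move=> e0; apply: sqz_wz_le; exact: ltW. Qed.

Let xmuw eps y : 0 < eps -> - xmu y * wz eps y <= mu_size.
Proof.
move=> e0; apply: le_trans (xmu_wz_le y (ltW e0)).
by rewrite ler_wpM2r ?wz_ge0// -normrN ler_norm.
Qed.

(** The radial moment is at least tau^2 (l - 2) E[wz^2] and at most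
    1 + mu_size E[wz]; the factor l - 2 >= 2 leaves room for
    mu_size wz <= mu_size^2 / (4 tau^2) + tau^2 wz^2. *)
Lemma wz2_le eps : 0 < eps -> \int[Q]_t (wz eps (V t) ^+ 2) <= wz2_bound.
Proof.
move=> e0; have := radial_lower 1 e0.
set I2 := \int[Q]_t _ => lo.
have iw2 := wz_pow_integrable 2 e0.
have I20 : 0 <= I2 by apply: Rintegral_ge0 => t _; rewrite exprn_ge0 ?wz_ge0.
have : \int[Q]_t ((sqz (V t) - xmu (V t)) * wz eps (V t) ^+ 2) <=
    \int[Q]_t ((1 + mu_size ^+ 2 / (4 * tau ^+ 2)) * 1 + tau ^+ 2 * wz eps (V t) ^+ 2).
  apply: le_Rintegral => //; first exact: radial_integrable.
    by apply: rintegrableD; apply: rintegrableZ.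
  move=> t _; set w := wz eps (V t).
  have h1 := sqw (V t) e0; have h2 := xmuw (V t) e0.
  have w0 : 0 <= w by exact: wz_ge0.
  have h3 : - xmu (V t) * w * w <= mu_size * w by rewrite ler_wpM2r.
  have h4 : mu_size * w <= mu_size ^+ 2 / (4 * tau ^+ 2) + tau ^+ 2 * w ^+ 2.
    have := sqr_ge0 (tau * w - mu_size / (2 * tau)).
    rewrite (_ : (tau * w - _) ^+ 2 = mu_size ^+ 2 / (4 * tau ^+ 2) + tau ^+ 2 * w ^+ 2 - mu_size * w).
      by rewrite subr_ge0.
    by field; rewrite lt0r_neq0.
  rewrite -/w in h1 *; lra.
rewrite RintegralD//; [|exact: rintegrableZ|exact: rintegrableZ].
rewrite !RintegralZl// int1 mulr1 -/I2 => hi.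
rewrite /wz2_bound ler_pdivlMr//.
have h := le_trans lo hi.
have : tau ^+ 2 * I2 * 1 <= tau ^+ 2 * I2 * (l%:R - 3).
  by rewrite ler_wpM2l// mulr_ge0// ltW.
lra.
Qed.

(** The radial moment of order 3 is at least tau^2 E[wz^3], because l - 3 >= 1,
    and involves only lower powers on the other side. *)
Lemma wz3_le eps : 0 < eps -> \int[Q]_t (wz eps (V t) ^+ 3) <= wz3_bound.
Proof.
move=> e0; have := radial_lower 2 e0.
set I3 := \int[Q]_t _ => lo.
have iw2 := wz_pow_integrable 2 e0.
have I30 : 0 <= I3 by apply: Rintegral_ge0 => t _; rewrite exprn_ge0 ?wz_ge0.
have : \int[Q]_t ((sqz (V t) - xmu (V t)) * wz eps (V t) ^+ 3) <=
    \int[Q]_t (1 + (1 + mu_size) * wz eps (V t) ^+ 2).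
  apply: le_Rintegral => //; first exact: radial_integrable.
    by apply: rintegrableD => //; apply: rintegrableZ.
  move=> t _; set w := wz eps (V t).
  have h1 := sqw (V t) e0; have h2 := xmuw (V t) e0.
  have w0 : 0 <= w by exact: wz_ge0.
  have h3 : - xmu (V t) * w * w ^+ 2 <= mu_size * w ^+ 2.
    by rewrite ler_wpM2r// sqr_ge0.
  have h4 : sqz (V t) * w ^+ 2 * w <= 1 * w by rewrite ler_wpM2r.
  have h5 : w <= 1 + w ^+ 2 by nra.
  rewrite -/w in h1 *; lra.
rewrite RintegralD//; last exact: rintegrableZ.
rewrite RintegralZl// int1 => hi.
have hi2 := wz2_le e0.
rewrite /wz3_bound ler_pdivlMr//.
have h := le_trans lo hi.
have : (1 + mu_size) * \int[Q]_t (wz eps (V t) ^+ 2) <= (1 + mu_size) * wz2_bound.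
  by rewrite ler_wpM2l// addr_ge0// mu_size_ge0.
have : tau ^+ 2 * I3 * 1 <= tau ^+ 2 * I3 * (l%:R - 3).
  by rewrite ler_wpM2l// mulr_ge0// ltW.
lra.
Qed.

Lemma wz_pow_cvg y m : 0 < sqz y ->
  (fun k => wz (e k) y ^+ m) @ \oo --> wz 0 y ^+ m.
Proof.
move=> a0; pose g (x : R) := (Num.sqrt (sqz y + x))^-1 ^+ m.
have cg : {for 0, continuous g}.
  have h : is_derive (0 : R) (1 : R) (fun x => sqz y + x) 1.
    by apply: is_derive_eq; ring.
  have a0' : 0 < sqz y + 0 by rewrite addr0.
  have h' := is_derive_invsqrt_pow m a0' h.
  by apply/differentiable_continuous/derivable1_diffP.
exact: (cvg_comp _ _ (cvg_harmonic (R := R)) cg).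
Qed.

Lemma wz_le_mono eps eps' y : 0 < sqz y + eps -> eps <= eps' ->
  wz eps' y <= wz eps y.
Proof.
move=> a0 ee; have a1 : 0 < sqz y + eps' by apply: lt_le_trans a0 _; rewrite lerD2l.
by rewrite lef_pV2 ?posrE ?sqrtr_gt0// ler_sqrt ?lerD2l// ltW.
Qed.

Lemma sqz_wz0 y : 0 < sqz y -> sqz y * wz 0 y ^+ 2 = 1.
Proof. by move=> a0; rewrite -[sqz y]addr0 wz_sqr// addr0. Qed.

Lemma wz0_eq0 y : sqz y = 0 -> wz 0 y = 0.
Proof. by move=> a0; rewrite /wz a0 addr0 sqrtr0 invr0. Qed.

(** Monotone convergence as [eps] decreases to 0.  The factor [sqz * wz 0 ^+ 2]
    is the indicator of a <> 0: it makes the limit hold at every point, including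
    a = 0 where the smoothed powers blow up and [wz 0] is 0. *)
Lemma wz0_pow_integrable (g : 'cV[R]_n -> R) m C : measurable_fun setT g ->
  (forall y, 0 <= g y) ->
  (forall k, Q.-integrable setT (EFin \o (fun t => g (V t) * wz (e k) (V t) ^+ m.+1))) ->
  (forall k, \int[Q]_t (g (V t) * wz (e k) (V t) ^+ m.+1) <= C) ->
  Q.-integrable setT (EFin \o (fun t => g (V t) * wz 0 (V t) ^+ m.+1)).
Proof.
move=> mg g0 ig gC.
pose h k y := g y * wz (e k) y ^+ m.+1 * (sqz y * wz 0 y ^+ 2).
have w0 eps y j : 0 <= wz eps y ^+ j by rewrite exprn_ge0// wz_ge0.
have h0 k y : 0 <= h k y.
  by apply: mulr_ge0; apply: mulr_ge0 => //; exact: sqz_ge0.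
have mh k : measurable_fun setT (h k).
  apply: measurable_funM; apply: measurable_funM => //.
  - by apply: measurable_funX; apply: measurable_wz; exact: ltW.
  - exact: measurable_sqz.
  - by apply: measurable_funX; apply: measurable_wz.
have mh' k : measurable_fun setT (EFin \o (fun t => h k (V t))).
  by apply/measurable_EFinP; exact: measurable_along.
have ndh y : {homo (fun k => (h k y)%:E) : k k' / (k <= k')%N >-> (k <= k')%E}.
  move=> k k' kk'; rewrite lee_fin /h; apply: ler_wpM2r.
    by apply: mulr_ge0 => //; exact: sqz_ge0.
  apply: ler_wpM2l => //; rewrite lerXn2r ?nnegrE ?wz_ge0//.
  apply: wz_le_mono; first by rewrite ltr_wpDl ?sqz_ge0.
  by rewrite lef_pV2 ?posrE// ler_nat ltnS.
have limr y : (fun k => h k y) @ \oo --> g y * wz 0 y ^+ m.+1.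
  have [a0|a0] := ltP 0 (sqz y).
    rewrite (_ : (fun k => _) = (fun k => g y * wz (e k) y ^+ m.+1)).
      by apply: cvgM; [exact: cvg_cst|exact: wz_pow_cvg].
    by apply/funext => k; rewrite /h /= sqz_wz0// mulr1.
  have a00 : sqz y = 0 by apply/le_anti; rewrite a0 sqz_ge0.
  rewrite wz0_eq0// exprS mul0r mulr0.
  rewrite (_ : (fun k => _) = (fun k => 0)); first exact: cvg_cst.
  by apply/funext => k; rewrite /h /= a00 mul0r mulr0.
have limh y : (fun k => (h k y)%:E) @ \oo --> (g y * wz 0 y ^+ m.+1)%:E.
  by apply: cvg_EFin; [exact: nearW|exact: limr].
have cvgI := cvg_monotone_convergence (mu := Q) measurableT mh'
  (fun k t _ => h0 k (V t)) (fun t _ => ndh (V t)).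
have E : (\int[Q]_t limn (fun k => (h k (V t))%:E) =
    \int[Q]_t (g (V t) * wz 0 (V t) ^+ m.+1)%:E)%E.
  by apply: eq_integral => t _; apply/cvg_lim => //; exact: limh.
rewrite E in cvgI.
have mgw : measurable_fun setT (fun t => g (V t) * wz 0 (V t) ^+ m.+1).
  apply: (@measurable_along (fun y => g y * wz 0 y ^+ m.+1)).
  by apply: measurable_funM => //; apply: measurable_funX; exact: measurable_wz.
apply/integrableP; split; first exact/measurable_EFinP.
rewrite (eq_integral (fun t => (g (V t) * wz 0 (V t) ^+ m.+1)%:E)); last first.
  by move=> t _ /=; rewrite ger0_norm// mulr_ge0.
apply: (@le_lt_trans _ _ C%:E); last exact: ltry.
rewrite -(cvg_lim _ cvgI)//; apply: lime_le; first by apply/cvg_ex; eexists; exact: cvgI.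
apply: nearW => k.
apply: (@le_trans _ _ (\int[Q]_t (g (V t) * wz (e k) (V t) ^+ m.+1)%:E)%E).
  apply: ge0_le_integral => //.
  - by move=> t _; rewrite /= lee_fin.
  - by case/integrableP : (ig k).
  - move=> t _; rewrite lee_fin /h ler_piMr ?mulr_ge0//.
    exact: sqz_wz_le.
rewrite -[leLHS]fineK ?lee_fin//; first exact: gC.
exact: integrable_fin_num (ig k).
Qed.

(** The limit [eps = 0] itself dominates the smoothed integrands, outside the
    null set a = 0. *)
Lemma wz_pow_cvg_integral (G : 'cV[R]_n -> R) m : measurable_fun setT G ->
  Q.-integrable setT (EFin \o (fun t => G (V t) * wz 0 (V t) ^+ m)) ->
  (fun k => \int[Q]_t (G (V t) * wz (e k) (V t) ^+ m)) @ \oo -->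
  \int[Q]_t (G (V t) * wz 0 (V t) ^+ m).
Proof.
move=> mG iG.
have mw eps : 0 <= eps -> measurable_fun setT (fun t => G (V t) * wz eps (V t) ^+ m).
  move=> e0; apply: (@measurable_along (fun y => G y * wz eps y ^+ m)).
  by apply: measurable_funM => //; apply: measurable_funX; exact: measurable_wz.
have ae0 := sqz_gt0_ae.
have cvgae : \forall t \ae Q, [set: T] t ->
    (fun k => (G (V t) * wz (e k) (V t) ^+ m)%:E) @ \oo -->
    (G (V t) * wz 0 (V t) ^+ m)%:E.
  apply: filterS ae0 => t a0 _.
  apply: cvg_EFin; first exact: nearW.
  by apply: cvgM; [exact: cvg_cst|exact: wz_pow_cvg].
have domae : \forall t \ae Q, forall k, [set: T] t ->
    (`|(G (V t) * wz (e k) (V t) ^+ m)%:E| <= `|(G (V t) * wz 0 (V t) ^+ m)%:E|)%E.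
  apply: filterS ae0 => t a0 k _.
  rewrite lee_fin !normrM ler_wpM2l// !ger0_norm ?exprn_ge0 ?wz_ge0//.
  rewrite lerXn2r ?nnegrE ?wz_ge0//.
  by apply: wz_le_mono; [rewrite addr0|exact: ltW].
have [_ _ h] := dominated_convergence measurableT
  (fun k => (measurable_EFinP _ _).2 (mw _ (ltW (e_gt0 k))))
  ((measurable_EFinP _ _).2 (mw 0 (lexx _))) cvgae (integrable_abse iG) domae.
apply: (fine_cvg (a := \int[Q]_t (G (V t) * wz 0 (V t) ^+ m))).
rewrite fineK; first exact: h.
exact: integrable_fin_num iG.
Qed.

Let mwz m : measurable_fun setT (fun y => wz 0 y ^+ m).
Proof. by apply: measurable_funX; exact: measurable_wz. Qed.

Let w0_ge0 y m : 0 <= wz 0 y ^+ m. Proof. by rewrite exprn_ge0// wz_ge0. Qed.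

Lemma wz0_2_integrable : Q.-integrable setT (EFin \o (fun t => wz 0 (V t) ^+ 2)).
Proof.
have h : Q.-integrable setT (EFin \o (fun t => 1 * wz 0 (V t) ^+ 2)).
  apply: (@wz0_pow_integrable (fun=> 1) 1 wz2_bound) => // k.
    have h := wz_pow_integrable 2 (e_gt0 k).
    by apply: eq_integrable h => // t _ /=; rewrite mul1r.
  under eq_Rintegral do rewrite mul1r.
  exact: wz2_le.
by apply: eq_integrable h => // t _ /=; rewrite mul1r.
Qed.

Lemma wz0_3_integrable : Q.-integrable setT (EFin \o (fun t => wz 0 (V t) ^+ 3)).
Proof.
have h : Q.-integrable setT (EFin \o (fun t => 1 * wz 0 (V t) ^+ 3)).
  apply: (@wz0_pow_integrable (fun=> 1) 2 wz3_bound) => // k.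
    have h := wz_pow_integrable 3 (e_gt0 k).
    by apply: eq_integrable h => // t _ /=; rewrite mul1r.
  under eq_Rintegral do rewrite mul1r.
  exact: wz3_le.
by apply: eq_integrable h => // t _ /=; rewrite mul1r.
Qed.

Let aff1 y : aff 1 (qz *m 0) y = 1 :> R.
Proof. by rewrite mulmx0 /aff dotvC dotv0 addr0. Qed.

Lemma sqr_r_wz_integrable k m : Q.-integrable setT
    (EFin \o (fun t => sqr_r (V t) * wz (e k) (V t) ^+ m.+1)) /\
  \int[Q]_t (sqr_r (V t) * wz (e k) (V t) ^+ m.+1) =
  s%:R * tau ^+ 2 * \int[Q]_t (wz (e k) (V t) ^+ m.+1).
Proof.
have [||h1 h2] := @stein_residual (e k) m 1 0 (Num.sqrt (e k))^-1 (e_gt0 k).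
- by move=> y; rewrite aff1 normr1 mul1r; exact: wz_le.
- have h := wz_pow_integrable m.+1 (e_gt0 k).
  by apply: eq_integrable h => // t _ /=; rewrite aff1 mul1r.
have E t : aff 1 (qz *m 0) (V t) * wz (e k) (V t) ^+ m.+1 = wz (e k) (V t) ^+ m.+1.
  by rewrite aff1 mul1r.
split; first by apply: eq_integrable h1 => // t _ /=; rewrite E.
under eq_Rintegral do rewrite -E.
by rewrite h2; under eq_Rintegral do rewrite E.
Qed.

Lemma sqr_r_wz0_2_integrable :
  Q.-integrable setT (EFin \o (fun t => sqr_r (V t) * wz 0 (V t) ^+ 2)).
Proof.
apply: (@wz0_pow_integrable sqr_r 1
    (s%:R * tau ^+ 2 * wz2_bound)).
- exact: measurable_sqr_r.
- exact: sqr_r_ge0.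
- by move=> k; case: (sqr_r_wz_integrable k 1).
- move=> k; case: (sqr_r_wz_integrable k 1) => _ ->.
  apply: ler_wpM2l; first by rewrite mulr_ge0// ltW.
  exact: wz2_le.
Qed.

Lemma sqr_r_wz0_3_integrable :
  Q.-integrable setT (EFin \o (fun t => sqr_r (V t) * wz 0 (V t) ^+ 3)).
Proof.
apply: (@wz0_pow_integrable sqr_r 2
    (s%:R * tau ^+ 2 * wz3_bound)).
- exact: measurable_sqr_r.
- exact: sqr_r_ge0.
- by move=> k; case: (sqr_r_wz_integrable k 2).
- move=> k; case: (sqr_r_wz_integrable k 2) => _ ->.
  apply: ler_wpM2l; first by rewrite mulr_ge0// ltW.
  exact: wz3_le.
Qed.

Lemma wz0_1_integrable : Q.-integrable setT (EFin \o (fun t => wz 0 (V t))).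
Proof.
apply: (rintegrable_le _ (rintegrableD i1 wz0_2_integrable)).
  exact: (@measurable_along _ (mwz 1)).
move=> t; rewrite ger0_norm ?wz_ge0//.
by have := wz_ge0 qz mu 0 (V t); set w := wz 0 _; nra.
Qed.

Lemma xmu_wz0_2_integrable :
  Q.-integrable setT (EFin \o (fun t => xmu (V t) * wz 0 (V t) ^+ 2)).
Proof.
apply: (rintegrable_le _ (rintegrableZ mu_size wz0_1_integrable)).
  by apply: (@measurable_along (fun y => xmu y * wz 0 y ^+ 2));
    apply: measurable_funM => //; exact: measurable_xmu.
move=> t; rewrite normrM (ger0_norm (w0_ge0 _ _)) expr2 mulrA.
by rewrite ler_wpM2r ?wz_ge0// xmu_wz_le.
Qed.

Lemma xmu_wz0_4_integrable :
  Q.-integrable setT (EFin \o (fun t => xmu (V t) * wz 0 (V t) ^+ 4)).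
Proof.
apply: (rintegrable_le _ (rintegrableZ mu_size wz0_3_integrable)).
  by apply: (@measurable_along (fun y => xmu y * wz 0 y ^+ 4));
    apply: measurable_funM => //; exact: measurable_xmu.
move=> t; rewrite normrM (ger0_norm (w0_ge0 _ _)) (exprS _ 3) mulrA.
by rewrite ler_wpM2r// xmu_wz_le.
Qed.

Lemma sqr_r_xmu_wz0_4_integrable : Q.-integrable setT
  (EFin \o (fun t => sqr_r (V t) * xmu (V t) * wz 0 (V t) ^+ 4)).
Proof.
apply: (rintegrable_le _ (rintegrableZ mu_size sqr_r_wz0_3_integrable)).
  apply: (@measurable_along (fun y => sqr_r y * xmu y * wz 0 y ^+ 4)).
  apply: measurable_funM => //; apply: measurable_funM; first exact: measurable_sqr_r.
  exact: measurable_xmu.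
move=> t; rewrite normrM (ger0_norm (w0_ge0 _ _)) (exprS _ 3).
rewrite normrM (ger0_norm (sqr_r_ge0 _)).
rewrite [leRHS](_ : _ = sqr_r (V t) * (mu_size * wz 0 (V t) ^+ 3)); last by ring.
rewrite -mulrA ler_wpM2l ?sqr_r_ge0// mulrA.
by rewrite ler_wpM2r// xmu_wz_le.
Qed.

Lemma radial_wz0_integrable : Q.-integrable setT
  (EFin \o (fun t => (sqz (V t) - xmu (V t)) * wz 0 (V t) ^+ 2)).
Proof.
have h : Q.-integrable setT (EFin \o (fun t => sqz (V t) * wz 0 (V t) ^+ 2)).
  apply: (rintegrable_le _ i1).
    apply: (@measurable_along (fun y => sqz y * wz 0 y ^+ 2)).
    by apply: measurable_funM => //; exact: measurable_sqz.
  by move=> t; rewrite ger0_norm; [exact: sqz_wz_le|apply: mulr_ge0 => //; exact: sqz_ge0].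
have := rintegrableB h xmu_wz0_2_integrable.
by apply: eq_integrable => // t _ /=; rewrite mulrBl.
Qed.

Definition inv4_moment : R := \int[Q]_t (xmu (V t) * wz 0 (V t) ^+ 4).
Definition radial_moment : R :=
  \int[Q]_t ((sqz (V t) - xmu (V t)) * wz 0 (V t) ^+ 2).

Let cvg4 : (fun k => \int[Q]_t (xmu (V t) * wz (e k) (V t) ^+ 4)) @ \oo --> inv4_moment.
Proof.
apply: wz_pow_cvg_integral.
  exact: measurable_xmu.
exact: xmu_wz0_4_integrable.
Qed.

(** [stein_residual] for the weight x.mu, then [eps] to 0. *)
Lemma residual_moment :
  \int[Q]_t (sqr_r (V t) * xmu (V t) * wz 0 (V t) ^+ 4) = s%:R * tau ^+ 2 * inv4_moment.
Proof.
have h1 : (fun k => \int[Q]_t (sqr_r (V t) * xmu (V t) * wz (e k) (V t) ^+ 4)) @ \oo -->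
    \int[Q]_t (sqr_r (V t) * xmu (V t) * wz 0 (V t) ^+ 4).
  apply: (@wz_pow_cvg_integral (fun y => sqr_r y * xmu y)).
    by apply: measurable_funM; [exact: measurable_sqr_r|exact: measurable_xmu].
  exact: sqr_r_xmu_wz0_4_integrable.
have h2 : (fun k => \int[Q]_t (sqr_r (V t) * xmu (V t) * wz (e k) (V t) ^+ 4)) @ \oo -->
    s%:R * tau ^+ 2 * inv4_moment.
  rewrite (_ : (fun k => _) = (fun k => s%:R * tau ^+ 2 *
      \int[Q]_t (xmu (V t) * wz (e k) (V t) ^+ 4))).
    by apply: cvgM; [exact: cvg_cst|exact: cvg4].
  apply/funext => k.
  have E t : aff (dotv mu mu) (qz *m mu) (V t) * wz (e k) (V t) ^+ 4 =
    xmu (V t) * wz (e k) (V t) ^+ 4 by rewrite xmuE.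
  have [||_ h] := @stein_residual (e k) 3 (dotv mu mu) mu mu_size (e_gt0 k).
  - by move=> y; rewrite -xmuE xmu_wz_le// ltW.
  - have h := xmu_wz_pow_integrable 3 (e_gt0 k).
    by apply: eq_integrable h => // t _ /=; rewrite -E.
  under eq_Rintegral do rewrite -mulrA -E.
  rewrite h; congr (_ * _); apply: eq_Rintegral => t _; exact: E.
exact: (cvg_unique (@norm_hausdorff _ R) h1 h2).
Qed.

(** The smoothed form of this inequality chains the radial lower bounds for the
    powers 2 and 4 of [wz]; the second has the coefficient l - 4 >= 0 and says
    that E[x.mu wz^4] <= E[a wz^4]. *)
Lemma inv4_radial_le : tau ^+ 2 * (l%:R - 2) * inv4_moment <= radial_moment.
Proof.
have h1 : (fun k => tau ^+ 2 * (l%:R - 2) *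
    \int[Q]_t (xmu (V t) * wz (e k) (V t) ^+ 4)) @ \oo -->
    tau ^+ 2 * (l%:R - 2) * inv4_moment.
  by apply: cvgM; [exact: cvg_cst|exact: cvg4].
have h2 : (fun k => \int[Q]_t ((sqz (V t) - xmu (V t)) * wz (e k) (V t) ^+ 2)) @ \oo -->
    radial_moment.
  apply: (@wz_pow_cvg_integral (fun y => sqz y - xmu y)).
    by apply: measurable_funB; [exact: measurable_sqz|exact: measurable_xmu].
  exact: radial_wz0_integrable.
apply: (ler_cvg_to h1 h2); apply: nearW => k.
have e0 := e_gt0 k.
have r2 := radial_lower 1 e0.
have r4 := radial_lower 3 e0.
have j2 := wz_pow_integrable 2 e0.
have j4 := sqz_wz_pow_integrable 2 e0.
have jx := xmu_wz_pow_integrable 3 e0.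
have l4 : (4%:R : R) <= l%:R by rewrite ler_nat.
have I4 : 0 <= \int[Q]_t (wz (e k) (V t) ^+ 4).
  by apply: Rintegral_ge0 => t _; rewrite exprn_ge0 ?wz_ge0.
have p4 : 0 <= \int[Q]_t ((sqz (V t) - xmu (V t)) * wz (e k) (V t) ^+ 4).
  by apply: le_trans r4; rewrite !mulr_ge0 ?subr_ge0// ltW.
have : \int[Q]_t (xmu (V t) * wz (e k) (V t) ^+ 4) <= \int[Q]_t (wz (e k) (V t) ^+ 2).
  apply: (@le_trans _ _ (\int[Q]_t (sqz (V t) * wz (e k) (V t) ^+ 4))).
    rewrite -subr_ge0 -RintegralB//.
    by under eq_Rintegral do rewrite -mulrBl.
  apply: le_Rintegral => // t _.
  rewrite (exprD _ 2 2) mulrA ler_piMl ?sqr_ge0//.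
  by apply: sqz_wz_le; exact: ltW.
move=> h; apply: le_trans r2.
rewrite -[2 in leRHS]/(2%:R); apply: ler_wpM2l => //.
by rewrite mulr_ge0 ?ltW// subr_gt0 (lt_le_trans _ l4)// ltr_nat.
Qed.

(** * Positivity of the inverse fourth moment *)

Section positivity.
Hypothesis mu_gt0 : 0 < dotv mu mu.

Let F (eps : R) : R := \int[Q]_t (xmu (V t) * wz eps (V t) ^+ 4).

Let is_derive_F (eps : R) : 0 < eps ->
  is_derive eps 1 F (- 2 * \int[Q]_t (xmu (V t) * wz eps (V t) ^+ 6)).
Proof.
move=> e0.
pose f (x : R) t := xmu (V t) * wz x (V t) ^+ 4.
have dw (x : R) t : 0 < x -> is_derive x 1 (f ^~ t) (- 2 * (xmu (V t) * wz x (V t) ^+ 6)).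
  move=> x0.
  have h : is_derive x 1 (fun x : R => sqz (V t) + x) 1 by apply: is_derive_eq; ring.
  have a0 : 0 < sqz (V t) + x by rewrite ltr_wpDl ?sqz_ge0.
  have h' := is_derive_invsqrt_pow 4 a0 h.
  rewrite /f; apply: is_derive_eq.
  by rewrite /GRing.scale/= -/(wz _ _); set W := _ ^+ 6; field.
have d1 (x : R) t : 0 < x -> partial1of2 f x t = - 2 * (xmu (V t) * wz x (V t) ^+ 6).
  by move=> x0; have h := dw x t x0; rewrite /partial1of2 derive1E derive_val.
pose W := (Num.sqrt (eps / 2))^-1.
pose G (t : T) : R := 2 * (mu_size * W ^+ 5).
have e2 : 0 < eps / 2 by rewrite divr_gt0.
have W0 : 0 <= W by rewrite invr_ge0 sqrtr_ge0.
have G0 t : 0 <= G t by rewrite !mulr_ge0 ?mu_size_ge0// exprn_ge0.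
have Iin (x : R) : [set` `](eps / 2), (eps + 1)[] x -> 0 < x.
  by rewrite /= in_itv/= => /andP[h _]; exact: lt_trans h.
have Ie : [set` `](eps / 2), (eps + 1)[] eps.
  by rewrite /= in_itv/=; apply/andP; split; [lra|rewrite ltrDl].
have fi (x : R) : [set` `](eps / 2), (eps + 1)[] x ->
    Q.-integrable setT (EFin \o f x).
  by move=> /Iin x0; exact: xmu_wz_pow_integrable.
have fd (x : R) (t : T) : [set` `](eps / 2), (eps + 1)[] x -> setT t ->
    derivable (f ^~ t) x 1.
  by move=> /Iin x0 _; have h := dw x t x0; exact: ex_derive.
have iG : Q.-integrable setT (EFin \o G) by exact: finite_measure_integrable_cst.
have Gub (x : R) (t : T) : [set` `](eps / 2), (eps + 1)[] x -> setT t ->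
    `|partial1of2 f x t| <= G t.
  move=> Ix _; have x0 := Iin _ Ix; rewrite d1// normrM normrN (ger0_norm (ler0n _ 2)).
  rewrite ler_wpM2l// normrM (ger0_norm (exprn_ge0 _ (wz_ge0 _ _ _ _))).
  rewrite (exprS _ 5) mulrA ler_pM ?mulr_ge0 ?exprn_ge0 ?wz_ge0//.
    by rewrite xmu_wz_le// ltW.
  rewrite lerXn2r ?nnegrE ?wz_ge0//; apply: le_trans (wz_le _ _ _ x0) _.
  rewrite lef_pV2 ?posrE ?sqrtr_gt0// ler_sqrt ?ltW//.
  by move: Ix; rewrite /= in_itv/= => /andP[].
have dF := derivable_under_integral measurableT Ie fi fd G0 iG Gub.
have vF := differentiation_under_integral measurableT Ie fi fd G0 iG Gub.
have -> : - 2 * \int[Q]_t (xmu (V t) * wz eps (V t) ^+ 6) = 'D_1 F eps.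
  rewrite -derive1E vF -RintegralZl//; last exact: xmu_wz_pow_integrable.
  by apply: eq_Rintegral => t _; rewrite d1.
exact: derivableP.
Qed.

(** The second term is 2 tau^2 times the derivative of [F]. *)
Let F_ode (eps : R) : 0 < eps ->
  F eps = dotv mu mu * \int[Q]_t (wz eps (V t) ^+ 4) +
    2 * tau ^+ 2 * (- 2 * \int[Q]_t (xmu (V t) * wz eps (V t) ^+ 6)).
Proof.
move=> e0; rewrite /F (stein_mu 3 e0); ring.
Qed.

Let wz4_gt0 (eps : R) : 0 < eps -> 0 < \int[Q]_t (wz eps (V t) ^+ 4).
Proof.
move=> e0.
have wp t : 0 < wz eps (V t) ^+ 4.
  by rewrite exprn_gt0// invr_gt0 sqrtr_gt0 ltr_wpDl ?sqz_ge0.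
have iw := wz_pow_integrable 4 e0.
have I0 : 0 <= \int[Q]_t (wz eps (V t) ^+ 4) by apply: Rintegral_ge0 => t _; exact: ltW.
rewrite lt_neqAle I0 andbT; apply/eqP => E0.
have E : (\int[Q]_t `|(wz eps (V t) ^+ 4)%:E| = 0)%E.
  under eq_integral do rewrite /= ger0_norm ?ltW//.
  by rewrite -[LHS]fineK ?(integrable_fin_num measurableT iw)// -[fine _]/(Rintegral _ _ _) -E0.
have := (ae_eq_integral_abs Q measurableT (measurable_int Q iw)).1 E.
move=> [N [mN N0 sN]].
have : N = setT.
  rewrite -subTset => t _; apply: sN => /= /(_ I) [] /eqP.
  by rewrite gt_eqF.
move=> NT; have : Q setT = 0%E by rewrite -NT.
rewrite [LHS]probability_setT => /eqP.
by rewrite onee_eq0.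
Qed.

(** The integrating factor of the equation for [F]. *)
Let D (eps : R) : R := expR (- (eps / (2 * tau ^+ 2))) * F eps.

Let is_derive_D (eps : R) : 0 < eps -> is_derive eps 1 D
  (- (expR (- (eps / (2 * tau ^+ 2))) * (dotv mu mu * \int[Q]_t (wz eps (V t) ^+ 4)) /
      (2 * tau ^+ 2))).
Proof.
move=> e0; have h := is_derive_F e0.
have he : is_derive eps 1 (fun x : R => expR (- (x / (2 * tau ^+ 2))))
    (- (2 * tau ^+ 2)^-1 * expR (- (eps / (2 * tau ^+ 2)))).
  have h1 : is_derive eps 1 (fun x : R => - (x / (2 * tau ^+ 2))) (- (2 * tau ^+ 2)^-1).
    by apply: is_derive_eq; rewrite /GRing.scale/= mulr1 mulr0 add0r.
  by apply: (is_derive_eq (is_derive1_comp (is_derive_expR _) h1)); rewrite mulrC.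
apply: is_derive_eq; rewrite /GRing.scale/= (F_ode e0).
have t0 := lt0r_neq0 htau.
by field.
Qed.

Let D_decr (x y : R) : 0 < x -> x < y -> D y < D x.
Proof.
move=> x0 xy.
have dD z : x <= z -> derivable D z 1.
  by move=> xz; have h := is_derive_D (lt_le_trans x0 xz); exact: ex_derive.
apply: (@ltr0_derive1_decr _ D x y) => //.
- by move=> z; rewrite in_itv/= => /andP[/ltW xz _]; exact: dD.
- move=> z; rewrite in_itv/= => /andP[/ltW xz _].
  have z0 := lt_le_trans x0 xz.
  have h := is_derive_D z0; rewrite derive1E derive_val oppr_lt0.
  by rewrite divr_gt0 ?mulr_gt0 ?expR_gt0 ?wz4_gt0.
- apply: derivable_within_continuous => z; rewrite in_itv/= => /andP[xz _].
  exact: dD.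
Qed.

(** |x.mu| wz is bounded and the three other powers of [wz] are at most those of
    eps^(-1/2), here for eps = k + 1 >= 1. *)
Let F_bound (k : nat) : `|F k.+1%:R| <= mu_size / k.+1%:R.
Proof.
have k0 : 0 < k.+1%:R :> R by [].
have iw := xmu_wz_pow_integrable 3 k0.
apply: le_trans (le_normr_Rintegral measurableT iw) _.
have -> : mu_size / k.+1%:R = \int[Q]_(t in [set: T]) (mu_size / k.+1%:R).
  by rewrite Rintegral_cst// -[LHS]mulr1; congr (_ * _); exact/esym/(congr1 fine (probability_setT Q)).
apply: le_Rintegral => //.
- exact: integrable_norm iw.
- exact: finite_measure_integrable_cst.
move=> t _; set w := wz k.+1%:R (V t).
have w0 : 0 <= w by exact: wz_ge0.
rewrite normrM (ger0_norm (exprn_ge0 _ w0)) (exprS _ 3) mulrA.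
apply: ler_pM; [by rewrite mulr_ge0|by rewrite exprn_ge0| |].
  by apply: xmu_wz_le; exact: ltW.
have wS : w <= (Num.sqrt k.+1%:R)^-1 by exact: wz_le.
have S0 : 0 <= (Num.sqrt k.+1%:R)^-1 :> R by rewrite invr_ge0 sqrtr_ge0.
have S1 : (Num.sqrt k.+1%:R)^-1 <= 1 :> R.
  rewrite invf_le1 ?sqrtr_gt0// -[leLHS]sqrtr1 ler_sqrt ?ler1n//.
apply: (@le_trans _ _ ((Num.sqrt k.+1%:R)^-1 ^+ 2)).
  rewrite exprS expr2 -[leRHS]mul1r; apply: ler_pM => //.
  - by rewrite mulr_ge0.
  - exact: le_trans S1.
  - by apply: ler_pM.
by rewrite exprVn sqr_sqrtr// ltW.
Qed.

(** A negative value would persist, by monotonicity, beyond the point where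
    [F_bound] makes [F] smaller in absolute value. *)
Let D_ge0 (x : R) : 0 < x -> 0 <= D x.
Proof.
move=> x0; rewrite leNgt; apply/negP => Dx.
pose k := Num.truncn (Num.max x (mu_size / - D x)).
have k1 : Num.max x (mu_size / - D x) < k.+1%:R by exact: truncnS_gt.
move: k1; rewrite gt_max => /andP[xk Nk].
have := D_decr x0 xk; rewrite ltNge => /negP; apply.
have k0 : 0 < k.+1%:R :> R by [].
have h := F_bound k.
have h1 : mu_size / k.+1%:R <= - D x.
  by rewrite ler_pdivrMr// mulrC -ler_pdivrMr ?oppr_gt0// ltW.
have E1 : expR (- (k.+1%:R / (2 * tau ^+ 2))) <= 1.
  by rewrite -expR0 ler_expR oppr_le0 divr_ge0// mulr_ge0// ltW.
rewrite -lerN2; apply: le_trans (le_trans h h1).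
rewrite /D -mulrN; apply: le_trans (ler_norm _) _.
by rewrite normrM normrN ger0_norm ?expR_ge0// ler_piMl.
Qed.

(** [D 1] is positive and, for [eps] below 1, bounds [D eps] and hence [F eps]
    from below; it therefore bounds the limit. *)
Lemma inv4_moment_gt0 : 0 < inv4_moment.
Proof.
have D1 : 0 < D 1 by apply: le_lt_trans (D_ge0 _) (D_decr (_ : 0 < 1) (_ : 1 < 2)); rewrite ?ltr1n.
apply: (lt_le_trans D1).
have h : (fun k => F (e k)) @ \oo --> inv4_moment.
  apply: wz_pow_cvg_integral.
    exact: measurable_xmu.
  exact: xmu_wz0_4_integrable.
apply: (cvgr_to_ge h); near=> k.
have k0 : (0 < k)%N by near: k; exact: nbhs_infty_gt.
have DD : D 1 <= D (e k).
  by apply/ltW/D_decr => //; rewrite invf_lt1// ltr1n ltnS.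
apply: le_trans DD _.
have Fe : 0 <= F (e k).
  by have := D_ge0 (e_gt0 k); rewrite /D pmulr_rge0// expR_gt0.
rewrite -[leRHS]mul1r; apply: ler_wpM2r => //.
by rewrite -expR0 ler_expR oppr_le0 divr_ge0 ?mulr_ge0// ltW.
Unshelve. all: by end_near. Qed.

End positivity.

(** * Bias of the two estimators *)

Notation w0 := (wz 0).

(** The coefficients of the residuals in the estimation errors: [fit_z] and
    [fit_r] are the entries of q_z x and q_r r, and the weights below are their
    combinations in the closed forms of the estimators. *)
Definition fit_z i (y : 'cV[R]_n) : R := (qz *m xz y) i 0.
Definition fit_r i (y : 'cV[R]_n) : R := (qr *m (qr^T *m y)) i 0.

Lemma measurable_fit_z i : measurable_fun setT (fit_z i).
Proof.
rewrite (_ : fit_z i = fun y => \sum_j qz i j * xz y j 0).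
  by apply: measurable_sum => j; apply: measurable_funM => //; exact: measurable_xz_entry.
by apply/funext => y; rewrite /fit_z mxE.
Qed.

Lemma measurable_fit_r i : measurable_fun setT (fit_r i).
Proof.
rewrite (_ : fit_r i = fun y => \sum_j qr i j * dotv (col j qr) y).
  by apply: measurable_sum => j; apply: measurable_funM => //; exact: measurable_dotv.
by apply/funext => y; rewrite /fit_r mxE; apply: eq_bigr => j _; rewrite dotv_col.
Qed.

Lemma fit_z_le i y : `|fit_z i y| * w0 y <= \sum_j `|qz i j|.
Proof.
rewrite /fit_z mxE; apply: le_trans (ler_wpM2r (wz_ge0 _ _ _ _) (ler_norm_sum _ _ _)) _.
rewrite mulr_suml; apply: ler_sum => j _; rewrite normrM -mulrA ler_piMr//.
exact: xz_wz_le.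
Qed.

Lemma fit_r_le i y : `|fit_r i y| <= (\sum_j `|qr i j|) * (1 + sqr_r y).
Proof.
rewrite /fit_r mxE; apply: le_trans (ler_norm_sum _ _ _) _.
rewrite mulr_suml; apply: ler_sum => j _; rewrite normrM ler_wpM2l//.
set v := (qr^T *m y) j 0.
have h : v ^+ 2 <= sqr_r y.
  rewrite /v /sqr_r /dotv (bigD1 j)//= -expr2 lerDl.
  by apply: sumr_ge0 => k _; rewrite -expr2 sqr_ge0.
apply: le_trans (lerD (lexx 1) h).
have -> : v ^+ 2 = `|v| ^+ 2 by rewrite -normrX ger0_norm// sqr_ge0.
by set a := `|v|; nra.
Qed.

Lemma fit_z_integrable i m : (0 < m)%N ->
  Q.-integrable setT (EFin \o (fun t => w0 (V t) ^+ m)) ->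
  Q.-integrable setT (EFin \o (fun t => fit_z i (V t) * w0 (V t) ^+ m.+1)).
Proof.
move=> m0 iw; apply: (rintegrable_le _ (rintegrableZ (\sum_j `|qz i j|) iw)).
  apply: (@measurable_along (fun y => fit_z i y * w0 y ^+ m.+1)).
  by apply: measurable_funM => //; exact: measurable_fit_z.
move=> t; rewrite normrM (ger0_norm (w0_ge0 _ _)) exprS mulrA ler_wpM2r//.
exact: fit_z_le.
Qed.

Definition weight_2sls i (y : 'cV[R]_n) : R := fit_z i y * w0 y ^+ 2.
Definition weight_hat (p : R) i (y : 'cV[R]_n) : R :=
  weight_2sls i y + p * (fit_z i y * (sqr_r y * w0 y ^+ 4) - fit_r i y * w0 y ^+ 2).

Lemma measurable_weight_2sls i : measurable_fun setT (weight_2sls i).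
Proof. by apply: measurable_funM => //; exact: measurable_fit_z. Qed.

Lemma measurable_weight_hat p i : measurable_fun setT (weight_hat p i).
Proof.
apply: measurable_funD; first exact: measurable_weight_2sls.
apply: measurable_funM => //; apply: measurable_funB; apply: measurable_funM => //.
- exact: measurable_fit_z.
- by apply: measurable_funM => //; exact: measurable_sqr_r.
- exact: measurable_fit_r.
Qed.

Lemma weight_2sls_integrable i :
  Q.-integrable setT (EFin \o (fun t => weight_2sls i (V t))).
Proof.
exact: (@fit_z_integrable i 1 isT wz0_1_integrable).
Qed.

Lemma weight_hat_integrable p i :
  Q.-integrable setT (EFin \o (fun t => weight_hat p i (V t))).
Proof.
apply: rintegrableD; first exact: weight_2sls_integrable.
apply: rintegrableZ; apply: rintegrableB.
  apply: (rintegrable_le _ (rintegrableZ (\sum_j `|qz i j|) sqr_r_wz0_3_integrable)).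
    apply: (@measurable_along (fun y => fit_z i y * (sqr_r y * w0 y ^+ 4))).
    apply: measurable_funM; first exact: measurable_fit_z.
    by apply: measurable_funM => //; exact: measurable_sqr_r.
  move=> t; rewrite normrM normrM (ger0_norm (w0_ge0 _ 4)) (ger0_norm (sqr_r_ge0 _)).
  rewrite (exprS _ 3).
  rewrite [leLHS](_ : _ = `|fit_z i (V t)| * w0 (V t) * (sqr_r (V t) * w0 (V t) ^+ 3)); last by ring.
  apply: ler_wpM2r; last exact: fit_z_le.
  by apply: mulr_ge0 => //; exact: sqr_r_ge0.
apply: (rintegrable_le _ (rintegrableZ (\sum_j `|qr i j|) (rintegrableD wz0_2_integrable sqr_r_wz0_2_integrable))).
  apply: (@measurable_along (fun y => fit_r i y * w0 y ^+ 2)).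
  by apply: measurable_funM => //; exact: measurable_fit_r.
move=> t; rewrite normrM (ger0_norm (w0_ge0 _ 2)).
apply: le_trans (ler_wpM2r (w0_ge0 _ 2) (fit_r_le _ _)) _.
by rewrite -mulrA mulrDl mul1r.
Qed.

Let resid_sum (g : 'I_n -> 'cV[R]_n -> R) :
  (forall i, measurable_fun setT (g i)) ->
  (forall i, Q.-integrable setT (EFin \o (fun t => g i (V t)))) ->
  Q.-integrable setT (EFin \o (fun t =>
    \sum_i resid i t * g i (V t))) /\
  \int[Q]_t (\sum_i resid i t * g i (V t)) = 0.
Proof.
move=> mg ig.
have h i := resid_expectation0 i (mg i) (ig i).
split; first by apply: rintegrable_sum => i; case: (h i).
rewrite Rintegral_sum; last by move=> i; case: (h i).
by rewrite big1// => i _; case: (h i).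
Qed.

Definition err_2sls t : R :=
  kap * ((sqz (V t) - xmu (V t)) * w0 (V t) ^+ 2) +
  \sum_i resid i t * weight_2sls i (V t).

Definition err_hat (p : R) t : R :=
  kap * ((sqz (V t) - xmu (V t)) * w0 (V t) ^+ 2 -
         p * (sqr_r (V t) * xmu (V t) * w0 (V t) ^+ 4)) +
  \sum_i resid i t * weight_hat p i (V t).

Notation B2 := radial_moment.
Notation M := inv4_moment.

Lemma err_2sls_expectation : Q.-integrable setT (EFin \o err_2sls) /\
  \int[Q]_t err_2sls t = kap * B2.
Proof.
have irad := radial_wz0_integrable.
have [h1 h2] := resid_sum measurable_weight_2sls weight_2sls_integrable.
split; first by apply: rintegrableD => //; exact: rintegrableZ.
rewrite RintegralD//; last exact: rintegrableZ.
by rewrite h2 addr0 RintegralZl.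
Qed.

Lemma err_hat_expectation p : Q.-integrable setT (EFin \o err_hat p) /\
  \int[Q]_t err_hat p t = kap * (B2 - p * (s%:R * tau ^+ 2 * M)).
Proof.
have irad := radial_wz0_integrable.
have ires := sqr_r_xmu_wz0_4_integrable.
have [h1 h2] := resid_sum (measurable_weight_hat p) (weight_hat_integrable p).
have h3 := rintegrableZ p ires.
have h4 := rintegrableB radial_wz0_integrable h3.
split; first by apply: rintegrableD => //; exact: rintegrableZ.
rewrite RintegralD//; last exact: rintegrableZ.
rewrite h2 addr0 RintegralZl// RintegralB// RintegralZl//.
by rewrite residual_moment.
Qed.

(** U = kappa V + e, paired with a vector of the span of the columns of [A]. *)
Lemma noise_split k (A : 'M[R]_(n, k)) (x : 'cV[R]_k) t :
  dotv x (A^T *m U t) = kap * dotv x (A^T *m V t) +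
    \sum_i resid i t * (A *m x) i 0.
Proof.
rewrite -!dotv_trmx /dotv mulr_sumr -big_split; apply: eq_bigr => i _ /=.
by rewrite /resid; ring.
Qed.

Lemma fit_zE t : dotv (xz (V t)) (qz^T *m U t) =
  kap * (sqz (V t) - xmu (V t)) + \sum_i resid i t * fit_z i (V t).
Proof. by rewrite noise_split xz_noise. Qed.

Lemma fit_rE t : dotv (qr^T *m V t) (qr^T *m U t) =
  kap * sqr_r (V t) + \sum_i resid i t * fit_r i (V t).
Proof. by rewrite noise_split. Qed.

Lemma beta_2sls_err (beta : R) t : 0 < sqz (V t) ->
  let x := col_mx (xz (V t)) (qr^T *m V t) in
  let y := beta *: x + col_mx (qz^T *m U t) (qr^T *m U t) in
  beta_2sls y x = beta + err_2sls t.
Proof.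
move=> a0 x y.
have yE : y = col_mx (beta *: xz (V t) + qz^T *m U t)
    (beta *: (qr^T *m V t) + qr^T *m U t).
  by rewrite /y /x scale_col_mx add_col_mx.
rewrite yE /x beta_2slsE dotvDr dotvZr -/(sqz _) fit_zE.
have an0 := lt0r_neq0 a0.
rewrite mulrDl mulfK//; congr (_ + _).
have -> : (sqz (V t))^-1 = w0 (V t) ^+ 2.
  by rewrite -[LHS]mul1r -(sqz_wz0 a0) mulrAC divff// mul1r.
rewrite /err_2sls mulrDl mulrA mulr_suml; congr (_ + _).
by apply: eq_bigr => i _; rewrite /weight_2sls mulrA.
Qed.

Lemma beta_hat_err (p beta : R) t : 0 < p -> 0 < sqz (V t) -> 0 < sqr_r (V t) ->
  let x := col_mx (xz (V t)) (qr^T *m V t) in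
  let y := beta *: x + col_mx (qz^T *m U t) (qr^T *m U t) in
  beta_hat p y x = beta + err_hat p t.
Proof.
move=> p0 a0 b0 x y.
have yE : y = col_mx (beta *: xz (V t) + qz^T *m U t)
    (beta *: (qr^T *m V t) + qr^T *m U t).
  by rewrite /y /x scale_col_mx add_col_mx.
rewrite yE /x beta_hatE beta_hat_momentsE//.
rewrite -/(sqz (V t)) -/(sqr_r (V t)).
rewrite !(dotvDr _ (beta *: _)) !dotvZr -/(sqz (V t)) -/(sqr_r (V t)) fit_zE fit_rE.
rewrite /err_hat.
have an0 := lt0r_neq0 a0.
have wE : w0 (V t) ^+ 2 = (sqz (V t))^-1.
  by rewrite -[RHS]mul1r -(sqz_wz0 a0) mulrAC divff// mul1r.
have w4E : w0 (V t) ^+ 4 = (sqz (V t))^-1 ^+ 2 by rewrite -wE -exprM.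
have -> : \sum_i resid i t * weight_hat p i (V t) =
    \sum_i ((resid i t * fit_z i (V t)) *
      (w0 (V t) ^+ 2 + p * (sqr_r (V t) * w0 (V t) ^+ 4)) -
    (resid i t * fit_r i (V t)) * (p * w0 (V t) ^+ 2)).
  by apply: eq_bigr => i _; rewrite /weight_hat /weight_2sls; ring.
rewrite sumrB -!mulr_suml w4E wE; set S1 := \sum_i _; set S2 := \sum_i _.
by field.
Qed.

Lemma sqr_r_gt0_ae : (1 <= s)%N -> \forall t \ae Q, 0 < sqr_r (V t).
Proof.
move=> hs; have j : 'I_s by exact: Ordinal hs.
have null := hyperplane_null 0 (col_neq0 j qrr).
exists [set t | \sum_i (col j qr) i 0 * V t i 0 = 0]; split => //.
- rewrite -[X in measurable X]setTI.
  exact: (measurable_along (measurable_dotv (col j qr)) measurableT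
    (measurable_set1 (0 : R))).
- move=> t /= /negP; rewrite -leNgt => b0.
  have : (qr^T *m V t) j 0 == 0.
    rewrite -normr_le0; apply: le_trans (entry_le_norm _ _) _.
    by rewrite ler0_sqrtr.
  by rewrite -dotv_col => /eqP.
Qed.

End gaussian_noise.

Theorem theorem1 (R : realType) (n k l s : nat)
    (hn : n = (1 + k + l + s)%N) (hs : (1 <= s)%N) (hl : (4 <= l)%N)
    (d : measure_display) (T : measurableType d) (P : probability T R)
    (Y X : {RV P >-> 'cV[R]_n}) (Z : {RV P >-> 'M[R]_(n, l)})
    (W : {RV P >-> 'M[R]_(n, k)}) (U V : {RV P >-> 'cV[R]_n})
    (K : 'M[R]_(n, l) * 'M[R]_(n, k) -> probability T R)
    (alpha alphaX beta : R) (gamma gammaX : 'cV[R]_k) (ppi : 'cV[R]_l)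
    (sigma tau rho : R)
    (hsigma : 0 < sigma) (htau : 0 < tau) (hrho : -1 < rho < 1)
    (hmodel : iv_model Y X Z W U V K
                alpha alphaX beta gamma gammaX ppi sigma tau rho)
    (z : 'M[R]_(n, l)) (w : 'M[R]_(n, k))
    (hrank : \rank (design_mx z w) = (1 + k + l)%N)
    (q1 : 'cV[R]_n) (qw : 'M[R]_(n, k)) (qz : 'M[R]_(n, l))
    (qr : 'M[R]_(n, s)) (hq : canonical_basis z w q1 qw qz qr)
    (p : R) (hp : 0 < p < 2 * ((l%:R - 2) / s%:R)) :
  let Xs t := canonical_form qz qr (X t) in
  let Ys t := canonical_form qz qr (Y t) in
  let mu : 'cV[R]_l := qz^T *m z *m ppi in
  let bhat t := beta_hat p (Ys t) (Xs t) in
  let b2sls t := beta_2sls (Ys t) (Xs t) in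
  [/\ (K (z, w)).-integrable [set: T] (EFin \o bhat),
      (K (z, w)).-integrable [set: T] (EFin \o b2sls),
      rho != 0 -> l2norm mu != 0 ->
        (`|'E_(K (z, w))[bhat] - beta%:E| <
         `|'E_(K (z, w))[b2sls] - beta%:E|)%E
    & rho = 0 \/ l2norm mu = 0 ->
        (`|'E_(K (z, w))[bhat] - beta%:E| =
         `|'E_(K (z, w))[b2sls] - beta%:E|)%E].
Proof.
move=> Xs Ys mu bhat b2sls.
case: hmodel => hY hX _ [_ _ hK1] hnoise.
have [hind hlaw] := hnoise (z, w).
set Q := K (z, w) in hind hlaw *.
have [[qzz qrr qzr] [z1 zw r1 rw rz]] := canonical_basisP hq.
have /andP[p0 pub] := hp.
have mX : measurable_fun setT X by exact: measurable_funP.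
have mY : measurable_fun setT Y by exact: measurable_funP.
(* The basis removes the intercept and the controls; in the first block the
   instruments contribute [mu], in the second nothing. *)
have XsE t : Z t = z -> W t = w ->
    Xs t = col_mx (xz qz mu (V t)) (qr^T *m V t).
  move=> Zt Wt.
  have XE : X t = alphaX *: (const_mx 1 : 'cV[R]_n) + z *m ppi + w *m gammaX + V t.
    apply/colP => i; rewrite hX Zt Wt -!row_mul !mxE mulr1.
    by [].
  rewrite /Xs /canonical_form XE !mulmxDr -!scalemxAr z1 r1 !scaler0 !add0r !mulmxA.
  by rewrite zw rw rz !mul0mx !addr0 add0r.
have YsE t : Z t = z -> W t = w ->
    Ys t = beta *: Xs t + col_mx (qz^T *m U t) (qr^T *m U t).
  move=> Zt Wt.
  have YE : Y t = alpha *: (const_mx 1 : 'cV[R]_n) + beta *: X t + w *m gamma + U t.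
    apply/colP => i; rewrite hY Wt -row_mul !mxE mulr1.
    by rewrite (mulrC (X t i 0)).
  rewrite /Ys /Xs /canonical_form YE !mulmxDr -!scalemxAr z1 r1 !scaler0 !add0r !mulmxA.
  by rewrite zw rw !mul0mx !addr0 scale_col_mx add_col_mx.
(* [Q] is carried by the event that the design is (z, w). *)
have aeZW : \forall t \ae Q, Z t = z /\ W t = w.
  pose S := (fun t => (Z t, W t)) @^-1` [set (z, w)].
  have mS : measurable S.
    rewrite (_ : S = (Z @^-1` [set z]) `&` (W @^-1` [set w])).
      by apply: measurableI; rewrite -[X in measurable X]setTI;
        apply: measurable_funP => //; exact: measurable_mx_set1.
    apply/seteqP; split => t /=; first by move=> E; split; congruence.
    by move=> [Zt Wt]; congr pair.
  exists (~` S); split; first exact: measurableC.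
    by rewrite probability_setC// [X in (1 - X)%E](hK1 (z, w)) subee.
  by move=> t /= h St; apply: h; case: St => -> ->.
have ae_a := sqz_gt0_ae hsigma htau hrho hind hlaw mu qzz hl.
have ae_b := sqr_r_gt0_ae hsigma htau hrho hind hlaw qrr hs.
have [i_hat E_hat] := err_hat_expectation hsigma htau hrho hind hlaw mu qzz qrr qzr hl p.
have [i_2sls E_2sls] := err_2sls_expectation hsigma htau hrho hind hlaw mu qzz hl.
have ic : Q.-integrable setT (EFin \o (fun=> beta)) by exact: finite_measure_integrable_cst.
have bhatE t : bhat t = beta_hat_moments p
    (dotv (qz^T *m X t) (qz^T *m X t)) (dotv (qr^T *m X t) (qr^T *m X t))
    (dotv (qz^T *m X t) (qz^T *m Y t)) (dotv (qr^T *m X t) (qr^T *m Y t)).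
  exact: beta_hatE.
have b2slsE t : b2sls t = dotv (qz^T *m X t) (qz^T *m Y t) / dotv (qz^T *m X t) (qz^T *m X t).
  exact: beta_2slsE.
have mmul m (A : 'M[R]_(m, n)) (x : T -> 'cV[R]_n) := @measurable_mulmx _ _ T _ _ _ A x.
have m_hat : measurable_fun setT bhat.
  rewrite (_ : bhat = fun t => beta_hat_moments p
    (dotv (qz^T *m X t) (qz^T *m X t)) (dotv (qr^T *m X t) (qr^T *m X t))
    (dotv (qz^T *m X t) (qz^T *m Y t)) (dotv (qr^T *m X t) (qr^T *m Y t))); last first.
    by apply/funext.
  by apply: measurable_beta_hat_moments; apply: measurable_dotv2; exact: measurable_mulmx.
have m_2sls : measurable_fun setT b2sls.
  rewrite (_ : b2sls = fun t => dotv (qz^T *m X t) (qz^T *m Y t) *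
     (dotv (qz^T *m X t) (qz^T *m X t))^-1); last first.
    by apply/funext.
  apply: measurable_funM; last apply: measurable_fun_invr;
    by apply: measurable_dotv2; exact: measurable_mulmx.
have ae_hat : \forall t \ae Q, bhat t = beta + err_hat U V sigma tau rho qz qr mu p t.
  apply: filterS3 aeZW ae_a ae_b => t [Zt Wt] a0 b0.
  rewrite /bhat YsE// XsE//.
  exact: beta_hat_err.
have ae_2sls : \forall t \ae Q, b2sls t = beta + err_2sls U V sigma tau rho qz mu t.
  apply: filterS2 aeZW ae_a => t [Zt Wt] a0.
  rewrite /b2sls YsE// XsE//.
  exact: beta_2sls_err.
have [ib_hat Eb_hat] := rintegrable_ae_eq m_hat (rintegrableD ic i_hat) ae_hat.
have [ib_2sls Eb_2sls] := rintegrable_ae_eq m_2sls (rintegrableD ic i_2sls) ae_2sls.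
have kE (c : R) (g : T -> R) : Q.-integrable setT (EFin \o g) ->
    \int[Q]_t g t = c -> (\int[Q]_t (beta + g t)%:E = (beta + c)%:E)%E.
  move=> ig gc; rewrite integral_EFinE; last exact: rintegrableD.
  rewrite RintegralD// gc; congr (_ + _)%:E.
  by rewrite Rintegral_cst// -[RHS]mulr1; congr (_ * _);
    exact: (congr1 fine (probability_setT Q)).
have Ebhat : ('E_Q[bhat] - beta%:E = (slope sigma tau rho *
    (radial_moment Q V qz mu - p * (s%:R * tau ^+ 2 * inv4_moment Q V qz mu)))%:E)%E.
  rewrite unlock [X in (X - _)%E](etrans Eb_hat (kE _ _ i_hat E_hat)).
  by rewrite -EFinB addrAC subrr add0r.
have Eb2sls : ('E_Q[b2sls] - beta%:E =
    (slope sigma tau rho * radial_moment Q V qz mu)%:E)%E.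
  rewrite unlock [X in (X - _)%E](etrans Eb_2sls (kE _ _ i_2sls E_2sls)).
  by rewrite -EFinB addrAC subrr add0r.
rewrite Ebhat Eb2sls; split => //.
- move=> rho0 mu0.
  have mu_gt0 : 0 < dotv mu mu.
    by rewrite -l2norm_sqr exprn_even_gt0.
  have M0 := inv4_moment_gt0 hsigma htau hrho hind hlaw qzz hl mu_gt0.
  have MB := inv4_radial_le hsigma htau hrho hind hlaw mu qzz hl.
  set M := inv4_moment _ _ _ _ in M0 MB *; set B := radial_moment _ _ _ _ in MB *.
  have t2 : 0 < tau ^+ 2 by rewrite exprn_gt0.
  have l2 : 0 < l%:R - 2 :> R by rewrite subr_gt0 ltr_nat (leq_trans _ hl).
  have s0 : 0 < s%:R :> R by rewrite ltr0n.
  have k0 : slope sigma tau rho != 0 by rewrite /slope !mulf_neq0 ?invr_eq0// lt0r_neq0.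
  have ps : p * s%:R < 2 * (l%:R - 2) by rewrite -ltr_pdivlMr// -mulrA.
  have tM : 0 < tau ^+ 2 * M by rewrite mulr_gt0.
  have psM : p * (s%:R * tau ^+ 2 * M) < 2 * B.
    apply: (@lt_le_trans _ _ (2 * (tau ^+ 2 * (l%:R - 2) * M))); last by rewrite ler_pM2l.
    rewrite (_ : p * _ = p * s%:R * (tau ^+ 2 * M)); last by ring.
    rewrite (_ : 2 * (_ * M) = 2 * (l%:R - 2) * (tau ^+ 2 * M)); last by ring.
    by rewrite ltr_pM2r.
  have ps0 : 0 < p * (s%:R * tau ^+ 2 * M) by rewrite -mulrA !mulr_gt0.
  have B0 : 0 < B by apply: lt_le_trans MB; rewrite !mulr_gt0.
  rewrite /= lte_fin (normrM _ (B - _)) (normrM _ B) ltr_pM2l ?normr_gt0// (gtr0_norm B0).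
  exact: normrB_lt.
- case=> [->|mu0].
    by rewrite /slope !mul0r.
  have mu_eq0 : mu = 0.
    apply/colP => j; rewrite [RHS]mxE; apply/eqP; rewrite -normr_le0.
    by apply: le_trans (entry_le_norm _ _) _; rewrite -l2norm_sqr mu0 expr0n sqrtr0.
  have -> : inv4_moment Q V qz mu = 0.
    rewrite /inv4_moment -[RHS](mul0r (fine (Q setT))) -Rintegral_cst//.
    by apply: eq_Rintegral => t _; rewrite mu_eq0 /xmu dotv0 mul0r.
  by rewrite !mulr0 subr0.
Qed.
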